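(* Let $N\ge1$ be an integer, $s\in(0,1)$, and let $\Omega\subset\mathbb{R}^N$ be an open set such that the embedding $\mathcal{D}^{s,2}_0(\Omega)\hookrightarrow L^2(\Omega)$ is compact. Then there exists $q_\Omega\in(2,2^*_s)$ such that, for all $q\in(2,q_\Omega)$, $\lambda_1(\Omega,s,q)$ is simple, i.e., all the eigenfunctions corresponding to $\lambda_1(\Omega,s,q)$ are mutually proportional.
   Context: For a function $u$ on $\mathbb{R}^N$ write $[u]^2=\int_{\mathbb{R}^N}\int_{\mathbb{R}^N}\frac{(u(x)-u(y))^2}{|x-y|^{N+2s}}\,dx\,dy$. Functions in $C_0^\infty(\Omega)$ (smooth, compactly supported in $\Omega$) are extended by $0$ to $\mathbb{R}^N\setminus\Omega$. $\mathcal{D}^{s,2}_0(\Omega)$ is the completion of $C_0^\infty(\Omega)$ with respect to the norm $[\cdot]$; under the embedding assumption it is identified with a space of functions, extended by $0$ outside $\Omega$. $2^*_s=2N/(N-2s)$ if $2s<N$ and $2^*_s=+\infty$ otherwise. $\lambda_1(\Omega,s,q)=\inf\{[\varphi]^2:\varphi\in C_0^\infty(\Omega),\ \int_\Omega|\varphi|^q\,dx=1\}$. An eigenfunction corresponding to $\lambda=\lambda_1(\Omega,s,q)$ is a non-trivial $u\in\mathcal{D}^{s,2}_0(\Omega)$ with $$\int_{\mathbb{R}^N}\int_{\mathbb{R}^N}\frac{(u(x)-u(y))(\varphi(x)-\varphi(y))}{|x-y|^{N+2s}}\,dx\,dy=\lambda\|u\|_{L^q(\Omega)}^{2-q}\int_\Omega|u|^{q-2}u\,\varphi\,dx\quad\text{for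 all }\varphi\in\mathcal{D}^{s,2}_0(\Omega).$$ *)

(* Defs.v *)
From HB Require Import structures.
From mathcomp Require Import all_boot all_order all_algebra.
From mathcomp Require Import all_classical all_reals all_analysis.
From mathcomp Require Import measurable_realfun.

Set Implicit Arguments.
Unset Strict Implicit.
Unset Printing Implicit Defensive.
Import Order.TTheory GRing.Theory Num.Theory.
Import numFieldNormedType.Exports.

Local Open Scope classical_set_scope.
Local Open Scope ring_scope.

Definition rV_display : measure_display -> measure_display.
Proof. exact. Qed.

Section borel_rV.
Context {R : realType} {n : nat}.

Let B : set (set 'rV[R]_n) := <<s open >>.

Let B0 : B set0. Proof. exact: sigma_algebra0. Qed.

Let BC A : B A -> B (~` A). Proof. exact: sigma_algebraC. Qed.

Let BU (F : (set 'rV[R]_n)^nat) : (forall i, B (F i)) -> B (\bigcup_i F i).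
Proof. exact: sigma_algebra_bigcup. Qed.

HB.instance Definition _ := @isMeasurable.Build
  (rV_display default_measure_display) 'rV[R]_n B B0 BC BU.

End borel_rV.

Section measurable_rV.
Context {R : realType}.

Lemma open_measurable_rV n (U : set 'rV[R]_n) : open U -> measurable U.
Proof. by move=> oU; exact: sub_sigma_algebra. Qed.

Lemma measurable_coord n (i : 'I_n) :
  measurable_fun [set: 'rV[R]_n] (fun x => x 0 i : measurableTypeR R).
Proof.
apply: (measurability _ (RGenOpens.measurableE R)) => _ [_ [a [b ->] <-]].
rewrite setTI; apply: open_measurable_rV.
apply: open_comp; last exact: interval_open.
by move=> x _; exact: coord_continuous.
Qed.

Lemma measurable_fun_rVP d (T : measurableType d) n (f : T -> 'rV[R]_n) :
  measurable_fun setT f <->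
  forall i, measurable_fun setT (fun t => f t 0 i : measurableTypeR R).
Proof.
split=> [mf i|mf].
  exact: (measurableT_comp (measurable_coord i) mf).
apply: (@measurability _ _ _ _ setT f open) => //= _ [U oU <-]; rewrite setTI.
pose Bx (c : 'rV[rat]_n * rat) : set 'rV[R]_n := 
    ball (map_mx ratr c.1 : 'rV[R]_n) (ratr c.2).
have -> : f @^-1` U = \bigcup_(c in [set c | Bx c `<=` U]) (f @^-1` Bx c).
  apply/seteqP; split => [t /= Uft|t [c /= cU /cU]//].
  have /nbhs_ballP[_/posnumP[e] eU] : nbhs (f t) U by exact: open_nbhs_nbhs.
  have [r /andP[r0 re]] : exists r : rat, (0 : R) < ratr r < e%:num / 2.
    have [r] := rat_in_itvoo (divr_gt0 (gt0 e) (ltr0Sn R 1)).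
    by rewrite in_itv/= => ?; exists r.
  have qP i : exists q : rat, `|ratr q - f t 0 i| < ratr r.
    have : f t 0 i - ratr r < f t 0 i + ratr r by rewrite ltrD2l gtrN.
    move=> /rat_in_itvoo[q]; rewrite in_itv/= => /andP[q1 q2].
    by exists q; rewrite ltr_distl q1 q2.
  pose q i := projT1 (cid (qP i)).
  have qE i : `|ratr (q i) - f t 0 i| < ratr r := projT2 (cid (qP i)).
  exists (\row_i q i, r) => /=.
    move=> y [_ yb]; apply: eU; split => // i j; rewrite ord1.
    have := yb ord0 j; rewrite /ball/= !mxE => yj.
    rewrite /ball_ -(subrKA (ratr (q j))) (le_lt_trans (ler_normD _ _))//.
    rewrite (splitr e%:num) ltrD//; last exact: lt_trans yj _.
    by rewrite distrC (lt_trans (qE j)).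
  by split=> // i j; rewrite ord1 !mxE; exact: qE.
rewrite bigcup_mkcond; apply: countable_bigcupT_measurable => [|c].
  exact: countableP.
case: ifPn => // _.
have [c0|c0] := ltP 0 (ratr c.2 : R); last first.
  rewrite (_ : _ @^-1` _ = set0)//; apply/seteqP; split => // t [/= r0].
  by move: c0; rewrite leNgt r0.
have -> : f @^-1` Bx c = \bigcap_(i in [set: 'I_n])
    ((fun t => f t 0 i) @^-1` ball (ratr (c.1 0 i) : R) (ratr c.2)).
  apply/seteqP; split => t /=.
    by move=> [_ h] i _; have := h 0 i; rewrite mxE.
  by move=> h; split => // i j; rewrite ord1 mxE; exact: h.
apply: fin_bigcap_measurable => // i _.
rewrite -[X in measurable X]setTI; apply: mf => //.
exact: measurable_ball.
Qed.

Definition rV_cons n (p : measurableTypeR R * 'rV[R]_n) : 'rV[R]_n.+1 :=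
  \row_i if unlift ord0 i is Some j then p.2 0 j else p.1.

Definition rV_uncons n (x : 'rV[R]_n.+1) : measurableTypeR R * 'rV[R]_n :=
  (x 0 ord0, \row_j x 0 (lift ord0 j)).

Lemma rV_consK n : cancel (@rV_cons n) (@rV_uncons n).
Proof.
move=> [a x]; rewrite /rV_uncons /rV_cons mxE unlift_none; congr pair.
by apply/rowP => j; rewrite !mxE liftK.
Qed.

Lemma measurable_rV_cons n : measurable_fun setT (@rV_cons n).
Proof.
apply/measurable_fun_rVP => i; rewrite /rV_cons.
case: (unliftP ord0 i) => [j ->|->].
  rewrite [X in measurable_fun _ X](_ : _ =
      (fun x : 'rV[R]_n => x 0 j) \o snd); last first.
    by apply/funext => p; rewrite mxE liftK.
  exact: measurableT_comp (measurable_coord j) measurable_snd.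
rewrite [X in measurable_fun _ X](_ : _ = fst)//.
by apply/funext => p; rewrite mxE unlift_none.
Qed.

Lemma measurable_rV_uncons n : measurable_fun setT (@rV_uncons n).
Proof.
apply: measurable_fun_pair; first exact: measurable_coord.
apply/measurable_fun_rVP => j.
under eq_fun do rewrite mxE.
exact: measurable_coord.
Qed.

End measurable_rV.

Section lebesgue_rV.
Context {R : realType}.

Section step.
Context {n : nat} (mu : {sigma_finite_measure set 'rV[R]_n -> \bar R}).

Definition lebesgue_rV_step : set 'rV[R]_n.+1 -> \bar R :=
  pushforward (@lebesgue_measure R \x mu)%E (@rV_cons R n).

Let step0 : lebesgue_rV_step set0 = 0%E.
Proof. by rewrite /lebesgue_rV_step /pushforward preimage_set0 measure0. Qed.

Let step_ge0 A : (0 <= lebesgue_rV_step A)%E.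
Proof. by rewrite /lebesgue_rV_step /pushforward measure_ge0. Qed.

Let step_sigma_additive : semi_sigma_additive lebesgue_rV_step.
Proof.
have mC (A : set 'rV[R]_n.+1) : measurable A -> measurable (@rV_cons R n @^-1` A).
  by move=> mA; rewrite -[X in measurable X]setTI; exact: measurable_rV_cons.
move=> F mF tF mUF; rewrite /lebesgue_rV_step /pushforward preimage_bigcup.
apply: measure_semi_sigma_additive => [k||]; first exact: mC.
- apply/trivIsetP => /= i j _ _ ij; rewrite -preimage_setI.
  by move/trivIsetP : tF => /(_ _ _ _ _ ij) ->//; rewrite preimage_set0.
- by rewrite -preimage_bigcup; exact: mC.
Qed.

HB.instance Definition _ := isMeasure.Build _ _ _ lebesgue_rV_step
  step0 step_ge0 step_sigma_additive.

Let step_sigma_finite : sigma_finite setT lebesgue_rV_step.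
Proof.
have [F FT Foo] : sigma_finite setT (@lebesgue_measure R \x mu)%E.
  have /sigma_finiteP[F [TF ndF Foo]] := sigma_finiteT (@lebesgue_measure R).
  have /sigma_finiteP[G [TG ndG Goo]] := sigma_finiteT mu.
  exists (fun k => F k `*` G k).
    rewrite -setXTT TF TG predeqE => -[x y]; split.
      move=> [/= [i _ Fix] [k _ Gky]]; exists (maxn i k) => //; split.
      - by move: x Fix; exact/subsetPset/ndF/leq_maxl.
      - by move: y Gky; exact/subsetPset/ndG/leq_maxr.
    by move=> [k _ []/= ? ?]; split; exists k.
  move=> k; have [? ?] := Foo k; have [? ?] := Goo k.
  split; first exact: measurableX.
  by rewrite product_measure1E// lte_mul_pinfty// ge0_fin_numE.
exists (fun k => @rV_uncons R n @^-1` F k).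
  by rewrite -preimage_bigcup -FT preimage_setT.
move=> k; have [mF Fk] := Foo k; split.
  by rewrite -[X in measurable X]setTI; exact: measurable_rV_uncons.
rewrite [X in (X < _)%E](_ : _ = (@lebesgue_measure R \x mu)%E (F k))//.
rewrite /lebesgue_rV_step /pushforward; congr (_ \x _)%E.
by apply/seteqP; split => p /=; rewrite rV_consK.
Qed.

HB.instance Definition _ := Measure_isSigmaFinite.Build _ _ _ lebesgue_rV_step
  step_sigma_finite.

End step.

Section base.

Definition lebesgue_rV0 : set 'rV[R]_0 -> \bar R := dirac (0 : 'rV[R]_0).

HB.instance Definition _ := Measure.on lebesgue_rV0.

Let base_sigma_finite : sigma_finite setT lebesgue_rV0.
Proof.
exists (fun=> setT); first by rewrite bigcup_const.
move=> _; split=> //.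
by rewrite /lebesgue_rV0 diracT ltry.
Qed.

HB.instance Definition _ := Measure_isSigmaFinite.Build _ _ _ lebesgue_rV0
  base_sigma_finite.

End base.

Fixpoint lebesgue_rV (n : nat) : {sigma_finite_measure set 'rV[R]_n -> \bar R} :=
  match n with
  | 0 => lebesgue_rV0
  | n'.+1 => lebesgue_rV_step (lebesgue_rV n')
  end.

Lemma lebesgue_rV_box n (a b : 'rV[R]_n) : (forall i, a 0 i <= b 0 i) ->
  lebesgue_rV n [set x | forall i, a 0 i <= x 0 i <= b 0 i] =
  (\prod_(i < n) (b 0 i - a 0 i))%:E.
Proof.
elim: n a b => [|n IH] a b ab /=.
  by rewrite big_ord0 /lebesgue_rV0 diracE mem_set//= => -[].
rewrite /lebesgue_rV_step /pushforward.
pose I0 : set (measurableTypeR R) := `[a 0 ord0, b 0 ord0]%classic.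
pose J : set 'rV[R]_n :=
  [set x | forall i, (rV_uncons a).2 0 i <= x 0 i <= (rV_uncons b).2 0 i].
have -> : @rV_cons R n @^-1` [set x | forall i, a 0 i <= x 0 i <= b 0 i] =
    I0 `*` J.
  apply/seteqP; split => [[t x] /= h|[t x] /= [It Jx] i].
    split; first by have := h ord0; rewrite mxE unlift_none /I0/= in_itv.
    by move=> i; have := h (lift ord0 i); rewrite !mxE liftK.
  rewrite mxE; case: (unliftP ord0 i) => [j ->|->].
    by have := Jx j; rewrite !mxE.
  by move: It; rewrite /I0/= in_itv.
rewrite product_measure1E//; last first.
  have -> : J = \bigcap_(i in [set: 'I_n]) ((fun x : 'rV[R]_n => x 0 i) @^-1`
      `[(rV_uncons a).2 0 i, (rV_uncons b).2 0 i]%classic).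
    apply/seteqP; split => [x Jx i _|x Jx i].
      by rewrite /= in_itv/=; exact: Jx.
    by have := Jx i Logic.I; rewrite /= in_itv.
  apply: fin_bigcap_measurable => // i _.
  rewrite -[X in measurable X]setTI; apply: measurable_coord => //.
  exact: measurable_itv.
rewrite IH; last by move=> i; rewrite !mxE.
have E0 : lebesgue_measure I0 = (b 0 ord0 - a 0 ord0)%:E.
  rewrite lebesgue_measure_itv/= lte_fin; case: ifPn => // ab0.
  rewrite (_ : b 0 ord0 = a 0 ord0) ?subrr//.
  by apply/eqP; rewrite eq_le ab andbT leNgt.
rewrite [X in (X * _)%E]E0 -EFinM big_ord_recl; congr (_ * _)%:E.
by apply: eq_bigr => i _; rewrite !mxE.
Qed.

End lebesgue_rV.

Section fractional_sobolev.
Context {R : realType} {N : nat}.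
Local Notation E := 'rV[R]_N.
Local Notation dx := (@lebesgue_rV R N).
Local Notation dxdy := (dx \x dx)%E.
Implicit Types (Omega : set E) (u v phi : E -> R) (s q : R).

(* the norm of the normed module 'rV[R]_N is the sup norm *)
Definition enorm (x : E) : R := Num.sqrt (\sum_(i < N) x 0 i ^+ 2).

Fixpoint continuously_differentiable (k : nat) (f : E -> R) : Prop :=
  continuous f /\
  match k with
  | 0 => True
  | k'.+1 => forall i : 'I_N,
      (forall x, derivable f x ('e_i : E)) /\
      continuously_differentiable k' (fun x => 'D_('e_i : E) f x)
  end.

Definition smooth (f : E -> R) := forall k, continuously_differentiable k f.

Definition test_function Omega phi :=
  [/\ smooth phi, compact (closure [set x | phi x != 0]) &
      closure [set x | phi x != 0] `<=` Omega].

(* at x = y the kernel takes the value 0^-1 = 0 *)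
Definition gagliardo_kernel s (z : E * E) : R :=
  (enorm (z.1 - z.2) `^ (N%:R + 2 * s))^-1.

Definition gagliardo_sq s u : \bar R :=
  (\int[dxdy]_z ((u z.1 - u z.2) ^+ 2 * gagliardo_kernel s z)%:E)%E.

Definition gagliardo_form s u v : R :=
  \int[dxdy]_z ((u z.1 - u z.2) * (v z.1 - v z.2) * gagliardo_kernel s z).

Definition Lnorm_on Omega q u : \bar R :=
  ('N[dx]_(q%:E)[(EFin \o u) \_ Omega])%E.

Definition L2_cvg Omega (u_ : nat -> E -> R) v :=
  Lnorm_on Omega 2 (u_ n \- v) @[n --> \oo] --> 0%E.

Definition gagliardo_cauchy s (u_ : nat -> E -> R) :=
  forall e : R, 0 < e -> exists n0, forall m n, (n0 <= m)%N -> (n0 <= n)%N ->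
    (gagliardo_sq s (u_ m \- u_ n)%R < e%:E)%E.

(* The completion of the test functions for the Gagliardo norm, as a space of
   functions: a class of Cauchy sequences is identified with its limit in L^2(Omega).
   This is legitimate under [compact_embedding] below. *)
Definition D0 Omega s u :=
  [/\ measurable_fun setT u, (forall x, ~ Omega x -> u x = 0) &
      exists phi_ : nat -> E -> R,
        [/\ forall n, test_function Omega (phi_ n),
            gagliardo_cauchy s phi_ & L2_cvg Omega phi_ u]].

(* The first conjunct extends the inclusion of the test functions into
   L^2(Omega) to the completion; the extension is injective by Fatou's lemma. *)
Definition compact_embedding Omega s :=
  (exists C : R, forall phi, test_function Omega phi ->
     (Lnorm_on Omega 2 phi ^+ 2 <= C%:E * gagliardo_sq s phi)%E) /\
  (forall u_ : nat -> E -> R, (forall n, D0 Omega s (u_ n)) ->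
     (exists M : R, forall n, (gagliardo_sq s (u_ n) <= M%:E)%E) ->
     exists (k : nat -> nat) (v : E -> R),
       [/\ {homo k : m n / (m < n)%N}, measurable_fun setT v &
           L2_cvg Omega (u_ \o k) v]).

Definition critical_exponent s : \bar R :=
  if 2 * s < N%:R then (2 * N%:R / (N%:R - 2 * s))%:E else +oo%E.

Definition lambda1 Omega s q : \bar R :=
  ereal_inf [set gagliardo_sq s phi | phi in
    [set phi | test_function Omega phi /\
               (\int[dx]_(x in Omega) (`|phi x| `^ q)%:E = 1)%E]].

Definition eigenfunction Omega s q (lambda : R) u :=
  [/\ D0 Omega s u, ~ {ae dx, forall x, u x = 0} &
      forall phi, D0 Omega s phi ->
        gagliardo_form s u phi =
        lambda * fine (Lnorm_on Omega q u) `^ (2 - q) *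
        \int[dx]_(x in Omega) (`|u x| `^ (q - 2) * u x * phi x)].

(* lambda1 is finite unless Omega is empty, when no eigenfunction exists *)
Definition lambda1_simple Omega s q :=
  forall u v, eigenfunction Omega s q (fine (lambda1 Omega s q)) u ->
    eigenfunction Omega s q (fine (lambda1 Omega s q)) v ->
    exists c : R, {ae dx, forall x, u x = c * v x}.

End fractional_sobolev.

(* Main.v *)
Require Import Defs.
From mathcomp Require Import all_boot all_order all_algebra.
From mathcomp Require Import all_classical all_reals all_analysis measurable_realfun.
From mathcomp Require Import ring lra.
Set Implicit Arguments.
Unset Strict Implicit.
Unset Printing Implicit Defensive.
Import Order.TTheory GRing.Theory Num.Theory.
Import numFieldNormedType.Exports.
Local Open Scope classical_set_scope.
Local Open Scope ring_scope.

(** Write [u]^2 for the Gagliardo energy and l for the first eigenvalue at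
    q = 2.  Suppose that simplicity fails for exponents q_n = 2 + theta_n
    decreasing to 2, and take non-proportional eigenfunctions U_n and V_n,
    normalized in L^(q_n).  Both have energy lambda_1(q_n), so the bilinear
    form of the energy vanishes on the pair U_n - V_n, U_n + V_n.  Let a_n and
    b_n be these two functions divided by their L^2 norms.

    The function |t|^theta t has slope at most (1 + theta) |t|^theta, and
    |t|^theta is at most 1 + O(theta) times a higher power of |t|.  Subtracting
    the two equations and testing with the difference therefore gives
    [a_n]^2 <= lambda_1(q_n) (1 + O(theta_n)) ([unit_diff_energy_limit]), and
    the same for b_n, which is the difference of U_n and - V_n.  As
    limsup lambda_1(q_n) <= l ([lambda1_limsup]), a_n and b_n are almost
    minimizers of the Rayleigh quotient at q = 2, normalized in L^2 and
    orthogonal for the energy.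

    Such pairs cannot exist ([no_orthogonal_near_minimizers]).  The reason is
    the sign defect D(u) = [u]^2 - [|u|]^2, whose integrand is
    4 max(- u(x) u(y), 0) times the kernel.  It is nonnegative, and D(u) = 0
    forces u to have a constant sign almost everywhere, on connected and on
    disconnected sets alike, because the kernel is positive at all pairs of
    distinct points.  Since |phi| can be approximated by competitors,
    D(phi) + l |phi|_2^2 <= [phi]^2 for test functions, and by Fatou this
    survives limits in L^2 in the form D(h) + l |h|_2^2 <= liminf [h_n]^2
    ([limit_sign_defect_le]).  By compactness a_n and b_n have L^2 limits f
    and g along a subsequence.  Apply the inequality to
    h_n = alpha a_n + beta b_n, whose limit is h = alpha f + beta g.  The
    right-hand side is at most (alpha^2 + beta^2) l, while |h|_2^2 contains
    the cross term 2 alpha beta (f, g).  Both signs of beta force (f, g) = 0,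
    and then D(h) = 0 for all alpha and beta.  So f and g are orthogonal in
    L^2 and span a plane of functions of constant sign, which is absurd
    ([one_signed_plane_trivial]).

    The error terms O(theta) are controlled in L^p with p = 2 + 4 s / N; for
    this subcritical exponent the embedding has a short proof by averaging
    over a cube whose size depends on the point ([gagliardo_nirenberg]). *)

(** * Integration over a general measure space *)
Section generic_integration.
Context d (T : measurableType d) (R : realType).
Variable mu : {measure set T -> \bar R}.

Lemma limn_einf_le_near (u : (\bar R)^nat) (l : \bar R) :
  (\forall n \near \oo, (u n <= l)%E) -> (limn_einf u <= l)%E.
Proof.
move=> [N _ ul]; rewrite limn_einf_lim.
apply: lime_le; first exact: is_cvg_einfs.
exists N => // n /= Nn; rewrite /einfs /=.
by apply: ge_ereal_inf; exists (u n); [exists n => //=|exact: ul].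
Qed.

(** Fatou for an almost everywhere limit, in the form in which it is applied:
    the integrals are eventually below c + e for every positive e. *)
Lemma le_fatou_ae (f_ : nat -> T -> R) (f : T -> R) (c : R) :
  (forall n, measurable_fun setT (f_ n)) -> measurable_fun setT f ->
  (forall n x, 0 <= f_ n x) -> (forall x, 0 <= f x) ->
  {ae mu, forall x, f_ ^~ x @ \oo --> f x} ->
  (forall e, 0 < e -> \forall n \near \oo,
    (\int[mu]_x (f_ n x)%:E <= (c + e)%:E)%E) ->
  (\int[mu]_x (f x)%:E <= c%:E)%E.
Proof.
move=> mf_ mf f_0 f0 cvf Ile.
have mF n : measurable_fun setT (EFin \o f_ n) by exact/measurable_EFinP.
have -> : (\int[mu]_x (f x)%:E = \int[mu]_x limn_einf (fun n => (f_ n x)%:E))%E.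
  apply: ge0_ae_eq_integral => //.
  - exact/measurable_EFinP.
  - rewrite /limn_einf; apply: measurableT_comp => //.
    apply: measurable_fun_limn_esup => n /=.
    by apply/measurable_EFinP; exact: measurable_funN.
  - by move=> x _; rewrite lee_fin.
  - move=> x _; rewrite limn_einf_lim; apply: lime_ge.
      exact: is_cvg_einfs.
    apply: nearW => n; rewrite /einfs /=.
    by apply: le_ereal_inf_tmp => _ [m _ <-]; rewrite lee_fin.
  - move: cvf; apply: filterS => x cvx _.
    have /cvg_limn_einf_sup[-> _] : (f_ n x)%:E @[n --> \oo] --> (f x)%:E.
      by apply/cvg_EFin => //; exact: nearW.
    by [].
apply: le_trans (fatou mu measurableT mF _) _.
  by move=> n x _; rewrite lee_fin.
apply/lee_addgt0Pr => e e0.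
rewrite -EFinD; apply: limn_einf_le_near; exact: Ile.
Qed.

(** The sum of the g n is integrable, hence finite almost everywhere, and the
    terms of a convergent series tend to 0. *)
Lemma ae_cvg0_summable (g : nat -> T -> R) :
  (forall n, measurable_fun setT (g n)) -> (forall n x, 0 <= g n x) ->
  (forall n, (\int[mu]_x (g n x)%:E <= (2^-1 ^+ n)%:E)%E) ->
  {ae mu, forall x, g ^~ x @ \oo --> (0 : R)}.
Proof.
move=> mg g0 Ig.
have mG n : measurable_fun setT (EFin \o g n) by exact/measurable_EFinP.
have G0 n x : [set: T] x -> (0 <= (g n x)%:E)%E by move=> _; rewrite lee_fin.
have S : mu.-integrable setT (fun x => \sum_(n <oo) (g n x)%:E)%E.
  apply/integrableP; split.
    apply: (@ge0_emeasurable_sum _ _ _ setT (fun n x => (g n x)%:E) xpredT)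
      => [k x _ _|k _]; [exact: G0|exact: mG].
  rewrite (eq_integral (fun x => \sum_(n <oo) (g n x)%:E)%E); last first.
    move=> x _; rewrite gee0_abs//.
    by apply: nneseries_ge0 => *; rewrite lee_fin.
  rewrite integral_nneseries//.
  apply: (@le_lt_trans _ _ (\sum_(n <oo) (2^-1 ^+ n)%:E)%E).
    apply: lee_nneseries => n *; last exact: Ig.
    by apply: integral_ge0 => x _; rewrite lee_fin.
  suff -> : (\sum_(0 <= n <oo) ((2:R)^-1 ^+ n)%:E)%E = 2%:E by rewrite ltry.
  apply/cvg_lim => //.
  rewrite (_ : (fun n => _) = EFin \o series (geometric 1 2^-1)); last first.
    apply/funext => n /=; rewrite sumEFin; congr EFin.
    by rewrite /series/=; apply: eq_bigr => i _; rewrite mul1r.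
  apply: cvg_EFin; first exact: nearW.
  rewrite [X in _ --> X](_ : _ = 1 * (1 - 2^-1)^-1); last first.
    by field.
  apply: cvg_geometric_series.
  by rewrite ger0_norm ?invr_ge0// invf_lt1// ltr1n.
have := integrable_ae measurableT S.
apply: filterS => x /(_ I) Sx.
have := @nneseries_tail_cvg R (fun n => (g n x)%:E) xpredT.
have Slt : (\sum_(k <oo) (g k x)%:E < +oo)%E by rewrite ltey_eq Sx.
move=> /(_ Slt (fun k _ => G0 k x I)) tail.
apply: (@squeeze_cvgr _ _ _ _ (cst 0) (fun n => fine (\sum_(n <= k <oo) (g k x)%:E)%E)).
- apply: nearW => n; rewrite g0 /=.
  have Sn : (\sum_(n <= k <oo) (g k x)%:E \is a fin_num)%E.
    rewrite ge0_fin_numE; last by apply: nneseries_ge0 => *; rewrite lee_fin.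
    apply: le_lt_trans Slt.
    rewrite [leRHS](@nneseries_split _ _ 0 n); last by move=> *; exact: G0.
    by apply: leeDr; apply: sume_ge0 => *; rewrite lee_fin.
  rewrite -lee_fin fineK// (@nneseries_split _ _ n 1); last by move=> *; exact: G0.
  rewrite addn1 big_nat1; apply: leeDl.
  by apply: nneseries_ge0 => *; rewrite lee_fin.
- exact: cvg_cst.
- exact: (fine_cvg tail).
Qed.

Lemma le_integral_EFin (f g : T -> R) :
  measurable_fun setT f -> measurable_fun setT g ->
  (forall x, 0 <= f x) -> (forall x, f x <= g x) ->
  (\int[mu]_x (f x)%:E <= \int[mu]_x (g x)%:E)%E.
Proof.
move=> mf mg f0 fg; apply: ge0_le_integral => //.
- by move=> x _; rewrite lee_fin.
- exact/measurable_EFinP.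
- exact/measurable_EFinP.
- by move=> x _; rewrite lee_fin.
Qed.

Lemma integralZl_EFin_ge0 (k : R) (f : T -> R) :
  0 <= k -> measurable_fun setT f -> (forall x, 0 <= f x) ->
  (\int[mu]_x (k * f x)%:E = k%:E * \int[mu]_x (f x)%:E)%E.
Proof.
move=> k0 mf f0; under eq_integral do rewrite EFinM.
apply: ge0_integralZl_EFin => //.
- by move=> x _; rewrite lee_fin.
- exact/measurable_EFinP.
Qed.

Lemma integralD_EFin_ge0 (f g : T -> R) :
  measurable_fun setT f -> measurable_fun setT g ->
  (forall x, 0 <= f x) -> (forall x, 0 <= g x) ->
  (\int[mu]_x (f x + g x)%:E =
   \int[mu]_x (f x)%:E + \int[mu]_x (g x)%:E)%E.
Proof.
move=> mf mg f0 g0; under eq_integral do rewrite EFinD.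
apply: ge0_integralD => //.
- by move=> x _; rewrite lee_fin.
- exact/measurable_EFinP.
- by move=> x _; rewrite lee_fin.
- exact/measurable_EFinP.
Qed.

Lemma integrable_ge0_lty (f : T -> R) : measurable_fun setT f ->
  (forall x, 0 <= f x) -> (\int[mu]_x (f x)%:E < +oo)%E ->
  mu.-integrable setT (EFin \o f).
Proof.
move=> mf f0 fI; apply/integrableP; split; first exact/measurable_EFinP.
by under eq_integral do rewrite /= ger0_norm//.
Qed.

Lemma integrable_dominated (f g : T -> R) : measurable_fun setT f ->
  (forall x, `|f x| <= g x) -> mu.-integrable setT (EFin \o g) ->
  mu.-integrable setT (EFin \o f).
Proof.
move=> mf fg; apply: le_integrable => //; first exact/measurable_EFinP.
by move=> x _; rewrite /= lee_fin (le_trans (fg x))// ler_norm.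
Qed.

Lemma integral_EFin_Rintegral (f : T -> R) : mu.-integrable setT (EFin \o f) ->
  (\int[mu]_x (f x)%:E)%E = (\int[mu]_x f x)%:E.
Proof. by move=> fI; rewrite fineK// integrable_fin_num. Qed.

End generic_integration.

Lemma ae_prod d (T : measurableType d) (R : realType)
    (mu : {sigma_finite_measure set T -> \bar R}) (P : T -> Prop) :
  {ae mu, forall x, P x} ->
  {ae (mu \x mu)%E, forall z : T * T, P z.1 /\ P z.2}.
Proof.
move=> [A [mA A0 PA]].
exists (A `*` setT `|` setT `*` A); split.
- by apply: measurableU; exact: measurableX.
- apply/eqP; rewrite -measure_le0.
  apply: (le_trans (measureU2 _ _ _)); try exact: measurableX.
  have e1 : (mu \x mu)%E (A `*` setT) = 0%E.
    by rewrite product_measure1E// [X in (X * _)%E]A0 mul0e.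
  have e2 : (mu \x mu)%E (setT `*` A) = 0%E.
    by rewrite product_measure1E// [X in (_ * X)%E]A0 mule0.
  by rewrite [X in (X + _)%E]e1 [X in (_ + X)%E]e2 adde0.
- move=> z /= /not_andP[Pz|Pz]; [left|right]; split => //=; exact: PA.
Qed.

(** * Inequalities for real powers *)
Section elementary_inequalities.
Context (R : realType).
Implicit Types a b t x w theta delta p q : R.

(** Young's inequality with second factor 1; geometrically, a concave power
    lies below its tangent at 1. *)
Lemma powR_le_tangent x d : 0 <= x -> 0 < d < 1 -> x `^ d <= 1 - d + d * x.
Proof.
move=> x0 /andP[d0 d1].
have d'0 : 0 < 1 - d by rewrite subr_gt0.
have := @conjugate_powR R (x `^ d) 1 d^-1 (1 - d)^-1.
rewrite powR_ge0 ler01 !invr_gt0 d0 d'0 !invrK.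
rewrite addrC subrK => /(_ isT isT isT isT erefl).
rewrite mulr1 -powRrM divff ?gt_eqF// powRr1// powR1 mul1r.
by rewrite addrC mulrC.
Qed.

(** For small theta the power m^theta exceeds 1 by at most an error of order
    theta, measured by a fixed power r.  This is what makes the equations at
    exponent 2 + theta close to the linear one. *)
Lemma powR_le_affine m theta r : 0 <= m -> 0 < theta < r ->
  m `^ theta <= 1 + theta / r * m `^ r.
Proof.
move=> m0 /andP[t0 tr]; have r0 := lt_trans t0 tr.
have := @powR_le_tangent (m `^ r) (theta / r) (powR_ge0 _ _).
rewrite divr_gt0// ltr_pdivrMr// mul1r tr -powRrM mulrCA divff ?gt_eqF// mulr1.
move=> /(_ isT) /le_trans; apply.
by rewrite lerD2r gerBl divr_ge0// ltW.
Qed.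

Lemma powR_split t r s : 0 <= t -> 0 < r -> 0 < s ->
  t `^ (r + s) = t `^ r * t `^ s.
Proof. by move=> t0 r0 s0; rewrite powRD// gt_eqF// addr_gt0. Qed.

Lemma sqr_powR t : 0 <= t -> t `^ 2 = t ^+ 2.
Proof. by move=> t0; rewrite (powR_mulrn 2). Qed.

Lemma powR_homo s t r : 0 <= s -> s <= t -> 0 <= r -> s `^ r <= t `^ r.
Proof.
move=> s0 st r0; apply: ge0_ler_powR; rewrite ?nnegrE//.
exact: le_trans st.
Qed.

Lemma invr_powR t r : 0 <= t -> t^-1 `^ r = (t `^ r)^-1.
Proof. by move=> t0; rewrite -powR_inv1// -powRrM mulN1r powRN. Qed.

(** The tangent inequality for exponent 1 / (1 + theta) at the point
    b^(1 + theta). *)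
Lemma bernoulli_powR b theta : 0 <= b -> 0 < theta ->
  1 - b `^ (1 + theta) <= (1 + theta) * (1 - b).
Proof.
move=> b0 t0; have t1 : 0 < 1 + theta by rewrite addr_gt0.
have := @powR_le_tangent (b `^ (1 + theta)) (1 + theta)^-1 (powR_ge0 _ _).
rewrite invr_gt0 t1 invf_lt1// ltrDl t0 -powRrM divff ?gt_eqF// powRr1//.
move=> /(_ isT); rewrite -(ler_pM2l t1) !mulrDr mulrN mulrA divff ?gt_eqF//.
by rewrite mulr1 mul1r; lra.
Qed.

(** The case a = 1 of [sgn_pow_monotone_le], to which homogeneity reduces it. *)
Lemma sgn_pow_monotone_le1 theta b : 0 < theta -> `|b| <= 1 ->
  (1 - `|b| `^ theta * b) * (1 - b) <= (1 + theta) * (1 - b) ^+ 2.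
Proof.
move=> t0 b1; have b1' : b <= 1 by rewrite (le_trans (ler_norm _)).
rewrite expr2 mulrA ler_wpM2r ?subr_ge0//.
have [b0|b0] := leP 0 b.
  rewrite ger0_norm// mulrC -[X in X * _]powRr1// -powR_split//.
  exact: bernoulli_powR.
rewrite ltr0_norm// -[X in _ * X](opprK b) mulrN opprK.
have : (- b) `^ theta <= 1.
  have -> : 1 = 1 `^ theta :> R by rewrite powR1.
  by apply: powR_homo; rewrite ?oppr_ge0 ?(ltW b0) ?(ltW t0)// -ltr0_norm.
have := powR_ge0 (- b) theta.
nra.
Qed.

(** The derivative of |t|^theta t is (1 + theta) |t|^theta; signs of a and b
    are arbitrary, so the same bound serves for differences and sums of
    eigenfunctions. *)
Lemma sgn_pow_monotone_le theta a b : 0 < theta ->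
  (`|a| `^ theta * a - `|b| `^ theta * b) * (a - b) <=
  (1 + theta) * (Num.max `|a| `|b|) `^ theta * (a - b) ^+ 2.
Proof.
move=> t0.
wlog ab : a b / `|b| <= `|a|.
  move=> W; have /orP[/W//|/W] := le_total `|b| `|a|.
  by rewrite maxC -(opprB b a) sqrrN mulrN -mulNr opprB.
rewrite max_l//.
have [|a0] := eqVneq a 0.
  move=> a0; move: ab; rewrite a0 normr0 normr_le0 => /eqP ->.
  by rewrite subrr expr0n/= !mulr0.
have an0 : 0 < `|a| by rewrite normr_gt0.
have := @sgn_pow_monotone_le1 theta (b / a) t0.
rewrite normrM normfV ler_pdivrMr// mul1r => /(_ ab).
have : 0 <= a ^+ 2 * `|a| `^ theta by rewrite mulr_ge0 ?sqr_ge0 ?powR_ge0.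
move=> P /(ler_wpM2l P).
have -> : (`|b| / `|a|) `^ theta = `|b| `^ theta / `|a| `^ theta.
  by rewrite powRM ?invr_ge0// invr_powR.
have : `|a| `^ theta != 0 by rewrite powR_eq0 normr_eq0 (negbTE a0).
set A := `|a| `^ theta; set B := `|b| `^ theta => A0.
rewrite [X in X <= _ -> _](_ : _ = (A * a - B * b) * (a - b)); last first.
  by field; rewrite a0 A0.
rewrite [X in _ <= X -> _](_ : _ = (1 + theta) * A * (a - b) ^+ 2)//.
by field.
Qed.

Lemma powRM_le_sum p q x y : 0 <= x -> 0 <= y -> 0 < p -> 0 < q ->
  x `^ p * y `^ q <= x `^ (p + q) + y `^ (p + q).
Proof.
move=> x0 y0 p0 q0; rewrite !powR_split//.
have P (z r : R) : 0 <= z `^ r := powR_ge0 z r.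
have [xy|/ltW yx] := leP x y.
  apply: (@le_trans _ _ (y `^ p * y `^ q)); last by rewrite lerDr mulr_ge0 ?P.
  rewrite ler_wpM2r ?P//; apply: powR_homo => //; exact: ltW.
apply: (@le_trans _ _ (x `^ p * x `^ q)); last by rewrite lerDl mulr_ge0 ?P.
rewrite ler_wpM2l ?P//; apply: powR_homo => //; exact: ltW.
Qed.

(** The pointwise form of the energy estimate: with a and b the values of two
    eigenfunctions and t the L^2 norm of their difference, the left side is
    the source term tested with the normalized difference w. *)
Lemma sgn_pow_diff_le theta p a b t w : 0 < theta < p - 2 -> 0 < t ->
  a - b = t * w ->
  (`|a| `^ theta * a - `|b| `^ theta * b) * w / t <=
  (1 + theta) * (w ^+ 2 + theta / (p - 2) *
                          (`|a| `^ p + `|b| `^ p + 2 * `|w| `^ p)).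
Proof.
move=> /andP[t0 tp] tt abE; have p2 := lt_trans t0 tp.
have := @sgn_pow_monotone_le theta a b t0.
rewrite abE => H.
have {H} : (`|a| `^ theta * a - `|b| `^ theta * b) * w / t <=
    (1 + theta) * (Num.max `|a| `|b|) `^ theta * w ^+ 2.
  set F := _ - _ in H *; set M := _ `^ theta in H *.
  have -> : F * w / t = (F * (t * w)) / t ^+ 2 by field; rewrite gt_eqF.
  rewrite ler_pdivrMr ?exprn_gt0//; apply: le_trans H _.
  by rewrite exprMn mulrCA mulrC.
move=> /le_trans; apply; rewrite -mulrA ler_wpM2l ?addr_ge0 ?(ltW t0)//.
have M0 : 0 <= Num.max `|a| `|b| by rewrite le_max normr_ge0.
have := @powR_le_affine _ theta (p - 2) M0.
rewrite t0 tp => /(_ isT) /(ler_wpM2r (sqr_ge0 w)) /le_trans; apply.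
rewrite mulrDl mul1r lerD2l -[leLHS]mulrA ler_wpM2l ?divr_ge0 ?(ltW t0) ?(ltW p2)//.
have K x : 0 <= x -> x `^ (p - 2) * w ^+ 2 <= x `^ p + `|w| `^ p.
  move=> x0; rewrite -[w ^+ 2]real_normK ?num_real// -sqr_powR//.
  by have := @powRM_le_sum (p - 2) 2 x `|w| x0 (normr_ge0 w) p2; rewrite subrK; apply.
have P (z r : R) : 0 <= z `^ r := powR_ge0 z r.
have := P `|a| p; have := P `|b| p; have := P `|w| p.
rewrite /Num.max; case: ifP => _.
  by have := K `|b| (normr_ge0 b); lra.
by have := K `|a| (normr_ge0 a); lra.
Qed.

(** The tangent inequality at 1 / t bounds t^theta from below by
    1 + theta - theta / t. *)
Lemma sqr_le_powR_near2 t theta : 0 <= t -> 0 < theta < 1 ->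
  t ^+ 2 - theta * t <= t `^ (2 + theta).
Proof.
move=> t0 th; have /andP[th0 th1] := th.
move: t0; rewrite le_eqVlt => /predU1P[<-|t0].
  by rewrite expr0n/= mulr0 subr0 powR_ge0.
have := @powR_le_tangent t^-1 theta; rewrite invr_ge0 (ltW t0) th => /(_ isT isT).
rewrite powR_split ?(ltW t0)// sqr_powR ?(ltW t0)//.
rewrite invr_powR ?(ltW t0)//.
have := powR_gt0 theta t0; set A := t `^ theta => A0 H.
rewrite -subr_ge0.
have {H} : 1 <= A * (1 - theta + theta / t).
  by rewrite -(ler_pM2l A0) divff ?gt_eqF in H.
rewrite -(ler_pM2l t0) mulr1 mulrCA mulrDr mulrCA divff ?gt_eqF// mulr1 => H.
have {}H : t <= A * (t * (1 - theta) + theta) by [].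
have tth : 0 <= theta * t by rewrite mulr_ge0 ?ltW.
have [A1|A1] := leP 1 A.
  have : 0 <= t ^+ 2 * (A - 1) by rewrite mulr_ge0 ?sqr_ge0// subr_ge0.
  by rewrite mulrBr; lra.
have : t * t <= t * (A * (t * (1 - theta) + theta)) by rewrite ler_pM2l.
have : 0 <= A * (theta * t) * t by rewrite !mulr_ge0 ?ltW.
have : 0 <= theta * t * (1 - A) by rewrite mulr_ge0// subr_ge0 ltW.
by rewrite expr2; lra.
Qed.

Lemma powR_le_interp t p q : 0 <= t -> 2 <= q <= p -> t `^ q <= t ^+ 2 + t `^ p.
Proof.
move=> t0 /andP[q2 qp]; rewrite -sqr_powR//.
have P (r : R) : 0 <= t `^ r := powR_ge0 t r.
have [t1|t1] := leP 1 t.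
  by apply: (@le_trans _ _ (t `^ p)); [exact: ler_powR|rewrite lerDr].
move: t0; rewrite le_eqVlt => /predU1P[<-|t0].
  have q0 : 0 < q by exact: lt_le_trans q2.
  by rewrite !powR0 ?addr0// gt_eqF// (lt_le_trans q0).
apply: (@le_trans _ _ (t `^ 2)); last by rewrite lerDl.
by apply: ger_powR => //; rewrite t0 (ltW t1).
Qed.

End elementary_inequalities.

(** * The Gagliardo kernel and cubes *)
Section kernel.
Context {R : realType} {N : nat}.
Local Notation E := 'rV[R]_N.
Local Notation dx := (@lebesgue_rV R N).
Local Notation dxdy := (dx \x dx)%E.
Implicit Types (x y : E) (u : E -> R) (s r : R).

Lemma continuous_measurable_rV u : continuous u -> measurable_fun setT u.
Proof.
move=> cu; apply: (measurability _ (RGenOpens.measurableE R)).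
move=> _ [_ [a [b ->] <-]]; rewrite setTI; apply: open_measurable_rV.
apply: open_comp; last exact: interval_open.
by move=> x _; exact: cu.
Qed.

Lemma measurable_gagliardo_kernel s : measurable_fun setT (@gagliardo_kernel R N s).
Proof.
have -> : @gagliardo_kernel R N s = (fun t => t `^ (- (N%:R + 2 * s))) \o
    (@Num.sqrt R) \o (fun z : E * E => \sum_(i < N) (z.1 0 i - z.2 0 i) ^+ 2).
  apply/funext => z; rewrite /gagliardo_kernel /= powRN; congr (_ `^ _)^-1.
  by rewrite /enorm; congr Num.sqrt; apply: eq_bigr => i _; rewrite !mxE.
apply: measurableT_comp; first apply: measurableT_comp.
- exact: measurable_powR.
- by apply: continuous_measurable_fun; exact: sqrt_continuous.
- apply: measurable_sum => i; apply: measurable_funX.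
  apply: measurable_funB.
    exact: (measurableT_comp (measurable_coord i) measurable_fst).
  exact: (measurableT_comp (measurable_coord i) measurable_snd).
Qed.

Lemma kernel_ge0 s z : 0 <= @gagliardo_kernel R N s z.
Proof. by rewrite invr_ge0 powR_ge0. Qed.

Lemma kernelC s x y : gagliardo_kernel s (x, y) = gagliardo_kernel s (y, x).
Proof.
rewrite /gagliardo_kernel /enorm /=; congr (Num.sqrt _ `^ _)^-1.
by apply: eq_bigr => i _; rewrite !mxE -opprB sqrrN.
Qed.

Lemma coord_le_enorm x i : `|x 0 i| <= enorm x.
Proof.
rewrite -sqrtr_sqr ler_wsqrtr// (bigD1 i)//= lerDl.
by apply: sumr_ge0 => j _; exact: sqr_ge0.
Qed.

Lemma enorm_ge0 x : 0 <= enorm x. Proof. exact: sqrtr_ge0. Qed.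

Lemma enorm0_eq x y : enorm (x - y) = 0 -> x = y.
Proof.
move=> xy0; apply/rowP => i; apply/eqP; rewrite -subr_eq0 -normr_le0.
by have := coord_le_enorm (x - y) i; rewrite xy0 !mxE.
Qed.

(** Closed ball of the sup norm; its measure is given by [lebesgue_rV_box]. *)
Definition cube x r : set E := [set y | forall i, `|x 0 i - y 0 i| <= r].

Lemma cubeE x r : cube x r =
  [set y | forall i, (x - const_mx r) 0 i <= y 0 i <= (x + const_mx r) 0 i].
Proof.
by apply/seteqP; split => y /= h i; have := h i; rewrite !mxE distrC ler_distl.
Qed.

Lemma measurable_cube x r : measurable (cube x r).
Proof.
rewrite (_ : cube x r = \bigcap_(i in [set: 'I_N])
    ((fun y => `|x 0 i - y 0 i|) @^-1` `]-oo, r]%classic)); last first.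
  by apply/seteqP; split => y /= h i; have := h i;
    rewrite ?in_itv/= => h' *; exact: h'.
apply: fin_bigcap_measurable => // i _.
have mf : measurable_fun setT (fun y : E => `|x 0 i - y 0 i|).
  apply: measurableT_comp => //; apply: measurable_funB => //.
  exact: measurable_coord.
by rewrite -[X in measurable X]setTI; apply: mf => //; exact: measurable_itv.
Qed.

Lemma lebesgue_cube x r : 0 <= r -> dx (cube x r) = ((2 * r) ^+ N)%:E.
Proof.
move=> r0; rewrite cubeE lebesgue_rV_box; last first.
  by move=> i; rewrite !mxE lerD2l ge0_cp.
rewrite (eq_bigr (fun=> 2 * r)); first by rewrite prodr_const card_ord.
by move=> i _; rewrite !mxE; ring.
Qed.

(** On the cube of half-side r the distance is at most N r. *)
Lemma cube_kernel_ge s x y r : 0 < s -> cube x r y -> x != y ->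
  1 <= (N%:R * r) `^ (N%:R + 2 * s) * gagliardo_kernel s (x, y).
Proof.
move=> s0 xy xNy; rewrite /gagliardo_kernel /=.
have e0 : 0 < enorm (x - y).
  rewrite lt_neqAle enorm_ge0 andbT eq_sym; apply: contra xNy => /eqP.
  by move=> /enorm0_eq ->.
have r0 : 0 <= r.
  have /existsP[i _] : [exists i, x 0 i != y 0 i].
    apply: contraNT xNy; rewrite negb_exists => /forallP h.
    by apply/eqP/rowP => i; have := h i; rewrite negbK => /eqP.
  exact: le_trans (normr_ge0 _) (xy i).
rewrite -ler_pdivrMr ?invr_gt0 ?powR_gt0// mul1r invrK.
apply: powR_homo; first exact: enorm_ge0; last by rewrite addr_ge0// mulr_ge0// ltW.
rewrite -[leRHS]ger0_norm ?mulr_ge0// -sqrtr_sqr ler_wsqrtr//.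
apply: (@le_trans _ _ (\sum_(i < N) r ^+ 2)).
  apply: ler_sum => i _; rewrite !mxE -real_normK ?num_real//.
  by rewrite lerXn2r ?nnegrE// xy.
rewrite sumr_const card_ord -[leLHS]mulr_natl exprMn ler_wpM2r ?sqr_ge0//.
rewrite -natrX ler_nat; case: (N) => // n; exact: leq_pmulr.
Qed.

End kernel.

(** * A Gagliardo-Nirenberg inequality *)
Section gagliardo_nirenberg.
Context {R : realType} {N : nat}.
Local Notation E := 'rV[R]_N.
Local Notation dx := (@lebesgue_rV R N).
Local Notation dxdy := (dx \x dx)%E.
Implicit Types (x y : E) (u : E -> R) (s r : R).

Definition energy_density s u (z : E * E) : R :=
  (u z.1 - u z.2) ^+ 2 * gagliardo_kernel s z.

Lemma energy_density_ge0 s u z : 0 <= energy_density s u z.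
Proof. by rewrite mulr_ge0 ?sqr_ge0 ?kernel_ge0. Qed.

Lemma measurable_diff u : measurable_fun setT u ->
  measurable_fun setT (fun z : E * E => u z.1 - u z.2).
Proof.
move=> mu; apply: measurable_funB.
  exact: (measurableT_comp mu measurable_fst).
exact: (measurableT_comp mu measurable_snd).
Qed.

Lemma measurable_energy_density s u : measurable_fun setT u ->
  measurable_fun setT (energy_density s u).
Proof.
move=> mu; apply: measurable_funM; last exact: measurable_gagliardo_kernel.
by apply: measurable_funX; exact: measurable_diff.
Qed.

(** The energy as a function of x alone, so that Tonelli writes the energy as
    its integral. *)
Definition local_energy s u x : \bar R :=
  (\int[dx]_y (energy_density s u (x, y))%:E)%E.

Lemma gagliardo_sq_local s u : measurable_fun setT u ->
  gagliardo_sq s u = (\int[dx]_x local_energy s u x)%E.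
Proof.
move=> mu; rewrite /gagliardo_sq fubini_tonelli1//.
  by apply/measurable_EFinP; exact: measurable_energy_density.
by move=> z; rewrite lee_fin energy_density_ge0.
Qed.

Lemma measurable_local_energy s u : measurable_fun setT u ->
  measurable_fun setT (local_energy s u).
Proof.
move=> mu.
apply: (@measurable_fun_fubini_tonelli_F _ _ _ _ _ dx
  (EFin \o energy_density s u)).
  by apply/measurable_EFinP; exact: measurable_energy_density.
by move=> z; rewrite lee_fin energy_density_ge0.
Qed.

Lemma local_energy_ge0 s u x : (0 <= local_energy s u x)%E.
Proof. by apply: integral_ge0 => y _; rewrite lee_fin energy_density_ge0. Qed.

(** Average u(x)^2 <= 2 (u(x) - u(y))^2 + 2 u(y)^2 over y in a cube about x. *)
Lemma cube_average_le s u x r (l : R) : measurable_fun setT u -> 0 < s -> 0 < r ->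
  (\int[dx]_y (u y ^+ 2)%:E <= l%:E)%E ->
  ((u x ^+ 2 * (2 * r) ^+ N)%:E <=
   (2 * (N%:R * r) `^ (N%:R + 2 * s))%:E * local_energy s u x + (2 * l)%:E)%E.
Proof.
move=> mu s0 r0 ul; set A := (_ * r) `^ _.
have A0 : 0 <= A by exact: powR_ge0.
have A2 : 0 <= 2 * A by exact: mulr_ge0.
have me : measurable_fun setT (fun y => energy_density s u (x, y)).
  exact: (measurable_fun_pair2 x (measurable_energy_density s mu)).
have -> : (u x ^+ 2 * (2 * r) ^+ N)%:E =
    (\int[dx]_y ((u x ^+ 2) * \1_(cube x r) y)%:E)%E.
  rewrite integralZl_EFin_ge0 ?sqr_ge0//; last first.
    by apply: measurable_indic; exact: measurable_cube.
  rewrite integral_indic//; last exact: measurable_cube.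
  by rewrite setIT [X in (_ * X)%E](lebesgue_cube x (ltW r0)) EFinM.
have m2 : measurable_fun setT (fun y => u y ^+ 2) by exact: measurable_funX.
apply: (@le_trans _ _
    (\int[dx]_y (2 * A * energy_density s u (x, y) + 2 * u y ^+ 2)%:E)%E).
  apply: le_integral_EFin.
  - apply: measurable_funM => //.
    by apply: measurable_indic; exact: measurable_cube.
  - by apply: measurable_funD; exact: measurable_funM.
  - by move=> y; rewrite mulr_ge0 ?sqr_ge0.
  - move=> y.
    have e0 := energy_density_ge0 s u (x, y).
    rewrite indicE; case: (boolP (y \in cube x r)) => /= [|_]; last first.
      have := mulr_ge0 A0 e0; have := sqr_ge0 (u y).
      by rewrite mulr0 -mulrA; lra.
    rewrite inE mulr1 => xy.
    have : (u x - u y) ^+ 2 <= A * energy_density s u (x, y).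
      have [->|xNy] := eqVneq x y.
        by rewrite subrr expr0n/= mulr_ge0// energy_density_ge0.
      rewrite /energy_density /= mulrCA ler_peMr ?sqr_ge0//.
      exact: cube_kernel_ge.
    have := sqr_ge0 (u x - 2 * u y); have := sqr_ge0 (u x - u y).
    set e := energy_density _ _ _; set B := A * e.
    rewrite -mulrA -/B; nra.
rewrite integralD_EFin_ge0; last 4 first.
- exact: measurable_funM.
- exact: measurable_funM.
- by move=> y; rewrite mulr_ge0 ?energy_density_ge0.
- by move=> y; rewrite mulr_ge0 ?sqr_ge0.
rewrite !integralZl_EFin_ge0//; last 2 first.
- by move=> y; exact: sqr_ge0.
- by move=> y; exact: energy_density_ge0.
by apply: leeD => //; rewrite EFinM lee_pmul2l.
Qed.

(** In [cube_average_le] choose the cube so that the term in l takes half of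
    the left side.  As r^N is then proportional to l / u(x)^2, this gives the
    pointwise bound |u(x)|^p <= C l^(2 s / N) local_energy(x), which is
    integrated. *)
Lemma gagliardo_nirenberg s : (0 < N)%N -> 0 < s ->
  exists2 C : R, 0 < C & forall u (l : R), measurable_fun setT u -> 0 < l ->
    (\int[dx]_y (u y ^+ 2)%:E <= l%:E)%E ->
    (\int[dx]_x (`|u x| `^ (2 + 4 * s / N%:R))%:E <=
      (C * l `^ (2 * s / N%:R))%:E * gagliardo_sq s u)%E.
Proof.
move=> N0 s0; have N0' : 0 < N%:R :> R by rewrite ltr0n.
pose b : R := 1 + 2 * s / N%:R.
have b0 : 0 < b by rewrite addr_gt0// divr_gt0// mulr_gt0.
pose C : R := (N%:R / 2) `^ (N%:R + 2 * s) * 4 `^ b.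
(* C = (N / 2)^(N + 2 s) 4^b with b = 1 + 2 s / N comes from the half-side
   r = h^(1 / N) / 2, for which (N r)^(N + 2 s) = (N / 2)^(N + 2 s) h^b *)
exists C; first by rewrite mulr_gt0 ?powR_gt0// divr_gt0.
move=> u l mu l0 ul.
rewrite gagliardo_sq_local// -ge0_integralZl//; last 3 first.
- exact: measurable_local_energy.
- by move=> x _; exact: local_energy_ge0.
- by rewrite lee_fin !mulr_ge0 ?powR_ge0.
apply: ge0_le_integral => //.
- apply/measurable_EFinP.
  apply: (measurableT_comp (measurable_powR _)).
  exact: measurableT_comp.
- apply: emeasurable_funM => //; exact: measurable_local_energy.
move=> x _.
have [->|ux0] := eqVneq (u x) 0.
  rewrite normr0 powR0; last by rewrite gt_eqF// addr_gt0// divr_gt0// mulr_gt0.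
  by rewrite mule_ge0 ?local_energy_ge0// lee_fin !mulr_ge0 ?powR_ge0.
have u2 : 0 < u x ^+ 2 by rewrite exprn_even_gt0.
(* h is the volume of the cube: u(x)^2 h = 4 l, twice the term 2 l *)
pose h := 4 * l / u x ^+ 2.
have h0 : 0 < h by rewrite divr_gt0// mulr_gt0.
pose r := h `^ (N%:R^-1) / 2.
have r0 : 0 < r by rewrite divr_gt0// powR_gt0.
have rN : (2 * r) ^+ N = h.
  rewrite /r mulrC divfK// -powR_mulrn ?powR_ge0// -powRrM mulVf ?gt_eqF//.
  by rewrite powRr1// ltW.
have rA : (N%:R * r) `^ (N%:R + 2 * s) =
    (N%:R / 2) `^ (N%:R + 2 * s) * h `^ b.
  rewrite (_ : N%:R * r = N%:R / 2 * h `^ N%:R^-1); last by rewrite /r; ring.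
  rewrite powRM ?powR_ge0 ?divr_ge0 ?(ltW N0')//.
  congr (_ * _); rewrite -powRrM; congr (_ `^ _).
  by rewrite /b; field; rewrite gt_eqF.
have := @cube_average_le s u x r l mu s0 r0 ul.
rewrite rN (_ : u x ^+ 2 * h = 2 * l + 2 * l); last first.
  by rewrite /h; field.
rewrite rA; set D := _ * h `^ b => H.
have D0 : 0 < D by rewrite mulr_gt0 ?powR_gt0// divr_gt0.
have {}H : (l%:E <= D%:E * local_energy s u x)%E.
  move: H (local_energy_ge0 s u x); case: (local_energy s u x) => [g| |]//.
    rewrite -!EFinM -EFinD !lee_fin; lra.
  by move=> _ _; rewrite gt0_muley ?leey.
have -> : `|u x| `^ (2 + 4 * s / N%:R) = C * l `^ (2 * s / N%:R) / D * l.
  rewrite (_ : 2 + 4 * s / N%:R = 2 * b); last by rewrite /b; field; rewrite gt_eqF.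
  rewrite powRrM sqr_powR// real_normK ?num_real//.
  have hb : h `^ b = 4 `^ b * (l * l `^ (2 * s / N%:R)) / (u x ^+ 2) `^ b.
    have l4 : 0 <= 4 * l by rewrite mulr_ge0 ?ltW.
    have u2' : 0 <= (u x ^+ 2)^-1 by rewrite invr_ge0 ltW.
    rewrite /h (powRM _ l4 u2') (invr_powR _ (ltW u2)) powRM ?(ltW l0)//.
    congr (_ * _ / _); rewrite /b powR_split ?(ltW l0) ?powRr1 ?(ltW l0)//.
    by rewrite divr_gt0// mulr_gt0.
  rewrite /D /C hb; field.
  rewrite !gt_eqF ?powR_gt0// ?divr_gt0//.
have : 0 <= C * l `^ (2 * s / N%:R) / D.
  by rewrite divr_ge0 ?mulr_ge0 ?powR_ge0// ltW.
set k := _ / D => k0.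
rewrite EFinM; apply: le_trans (lee_wpmul2l _ H) _; first by rewrite lee_fin.
by rewrite muleA -EFinM /k divfK ?gt_eqF.
Qed.

End gagliardo_nirenberg.

(** * Lipschitz functions of bounded support have finite energy *)
Section finite_energy.
Context {R : realType} {N : nat}.
Local Notation E := 'rV[R]_N.
Local Notation dx := (@lebesgue_rV R N).
Local Notation dxdy := (dx \x dx)%E.
Implicit Types (x y : E) (u : E -> R) (s r : R).

Lemma dyadic_small (t : R) : 0 < t <= 1 ->
  exists k, 2^-1 ^+ k.+1 < t <= 2^-1 ^+ k.
Proof.
move=> /andP[t0 t1].
have ex : exists k, 2^-1 ^+ k.+1 < t.
  have h1 : `|2^-1 : R| < 1 by rewrite ger0_norm ?invr_ge0// invf_lt1// ltr1n.
  have /cvgrPdist_lt/(_ _ t0)[k _ kP] := cvg_geometric 1 h1.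
  exists k; have := kP k.+1 (leqnSn k); rewrite /= mul1r sub0r normrN.
  by rewrite ger0_norm// exprn_ge0// invr_ge0.
case: (ex_minnP ex) => -[|k] kt kmin; first by exists 0%N; rewrite expr0 kt.
exists k.+1; rewrite kt leNgt; apply/negP => tk.
by have := kmin k tk; rewrite ltnn.
Qed.

Lemma dyadic_large (t : R) : 1 < t ->
  exists k, (2^-1 ^+ k)^-1 < t <= 2 * (2^-1 ^+ k)^-1.
Proof.
move=> t1; have t0 : 0 < t := lt_trans ltr01 t1.
have [|k /andP[k1 k2]] := @dyadic_small t^-1.
  by rewrite invr_gt0 t0 invf_le1// ltW.
have h0 n : 0 < 2^-1 ^+ n :> R by rewrite exprn_gt0.
have {}k1 : t < 2 * (2^-1 ^+ k)^-1.
  rewrite -[X in X < _]invrK -[X in _ < X]invrK ltf_pV2 ?posrE ?invr_gt0 ?mulr_gt0 ?invr_gt0//.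
  by rewrite invfM invrK -exprS.
have {}k2 : (2^-1 ^+ k)^-1 <= t.
  by rewrite -[X in _ <= X]invrK lef_pV2 ?posrE ?invr_gt0.
move: k2; rewrite le_eqVlt => /predU1P[kt|kt]; last by exists k; rewrite kt (ltW k1).
case: k => [|k] in k1 kt *; first by move: t1; rewrite -kt expr0 invr1 ltxx.
exists k; rewrite -kt exprS invfM invrK lexx andbT ltr_pMl ?invr_gt0//.
by rewrite ltr1n.
Qed.

Lemma geometric_nneseries_lty (c z : R) : 0 <= c -> 0 <= z < 1 ->
  (\sum_(k <oo) (c * z ^+ k)%:E < +oo)%E.
Proof.
move=> c0 /andP[z0 z1].
suff -> : (\sum_(0 <= k <oo) (c * z ^+ k)%:E)%E = (c * (1 - z)^-1)%:E by rewrite ltry.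
apply/cvg_lim => //.
rewrite (_ : (fun n => _) = EFin \o series (geometric c z)); last first.
  by apply/funext => n /=; rewrite sumEFin.
apply: cvg_EFin; first exact: nearW.
by apply: cvg_geometric_series; rewrite ger0_norm.
Qed.

(** The contribution of the k-th dyadic shell: distances about 2^-k, where the
    Lipschitz bound L is used, and distances about 2^k, where only the bound M
    on the oscillation is used. *)
Definition dyadic_majorant s (L M : R) k x y : R :=
  (L * 2^-1 ^+ k) ^+ 2 * ((2^-1 ^+ k.+1) `^ (N%:R + 2 * s))^-1 *
    \1_(cube x (2^-1 ^+ k)) y +
  M ^+ 2 * (2^-1 ^+ k) `^ (N%:R + 2 * s) *
    \1_(cube x (2 * (2^-1 ^+ k)^-1)) y.

Lemma dyadic_majorant_ge0 s L M k x y : 0 <= dyadic_majorant s L M k x y.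
Proof.
by apply: addr_ge0; apply: mulr_ge0 => //; apply: mulr_ge0;
  rewrite ?sqr_ge0 ?invr_ge0 ?powR_ge0.
Qed.

Lemma energy_density_le_dyadic s u (L M : R) x y : 0 < s -> 0 <= L ->
  (forall x y, `|u x - u y| <= L * enorm (x - y)) ->
  (forall x y, `|u x - u y| <= M) ->
  exists k, energy_density s u (x, y) <= dyadic_majorant s L M k x y.
Proof.
move=> s0 L0 uL uM.
have a0 : 0 <= N%:R + 2 * s by rewrite addr_ge0// mulr_ge0// ltW.
have h0 n : 0 < 2^-1 ^+ n :> R by rewrite exprn_gt0.
have [->|xNy] := eqVneq x y.
  exists 0%N; rewrite /energy_density /= subrr expr0n/= mul0r.
  exact: dyadic_majorant_ge0.
have d0 : 0 < enorm (x - y).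
  rewrite lt_neqAle enorm_ge0 andbT eq_sym; apply: contra xNy => /eqP.
  by move=> /enorm0_eq ->.
have ucube r : enorm (x - y) <= r -> cube x r y.
  move=> xyr i; apply: le_trans xyr.
  by have := coord_le_enorm (x - y) i; rewrite !mxE.
have ker t : 0 < t -> t <= enorm (x - y) ->
    gagliardo_kernel s (x, y) <= (t `^ (N%:R + 2 * s))^-1.
  move=> t0 tl; rewrite /gagliardo_kernel /= lef_pV2 ?posrE ?powR_gt0//.
  by apply: powR_homo => //; exact: ltW.
have sq (c : R) : `|u x - u y| <= c -> (u x - u y) ^+ 2 <= c ^+ 2.
  move=> uc; rewrite -[leLHS]real_normK ?num_real// lerXn2r ?nnegrE//.
  exact: le_trans uc.
have [t1|t1] := leP (enorm (x - y)) 1.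
  have [|k /andP[k1 k2]] := @dyadic_small (enorm (x - y)); first by rewrite d0.
  exists k; rewrite /dyadic_majorant [X in X + _](_ : _ =
    (L * 2^-1 ^+ k) ^+ 2 * ((2^-1 ^+ k.+1) `^ (N%:R + 2 * s))^-1); last first.
    by rewrite indicE mem_set ?mulr1//; exact: ucube.
  apply: (@le_trans _ _ ((L * 2^-1 ^+ k) ^+ 2 *
      ((2^-1 ^+ k.+1) `^ (N%:R + 2 * s))^-1)); last first.
    by rewrite lerDl; do 2![apply: mulr_ge0 => //]; rewrite ?sqr_ge0 ?powR_ge0.
  apply: ler_pM; rewrite ?sqr_ge0 ?kernel_ge0//.
    apply: sq; apply: le_trans (uL x y) _; exact: ler_wpM2l.
  by apply: ker => //; exact: ltW.
have [k /andP[k1 k2]] := dyadic_large t1.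
exists k; rewrite /dyadic_majorant [X in _ + X](_ : _ =
  M ^+ 2 * (2^-1 ^+ k) `^ (N%:R + 2 * s)); last first.
  by rewrite indicE mem_set ?mulr1//; exact: ucube.
apply: (@le_trans _ _ (M ^+ 2 * (2^-1 ^+ k) `^ (N%:R + 2 * s))); last first.
  rewrite lerDr; do 2![apply: mulr_ge0 => //];
    by rewrite ?sqr_ge0 ?invr_ge0 ?powR_ge0.
apply: ler_pM; rewrite ?sqr_ge0 ?kernel_ge0//; first exact: sq.
have := ker (2^-1 ^+ k)^-1; rewrite invr_gt0 h0 (ltW k1) => /(_ isT isT).
by rewrite invr_powR ?invrK// ltW.
Qed.

(** The inner shells contribute 2^(-k (2 - 2 s)) and the outer ones
    2^(-2 s k), up to constants; both ratios are below 1 when 0 < s < 1. *)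
Lemma integral_dyadic_majorant_le s (L M : R) : 0 < s < 1 ->
  exists C z : R, [/\ 0 <= C, 0 <= z < 1 & forall k x,
    (\int[dx]_y (dyadic_majorant s L M k x y)%:E <= (C * z ^+ k)%:E)%E].
Proof.
move=> /andP[s0 s1].
pose a := N%:R + 2 * s.
pose z1 : R := 2^-1 `^ (2 - 2 * s); pose z2 : R := 2^-1 `^ (2 * s).
pose C1 : R := L ^+ 2 * 2 `^ a * 2 ^+ N; pose C2 : R := M ^+ 2 * 4 ^+ N.
have h0 n : 0 < 2^-1 ^+ n :> R by rewrite exprn_gt0.
have z_lt1 r : 0 < r -> 2^-1 `^ r < 1 :> R.
  move=> r0; rewrite [X in _ < X](_ : 1 = 1 `^ r); last by rewrite powR1.
  by apply: gt0_ltr_powR; rewrite ?nnegrE ?invr_ge0 ?invf_lt1 ?ltr1n.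
have C10 : 0 <= C1.
  by do 2![apply: mulr_ge0 => //]; rewrite ?sqr_ge0 ?powR_ge0.
have C20 : 0 <= C2 by rewrite mulr_ge0 ?sqr_ge0.
(* z1 and z2 are the ratios of the inner and of the outer shells *)
exists (C1 + C2), (Num.max z1 z2); split.
- exact: addr_ge0.
- rewrite le_max powR_ge0 /= gt_max !z_lt1//; lra.
move=> k x; set t : R := 2^-1 ^+ k.
have t0 : 0 < t by exact: h0.
have tpow r : t `^ r = (2^-1 `^ r) ^+ k.
  by rewrite /t -powR_mulrn ?invr_ge0// -!powRrM mulrC powRrM powR_mulrn ?powR_ge0.
have tD p q : t `^ p * t `^ q = t `^ (p + q).
  by rewrite powRD// (gt_eqF t0) implybT.
have tI n : (t^-1) ^+ n = t `^ (- n%:R).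
  by rewrite powRN powR_mulrn ?(ltW t0)// exprVn.
have tN n : t ^+ n = t `^ n%:R by rewrite powR_mulrn// ltW.
rewrite /dyadic_majorant -/a -/t.
have m1 r : measurable_fun setT (\1_(cube x r) : E -> R).
  by apply: measurable_indic; exact: measurable_cube.
set A := (L * t) ^+ 2 * _; set B := M ^+ 2 * _.
have A0 : 0 <= A by rewrite mulr_ge0 ?sqr_ge0 ?invr_ge0 ?powR_ge0.
have B0 : 0 <= B by rewrite mulr_ge0 ?sqr_ge0 ?powR_ge0.
rewrite integralD_EFin_ge0; last 4 first.
- exact: measurable_funM.
- exact: measurable_funM.
- by move=> y; exact: mulr_ge0.
- by move=> y; exact: mulr_ge0.
rewrite !integralZl_EFin_ge0// !integral_indic//; try exact: measurable_cube.
rewrite !setIT [X in (_ * X + _)%E](lebesgue_cube x (ltW t0)).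
rewrite [X in (_ + _ * X)%E]lebesgue_cube ?mulr_ge0 ?invr_ge0 ?(ltW t0)//.
rewrite -!EFinM -EFinD lee_fin [leRHS]mulrDl.
have zk (z : R) : 0 <= z -> z <= Num.max z1 z2 -> z ^+ k <= Num.max z1 z2 ^+ k.
  by move=> z0 zz; rewrite lerXn2r ?nnegrE// (le_trans z0).
apply: lerD.
  rewrite [leLHS](_ : _ = C1 * z1 ^+ k); last first.
    rewrite -[z1 ^+ k]tpow /A [2^-1 ^+ k.+1]exprS -/t powRM ?(ltW t0) ?invr_ge0//.
    rewrite invfM invr_powR// invrK !exprMn.
    rewrite (_ : t `^ (2 - 2 * s) = t ^+ 2 * (t `^ a)^-1 * t ^+ N).
      by rewrite /C1; ring.
    rewrite !tN -powRN !tD.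
    by congr (_ `^ _); rewrite /a; ring.
  by apply: ler_wpM2l => //; apply: zk; rewrite ?powR_ge0// le_max lexx.
rewrite [leLHS](_ : _ = C2 * z2 ^+ k); last first.
  rewrite -[z2 ^+ k]tpow /B /C2 mulrA -natrM exprMn tI.
  rewrite (_ : t `^ (2 * s) = t `^ a * t `^ (- N%:R)); first by ring.
  rewrite tD.
  by congr (_ `^ _); rewrite /a; ring.
by apply: ler_wpM2l => //; apply: zk; rewrite ?powR_ge0// le_max lexx orbT.
Qed.

Lemma local_energy_bounded s u (L M : R) : 0 < s < 1 -> 0 <= L ->
  measurable_fun setT u ->
  (forall x y, `|u x - u y| <= L * enorm (x - y)) ->
  (forall x y, `|u x - u y| <= M) ->
  exists2 B : R, 0 <= B & forall x, (local_energy s u x <= B%:E)%E.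
Proof.
move=> s01 L0 mu uL uM.
have [C [z [C0 z01 Cz]]] := integral_dyadic_majorant_le L M s01.
have S := geometric_nneseries_lty C0 z01.
have S0 : (0 <= \sum_(k <oo) (C * z ^+ k)%:E)%E.
  by apply: nneseries_ge0 => k _ _; rewrite lee_fin mulr_ge0// exprn_ge0//; case/andP: z01.
exists (fine (\sum_(k <oo) (C * z ^+ k)%:E)%E); first exact: fine_ge0.
move=> x; rewrite fineK ?ge0_fin_numE//.
have mm k : measurable_fun setT (EFin \o dyadic_majorant s L M k x).
  apply/measurable_EFinP; apply: measurable_funD; apply: measurable_funM => //;
    by apply: measurable_indic; exact: measurable_cube.
have me : measurable_fun setT (fun y => energy_density s u (x, y)).
  exact: (measurable_fun_pair2 x (measurable_energy_density s mu)).
apply: (@le_trans _ _ (\int[dx]_y \sum_(k <oo) (dyadic_majorant s L M k x y)%:E)%E).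
  apply: ge0_le_integral => //.
  - by move=> y _; rewrite lee_fin energy_density_ge0.
  - exact/measurable_EFinP.
  - apply: (@ge0_emeasurable_sum _ _ _ setT
      (fun k y => (dyadic_majorant s L M k x y)%:E) xpredT) => [k y _ _|k _].
      by rewrite lee_fin dyadic_majorant_ge0.
    exact: mm.
  - move=> y _; have s0 : 0 < s by case/andP: s01.
    have [k kP] := energy_density_le_dyadic x y s0 L0 uL uM.
    rewrite -lee_fin in kP; apply: le_trans kP _.
    have g0 j : (0 <= (dyadic_majorant s L M j x y)%:E)%E.
      by rewrite lee_fin dyadic_majorant_ge0.
    apply: le_trans (nneseries_lim_ge k.+1 _); last by move=> *; exact: g0.
    rewrite big_nat_recr//=; apply: leeDr; exact: sume_ge0.
rewrite integral_nneseries//; last first.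
  by move=> k y _; rewrite lee_fin dyadic_majorant_ge0.
apply: lee_nneseries => k *; last exact: Cz.
by apply: integral_ge0 => y _; rewrite lee_fin dyadic_majorant_ge0.
Qed.

(** The density vanishes unless one of the two points lies in the support, and
    for each such point [local_energy_bounded] applies. *)
Lemma gagliardo_sq_lty s u (L M r : R) : 0 < s < 1 -> 0 <= L -> 0 <= r ->
  measurable_fun setT u ->
  (forall x y, `|u x - u y| <= L * enorm (x - y)) ->
  (forall x y, `|u x - u y| <= M) ->
  (forall x, u x != 0 -> cube 0 r x) ->
  (gagliardo_sq s u < +oo)%E.
Proof.
move=> s01 L0 r0 mu uL uM ur.
have [B B0 uB] := local_energy_bounded s01 L0 mu uL uM.
have me := measurable_energy_density s mu.
pose I : E -> R := \1_(cube 0 r).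
have mI : measurable_fun setT I by apply: measurable_indic; exact: measurable_cube.
have I0 x : 0 <= I x by [].
have mEsymm : measurable_fun setT (fun z : E * E => energy_density s u (z.2, z.1)).
  have -> : (fun z : E * E => energy_density s u (z.2, z.1)) = energy_density s u.
    by apply/funext => -[x y]; rewrite /energy_density /= kernelC -opprB sqrrN.
  exact: me.
have mI1 : measurable_fun setT (fun z : E * E => I z.1).
  exact: (measurableT_comp mI measurable_fst).
have mI2 : measurable_fun setT (fun z : E * E => I z.2).
  exact: (measurableT_comp mI measurable_snd).
have e0 := energy_density_ge0 s u.
have mf1 : measurable_fun setT (fun z : E * E => I z.1 * energy_density s u z).
  exact: (measurable_funM mI1 me).
have mf2 : measurable_fun setT (fun z : E * E => I z.2 * energy_density s u z).
  exact: (measurable_funM mI2 me).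
have H1 : (\int[dxdy]_z (I z.1 * energy_density s u z)%:E <=
           (B * (2 * r) ^+ N)%:E)%E.
  rewrite fubini_tonelli1//; last 2 first.
  - exact/measurable_EFinP.
  - by move=> z; rewrite lee_fin mulr_ge0.
  apply: (@le_trans _ _ (\int[dx]_x (B * I x)%:E)%E).
    apply: ge0_le_integral => //.
    - by move=> x _; apply: integral_ge0 => y _; rewrite lee_fin mulr_ge0.
    - apply: (@measurable_fun_fubini_tonelli_F _ _ _ _ _ dx
        (fun z : E * E => (I z.1 * energy_density s u z)%:E)).
        exact/measurable_EFinP.
      by move=> z; rewrite lee_fin mulr_ge0.
    - by apply/measurable_EFinP; exact: measurable_funM.
    - move=> x _; rewrite /fubini_F /= integralZl_EFin_ge0//; last first.
        exact: (measurable_fun_pair2 x me).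
      rewrite [X in (_ <= X)%E]EFinM [leRHS]muleC; apply: lee_wpmul2l; first by rewrite lee_fin.
      exact: uB.
  rewrite integralZl_EFin_ge0// integral_indic//; last exact: measurable_cube.
  by rewrite setIT [X in (_ * X)%E](lebesgue_cube 0 r0).
have H2 : (\int[dxdy]_z (I z.2 * energy_density s u z)%:E <=
           (B * (2 * r) ^+ N)%:E)%E.
  apply: le_trans H1.
  pose F1 (z : E * E) := (I z.1 * energy_density s u z)%:E.
  pose F2 (z : E * E) := (I z.2 * energy_density s u z)%:E.
  have F10 z : (0 <= F1 z)%E by rewrite lee_fin mulr_ge0.
  have F20 z : (0 <= F2 z)%E by rewrite lee_fin mulr_ge0.
  have mF1 : measurable_fun setT F1 by exact/measurable_EFinP.
  have mF2 : measurable_fun setT F2 by exact/measurable_EFinP.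
  rewrite -/F1 -/F2 [leLHS](fubini_tonelli2 F2 mF2 F20).
  rewrite [leRHS](fubini_tonelli1 F1 mF1 F10).
  rewrite le_eqVlt; apply/orP; left; apply/eqP.
  apply: eq_integral => x _; apply: eq_integral => y _ /=.
  by rewrite /F2 /F1 /energy_density /= [in LHS]kernelC -(opprB (u x)) sqrrN.
apply: (@le_lt_trans _ _ ((B * (2 * r) ^+ N)%:E + (B * (2 * r) ^+ N)%:E)%E); last first.
  by rewrite -EFinD ltry.
apply: le_trans (leeD H1 H2).
rewrite -integralD_EFin_ge0; last 4 first.
- exact: mf1.
- exact: mf2.
- by move=> z; exact: mulr_ge0.
- by move=> z; exact: mulr_ge0.
apply: (le_integral_EFin dxdy me (measurable_funD mf1 mf2) e0).
move=> -[x y] /=; rewrite -/(energy_density s u (x, y)) -mulrDl.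
have [ux|ux] := eqVneq (u x) 0; have [uy|uy] := eqVneq (u y) 0.
- by rewrite /energy_density /= ux uy subrr expr0n/= mul0r mulr0.
- by rewrite ler_peMl// /I !indicE (mem_set (ur _ uy)) lerDr.
- by rewrite ler_peMl// /I !indicE (mem_set (ur _ ux)) lerDl.
- by rewrite ler_peMl// /I !indicE (mem_set (ur _ ux)) lerDl.
Qed.

End finite_energy.

(** * Calculus of smooth functions *)
Section smooth_functions.
Context {R : realType} {N : nat}.
Local Notation E := 'rV[R]_N.
Implicit Types (f g phi : E -> R) (x y v : E).

Lemma derive_along_line f x v :
  'D_v f x = (fun h : R => f (h *: v + x))^`()%classic 0.
Proof.
rewrite derive1E /derive; set g1 := fun h => _; set g2 := fun h => _.
suff -> : g1 = g2 by [].
by apply/funext => h; rewrite /g1 /g2 /= addr0 scale0r add0r [_%:A]mulr1.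
Qed.

(** Chain rule along a line: a directional derivative is the derivative of a
    function of one real variable. *)
Lemma is_derive_comp (g : R -> R) f x v (dg df : R) :
  is_derive x v f df -> is_derive (f x) 1 g dg ->
  is_derive x v (g \o f) (dg * df).
Proof.
move=> [fx <-] [gx <-].
have F0 : f (0 *: v + x) = f x by rewrite scale0r add0r.
have dF : derivable (fun h : R => f (h *: v + x)) 0 1.
  exact: (derivable1P f x v).1 fx.
have dG : derivable g (f (0 *: v + x)) 1 by rewrite F0.
split.
  apply/(derivable1P (g \o f) x v)/derivable1_diffP.
  apply: (@differentiable_comp _ _ _ _ (fun h : R => f (h *: v + x)) g 0).
    exact/derivable1_diffP.
  exact/derivable1_diffP.
rewrite derive_along_line (derive1_comp dF dG) -derive_along_line.
by rewrite F0 derive1E.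
Qed.

Lemma cd_continuous k f : continuously_differentiable k f -> continuous f.
Proof. by case: k => [|k] []. Qed.

Lemma cdS k f : continuously_differentiable k.+1 f ->
  continuously_differentiable k f.
Proof.
elim: k f => [|k IH] f [cf H]; first by split.
split=> // i; have [df dk] := H i; split => //; exact: IH.
Qed.

Lemma cd_cst k (c : R) : continuously_differentiable k (cst c : E -> R).
Proof.
elim: k c => [|k IH] c; first by split => //; exact: cst_continuous.
split; first exact: cst_continuous.
move=> i; split; first by move=> x; exact: derivable_cst.
rewrite (_ : (fun x => _) = cst 0); first exact: IH.
by apply/funext => x; rewrite derive_cst.
Qed.

Lemma cdD k f g : continuously_differentiable k f ->
  continuously_differentiable k g ->
  continuously_differentiable k (fun x => f x + g x).
Proof.
elim: k f g => [|k IH] f g [cf Hf] [cg Hg].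
  by split => // x; apply: continuousD; [exact: cf|exact: cg].
split; first by move=> x; apply: continuousD; [exact: cf|exact: cg].
move=> i; have [df dkf] := Hf i; have [dg dkg] := Hg i; split.
  by move=> x; exact: derivableD.
rewrite (_ : (fun x => _) = (fun x => 'D_('e_i) f x + 'D_('e_i) g x)); first exact: IH.
by apply/funext => x; rewrite -deriveD.
Qed.

Lemma cdM k f g : continuously_differentiable k f ->
  continuously_differentiable k g ->
  continuously_differentiable k (fun x => f x * g x).
Proof.
elim: k f g => [|k IH] f g Cf Cg.
  case: Cf Cg => [cf Hf] [cg Hg].
  by split => // x; apply: continuousM; [exact: cf|exact: cg].
have := cdS Cf; have := cdS Cg.
case: Cf Cg => [cf Hf] [cg Hg] Cg Cf.
split; first by move=> x; apply: continuousM; [exact: cf|exact: cg].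
move=> i; have [df dkf] := Hf i; have [dg dkg] := Hg i; split.
  by move=> x; exact: derivableM.
rewrite (_ : (fun x => _) =
  (fun x => f x * 'D_('e_i) g x + g x * 'D_('e_i) f x)); last first.
  by apply/funext => x; exact: deriveM.
by apply: cdD; exact: IH.
Qed.

Lemma cdZ k (c : R) f : continuously_differentiable k f ->
  continuously_differentiable k (fun x => c * f x).
Proof. by move=> Cf; apply: cdM => //; exact: cd_cst. Qed.

(** A smooth approximation of the absolute value which is a contraction and
    vanishes at 0, so it maps test functions to test functions and does not
    increase the energy. *)
Definition smooth_abs (e t : R) : R := Num.sqrt (t ^+ 2 + e ^+ 2) - e.

(** With H the inverse square root, the derivative is - phi (D phi) H^3, again
    a polynomial in H, phi and D phi; this is why the smoothness of H follows
    by induction in [cd_inv_sqrt]. *)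
Lemma is_derive_inv_sqrt phi (e : R) x v : 0 < e -> derivable phi x v ->
  is_derive x v (fun x => (Num.sqrt (phi x ^+ 2 + e ^+ 2))^-1)
    (- 1 * (phi x * 'D_v phi x) *
      (Num.sqrt (phi x ^+ 2 + e ^+ 2))^-1 ^+ 3).
Proof.
move=> e0 dphi.
pose a : E -> R := fun x => phi x ^+ 2 + e ^+ 2.
have a0 y : 0 < a y by rewrite ltr_wpDl ?sqr_ge0 ?exprn_gt0.
have da : is_derive x v a (2 * (phi x * 'D_v phi x)).
  have dp : is_derive x v phi ('D_v phi x) by exact: DeriveDef.
  have := is_deriveD (is_deriveM dp dp) (is_derive_cst (e ^+ 2) x v).
  rewrite (_ : phi * phi + _ = a); last by apply/funext => y; rewrite /a expr2.
  move=> H; apply: (is_derive_eq H); rewrite addr0 /GRing.scale/=; ring.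
have ds := is_derive_comp da (is_derive1_sqrt (a0 x)).
have s0 : 0 < Num.sqrt (a x) by rewrite sqrtr_gt0.
have s0' : (Num.sqrt \o a) x != 0 by rewrite gt_eqF.
split; first exact: (derivableV s0' (@ex_derive _ _ _ _ _ _ _ ds)).
rewrite (_ : (fun x => _) = (fun y => ((Num.sqrt \o a) y)^-1))//.
rewrite (deriveV s0' (@ex_derive _ _ _ _ _ _ _ ds)) (@derive_val _ _ _ _ _ _ _ ds).
rewrite /GRing.scale /= -/(a x); field; by rewrite gt_eqF.
Qed.

Lemma cd_inv_sqrt k phi (e : R) : 0 < e -> smooth phi ->
  continuously_differentiable k (fun x => (Num.sqrt (phi x ^+ 2 + e ^+ 2))^-1).
Proof.
move=> e0 sphi; set H := fun x => _.
have cH : continuous H.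
  move=> x.
  have a0 : 0 < phi x ^+ 2 + e ^+ 2 by rewrite ltr_wpDl ?sqr_ge0 ?exprn_gt0.
  apply: (@continuousV _ _ (fun x => Num.sqrt (phi x ^+ 2 + e ^+ 2)) x).
    by rewrite gt_eqF// sqrtr_gt0.
  apply: (@continuous_comp _ _ _ (fun x => phi x ^+ 2 + e ^+ 2) (@Num.sqrt R)).
    apply: (@continuousD _ _ _ (fun x => phi x ^+ 2) (cst (e ^+ 2)) x);
      last exact: cst_continuous.
    exact: (cd_continuous (cdM (sphi 0%N) (sphi 0%N))).
  exact: sqrt_continuous.
elim: k => [|k IH]; first by split.
split => // i.
have dphi x : derivable phi x 'e_i by case: (sphi 1%N) => _ /(_ i)[].
have dH x := is_derive_inv_sqrt e0 (dphi x).
split; first by move=> x; exact: (@ex_derive _ _ _ _ _ _ _ (dH x)).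
rewrite (_ : (fun x => _) =
    (fun x => - 1 * (phi x * 'D_('e_i) phi x) * (H x * (H x * H x)))); last first.
  apply/funext => x; rewrite (@derive_val _ _ _ _ _ _ _ (dH x)).
  by rewrite -/(H x) exprS expr2.
have dk : continuously_differentiable k (fun x => 'D_('e_i) phi x).
  by case: (sphi k.+1) => _ /(_ i)[].
apply: cdM; last by apply: cdM => //; exact: cdM.
by apply: cdZ; apply: cdM.
Qed.

(** The square root of A is A times its inverse square root. *)
Lemma smooth_smooth_abs phi (e : R) : 0 < e -> smooth phi ->
  smooth (smooth_abs e \o phi).
Proof.
move=> e0 sphi k; have CH := cd_inv_sqrt k e0 sphi.
rewrite (_ : _ \o _ = (fun x => (phi x * phi x + e ^+ 2) *
  (Num.sqrt (phi x ^+ 2 + e ^+ 2))^-1 + - e)); last first.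
  apply/funext => x /=; rewrite /smooth_abs; congr (_ - e).
  have a0 : 0 < phi x ^+ 2 + e ^+ 2 by rewrite ltr_wpDl ?sqr_ge0 ?exprn_gt0.
  rewrite -expr2 -[in X in X / _](@sqr_sqrtr _ (phi x ^+ 2 + e ^+ 2)) ?ltW//.
  by rewrite expr2 mulfK// gt_eqF// sqrtr_gt0.
by apply: cdD; [apply: cdM => //; apply: cdD; [exact: cdM|]|]; exact: cd_cst.
Qed.

End smooth_functions.

(** * Test functions *)
Section test_functions.
Context {R : realType} {N : nat}.
Local Notation E := 'rV[R]_N.
Local Notation dx := (@lebesgue_rV R N).
Local Notation dxdy := (dx \x dx)%E.
Implicit Types (f g phi psi : E -> R) (x y v : E) (Omega : set E).

(** The path h |-> x + h e_i turns the partial derivative into a derivative on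
    the real line, to which the mean value theorem applies. *)
Lemma derive_coord_line f (i : 'I_N) x (t : R) :
  (forall x, derivable f x 'e_i) ->
  is_derive t 1 (fun h : R => f (h *: 'e_i + x)) ('D_('e_i) f (t *: 'e_i + x)).
Proof.
move=> df.
have E1 : (fun h : R => h^-1 *: (((fun h : R => f (h *: 'e_i + x)) \o shift t) (h *: 1)
      - f (t *: 'e_i + x))) =
    (fun h => h^-1 *: ((f \o shift (t *: 'e_i + x)) (h *: 'e_i) - f (t *: 'e_i + x))).
  by apply/funext => h /=; rewrite [_%:A]mulr1 scalerDl addrA.
split; first by rewrite /derivable E1; exact: df.
by rewrite /derive E1.
Qed.

Lemma coord_lipschitz f (i : 'I_N) (M : R) x (t : R) :
  (forall x, derivable f x 'e_i) -> (forall x, `|'D_('e_i) f x| <= M) ->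
  `|f (t *: 'e_i + x) - f x| <= M * `|t|.
Proof.
move=> df dM.
pose g (h : R) : R := f (h *: 'e_i + x).
have dg (h : R) : is_derive h 1 g ('D_('e_i) f (h *: 'e_i + x)) by exact: derive_coord_line.
have cg : continuous g.
  move=> h; apply/differentiable_continuous/derivable1_diffP.
  exact: (@ex_derive _ _ _ _ _ _ _ (dg h)).
have g0 : f x = g 0 by rewrite /g scale0r add0r.
rewrite -/(g t) g0.
have [t0|t0] := leP 0 t.
  have [c _ ->] := MVT_segment t0 (fun h _ => dg h) (continuous_subspaceT cg).
  by rewrite subr0 normrM ler_wpM2r.
have [c _ E1] := MVT_segment (ltW t0) (fun h _ => dg h) (continuous_subspaceT cg).
by rewrite distrC E1 sub0r normrM normrN ler_wpM2r.
Qed.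

(** The points of a path from x to y that changes one coordinate at a time. *)
Definition coord_switch (x y : E) (k : nat) : E := \row_j (if (j < k)%N then y 0 j else x 0 j).

Lemma coord_switchS x y (k : 'I_N) :
  coord_switch x y k.+1 = (y 0 k - x 0 k) *: 'e_k + coord_switch x y k.
Proof.
apply/rowP => j; rewrite !mxE eqxx /= ltnS leq_eqVlt.
have [->|jk] := eqVneq j k.
  by rewrite eqxx /= ltnn mulr1 subrK.
by rewrite -[(j == k :> nat)]/(j == k) (negbTE jk) /= mulr0 add0r.
Qed.

(** Telescope along the path [coord_switch], using the mean value theorem on
    each edge. *)
Lemma lipschitz_of_bounded_partials f (M : 'I_N -> R) :
  (forall i x, derivable f x 'e_i) -> (forall i x, `|'D_('e_i) f x| <= M i) ->
  forall x y, `|f x - f y| <= (\sum_i M i) * enorm (x - y).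
Proof.
move=> df dM x y.
have -> : f x - f y = \sum_(k < N) (f (coord_switch y x k.+1) - f (coord_switch y x k)).
  rewrite -(big_mkord xpredT (fun k => f (coord_switch y x k.+1) - f (coord_switch y x k))) /=.
  rewrite telescope_sumr//; congr (f _ - f _); apply/rowP => j; rewrite mxE ?ltn_ord//.
rewrite mulr_suml; apply: le_trans (ler_norm_sum _ _ _) _.
apply: ler_sum => k _; rewrite coord_switchS.
apply: le_trans (coord_lipschitz _ _ (df k) (dM k)) _.
apply: ler_wpM2l; first exact: le_trans (dM k 0).
by have := coord_le_enorm (x - y) k; rewrite !mxE.
Qed.

Lemma zero_off_support phi x : ~ closure [set x | phi x != 0] x -> phi x = 0.
Proof.
move=> nx; apply/eqP; apply: contra_notT nx => phix.
exact: subset_closure.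
Qed.

Lemma derive_zero_off_support phi x v :
  ~ closure [set x | phi x != 0] x -> 'D_v phi x = 0.
Proof.
move=> nx; rewrite -(derive_cst (0 : R) x v); apply: near_eq_derive.
have oC : open (~` closure [set x | phi x != 0]).
  by apply: closed_openC; exact: closed_closure.
have : nbhs x (~` closure [set x | phi x != 0]) by exact: open_nbhs_nbhs.
apply: filterS => y ny; apply/eqP; apply: contra_notT ny => phiy.
exact: subset_closure.
Qed.

Lemma bounded_of_compact_support f (S : set E) : continuous f -> compact S ->
  (forall x, ~ S x -> f x = 0) -> exists2 M : R, 0 <= M & forall x, `|f x| <= M.
Proof.
move=> cf cS f0.
have /compact_bounded[M0 [_ HM]] : compact (f @` S).
  by apply: continuous_compact => //; exact: continuous_subspaceT.
have M1 : M0 < `|M0| + 1 by rewrite (le_lt_trans (ler_norm _))// ltrDl.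
exists (`|M0| + 1); first by rewrite addr_ge0.
move=> x; have [Sx|nSx] := pselect (S x); last by rewrite f0// normr0 addr_ge0.
by apply: (HM _ M1); exists x.
Qed.

Lemma test_function_lipschitz Omega phi : test_function Omega phi ->
  exists2 L : R, 0 <= L & forall x y, `|phi x - phi y| <= L * enorm (x - y).
Proof.
move=> [sphi cS _].
have H (i : 'I_N) : exists M : R, 0 <= M /\ forall x, `|'D_('e_i) phi x| <= M.
  have cD : continuous (fun x => 'D_('e_i) phi x).
    by case: (sphi 1%N) => _ /(_ i)[_ []].
  have [M M0 HM] := bounded_of_compact_support cD cS (fun x =>
    @derive_zero_off_support phi x 'e_i).
  by exists M.
have {H}/choice[M HM] := H.
exists (\sum_i M i); first by apply: sumr_ge0 => i _; case: (HM i).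
apply: lipschitz_of_bounded_partials => [i x|i x]; last by case: (HM i).
by case: (sphi 1%N) => _ /(_ i)[].
Qed.

Lemma test_function_bounded Omega phi : test_function Omega phi ->
  exists2 M : R, 0 <= M & forall x, `|phi x| <= M.
Proof.
move=> tphi; have [sphi cS _] := tphi.
apply: (bounded_of_compact_support (cd_continuous (sphi 0%N)) cS) => x.
exact: zero_off_support.
Qed.

Lemma test_function_cube Omega phi : test_function Omega phi ->
  exists2 r : R, 0 <= r & forall x, phi x != 0 -> cube 0 r x.
Proof.
move=> [_ /compact_bounded[M0 [_ HM]] _].
have M1 : M0 < `|M0| + 1 by rewrite (le_lt_trans (ler_norm _))// ltrDl.
exists (`|M0| + 1); first by rewrite addr_ge0.
move=> x phix i; rewrite mxE sub0r normrN.
have xS : closure [set x | phi x != 0] x by exact: subset_closure.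
have := HM _ M1 x xS; rewrite /= [X in X <= _ -> _]/Num.norm/= mx_normrE.
apply: le_trans.
exact: (le_bigmax _ (fun ij : 'I_1 * 'I_N => `|x ij.1 ij.2|) (ord0, i)).
Qed.

Lemma measurable_test Omega phi : test_function Omega phi -> measurable_fun setT phi.
Proof. by move=> [/(_ 0%N)/cd_continuous + _ _]; exact: continuous_measurable_rV. Qed.

Lemma test_function_off Omega phi : test_function Omega phi ->
  forall x, ~ Omega x -> phi x = 0.
Proof.
move=> [_ _ sO] x nO; apply/eqP; apply: contra_notT nO => phix.
by apply: sO; exact: subset_closure.
Qed.

Lemma test_function_energy_lty Omega phi (s : R) : 0 < s < 1 ->
  test_function Omega phi -> (gagliardo_sq s phi < +oo)%E.
Proof.
move=> s01 tphi; have [L L0 HL] := test_function_lipschitz tphi.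
have [M M0 HM] := test_function_bounded tphi.
have [r r0 Hr] := test_function_cube tphi.
apply: (@gagliardo_sq_lty _ _ s phi L (M + M) r) => //.
  exact: measurable_test tphi.
by move=> x y; apply: le_trans (ler_normB _ _) _; exact: lerD.
Qed.

Lemma test_function_integrable Omega phi g : test_function Omega phi ->
  measurable_fun setT g -> (forall x, phi x = 0 -> g x = 0) ->
  (exists M : R, forall x, `|g x| <= M) ->
  dx.-integrable setT (EFin \o g).
Proof.
move=> tphi mg g0 [M gM]; have [r r0 Hr] := test_function_cube tphi.
have M0 : 0 <= M by exact: le_trans (gM 0).
have mI : measurable_fun setT (\1_(cube 0 r) : E -> R).
  by apply: measurable_indic; exact: measurable_cube.
apply: (@integrable_dominated _ _ _ _ _ (fun x => M * \1_(cube 0 r) x)) => //.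
  move=> x; have [px|px] := eqVneq (phi x) 0.
    by rewrite g0// normr0 mulr_ge0.
  by rewrite indicE (mem_set (Hr _ px)) mulr1.
apply: integrable_ge0_lty; first exact: measurable_funM.
  by move=> x; rewrite mulr_ge0.
rewrite integralZl_EFin_ge0// integral_indic//; last exact: measurable_cube.
by rewrite setIT [X in (_ * X)%E](lebesgue_cube 0 r0) -EFinM ltry.
Qed.

Lemma test_functionD Omega phi psi (a b : R) : test_function Omega phi ->
  test_function Omega psi -> test_function Omega (fun x => a * phi x + b * psi x).
Proof.
move=> [s1 c1 o1] [s2 c2 o2].
have sub : closure [set x | a * phi x + b * psi x != 0] `<=`
    closure [set x | phi x != 0] `|` closure [set x | psi x != 0].
  rewrite -closureU; apply: closure_subset => x /=.
  have [->|] := eqVneq (phi x) 0; last by left.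
  have [->|] := eqVneq (psi x) 0; last by right.
  by rewrite !mulr0 addr0 eqxx.
split.
- by move=> k; apply: cdD; exact: cdZ.
- apply: subclosed_compact sub; first exact: closed_closure.
  exact: compactU.
- by move=> x /sub [/o1|/o2].
Qed.

Lemma test_function_smooth_abs Omega phi (e : R) : 0 < e ->
  test_function Omega phi -> test_function Omega (smooth_abs e \o phi).
Proof.
move=> e0 [s1 c1 o1].
have sub : closure [set x | (smooth_abs e \o phi) x != 0] `<=`
    closure [set x | phi x != 0].
  apply: closure_subset => x /=; apply: contra => /eqP ->.
  by rewrite /smooth_abs expr0n add0r sqrtr_sqr gtr0_norm// subrr.
split.
- exact: smooth_smooth_abs.
- apply: subclosed_compact sub => //; exact: closed_closure.
- by move=> x /sub /o1.
Qed.

End test_functions.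

(** * Square-integrable functions *)
Section square_integrable.
Context d (T : measurableType d) (R : realType).
Variable mu : {measure set T -> \bar R}.
Implicit Types (f g h : T -> R) (a b : R).

Definition L2fun f := measurable_fun setT f /\
  mu.-integrable setT (EFin \o (fun x => f x ^+ 2)).

Definition dot f g : R := \int[mu]_x (f x * g x).

Lemma L2fun_lty f : measurable_fun setT f ->
  (\int[mu]_x (f x ^+ 2)%:E < +oo)%E -> L2fun f.
Proof.
move=> mf fI; split=> //; apply: integrable_ge0_lty => //.
  exact: measurable_funX.
by move=> x; exact: sqr_ge0.
Qed.

Lemma L2fun_mul_integrable f g : L2fun f -> L2fun g ->
  mu.-integrable setT (EFin \o (fun x => f x * g x)).
Proof.
move=> [mf If] [mg Ig].
apply: (integrable_dominated (g := fun x => f x ^+ 2 + g x ^+ 2)).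
- exact: (measurable_funM mf mg).
- move=> x; rewrite ler_norml.
  have := sqr_ge0 (f x - g x); have := sqr_ge0 (f x + g x).
  have := sqr_ge0 (f x); have := sqr_ge0 (g x).
  by rewrite sqrrB sqrrD => ? ? ? ?; apply/andP; split; lra.
- have := integrableD measurableT If Ig.
  by apply: eq_integrable.
Qed.

Lemma L2funD a b f g : L2fun f -> L2fun g -> L2fun (fun x => a * f x + b * g x).
Proof.
move=> Lf Lg; have [mf If] := Lf; have [mg Ig] := Lg.
have m : measurable_fun setT (fun x => a * f x + b * g x).
  apply: measurable_funD; exact: measurable_funM.
split=> //.
apply: (integrable_dominated
  (g := fun x => 2 * a ^+ 2 * f x ^+ 2 + 2 * b ^+ 2 * g x ^+ 2)).
- exact: measurable_funX.
- move=> x; rewrite ger0_norm ?sqr_ge0//.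
  have := sqr_ge0 (a * f x - b * g x); rewrite sqrrB sqrrD !exprMn; lra.
- have := integrableD measurableT (integrableZl measurableT (2 * a ^+ 2) If)
    (integrableZl measurableT (2 * b ^+ 2) Ig).
  by apply: eq_integrable.
Qed.

Lemma L2funZ a f : L2fun f -> L2fun (fun x => a * f x).
Proof.
move=> Lf; have := L2funD a 0 Lf Lf.
by under eq_fun do rewrite mul0r addr0.
Qed.

Lemma dotC f g : dot f g = dot g f.
Proof. by apply: eq_Rintegral => x _; rewrite mulrC. Qed.

Lemma dotDl a b f g h : L2fun f -> L2fun g -> L2fun h ->
  dot (fun x => a * f x + b * g x) h = a * dot f h + b * dot g h.
Proof.
move=> Lf Lg Lh.
have If := L2fun_mul_integrable Lf Lh; have Ig := L2fun_mul_integrable Lg Lh.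
rewrite /dot -(RintegralZl a measurableT If) -(RintegralZl b measurableT Ig).
rewrite -RintegralD//; first by apply: eq_Rintegral => x _; ring.
- have := integrableZl measurableT a If; by apply: eq_integrable.
- have := integrableZl measurableT b Ig; by apply: eq_integrable.
Qed.

Lemma dotDD a b f g : L2fun f -> L2fun g ->
  dot (fun x => a * f x + b * g x) (fun x => a * f x + b * g x) =
  a ^+ 2 * dot f f + 2 * a * b * dot f g + b ^+ 2 * dot g g.
Proof.
move=> Lf Lg; have Lh := L2funD a b Lf Lg.
set h := fun x => _ in Lh *.
have fh : dot f h = a * dot f f + b * dot f g.
  by rewrite dotC dotDl// (dotC g).
have gh : dot g h = a * dot f g + b * dot g g by rewrite dotC dotDl.
by rewrite {1}/h dotDl// fh gh; ring.
Qed.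

Lemma dotZl a f h : L2fun f -> L2fun h -> dot (fun x => a * f x) h = a * dot f h.
Proof.
move=> Lf Lh; rewrite -[RHS]addr0 -[X in _ + X](mul0r (dot f h)) -dotDl//.
by congr dot; apply/funext => x; rewrite mul0r addr0.
Qed.

Lemma dotZZ a f : L2fun f ->
  dot (fun x => a * f x) (fun x => a * f x) = a ^+ 2 * dot f f.
Proof. by move=> Lf; have La := L2funZ a Lf; rewrite dotZl// dotC dotZl// expr2 mulrA. Qed.

Lemma dot_sqr_ge0 f : 0 <= dot f f.
Proof. by apply: Rintegral_ge0 => x _; rewrite -expr2 sqr_ge0. Qed.

Lemma dotE f : L2fun f -> (\int[mu]_x (f x ^+ 2)%:E)%E = (dot f f)%:E.
Proof. by move=> [_ If]; rewrite integral_EFin_Rintegral. Qed.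

Lemma dot0_ae f : L2fun f -> dot f f = 0 -> {ae mu, forall x, f x = 0}.
Proof.
move=> Lf f0; have [mf If] := Lf.
have m2 : measurable_fun setT (EFin \o (fun x => f x ^+ 2)).
  by apply/measurable_EFinP; exact: measurable_funX.
have /(ae_eq_integral_abs mu measurableT m2).1 :
    (\int[mu]_x `|(EFin \o (fun x => f x ^+ 2)%R) x|)%E = 0%E.
  rewrite -[RHS]/(0%:E) -f0 -dotE//; apply: eq_integral => x _ /=.
  by rewrite ger0_norm// sqr_ge0.
apply: filterS => x /(_ I) /= [] /eqP; rewrite sqrf_eq0 => /eqP.
by [].
Qed.

(** The difference of the two sides is 1 / eta times the square of the norm of
    f - (1 + eta) g. *)
Lemma dot_near_le eta f g : 0 < eta -> L2fun f -> L2fun g ->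
  dot f f <= (1 + eta) * dot g g +
    (1 + eta^-1) * dot (fun x => f x - g x) (fun x => f x - g x).
Proof.
move=> e0 Lf Lg.
have -> : (fun x => f x - g x) = (fun x => 1 * f x + (- 1) * g x).
  by apply/funext => x; ring.
have : 0 <= eta^-1 * dot (fun x => 1 * f x + - (1 + eta) * g x)
                         (fun x => 1 * f x + - (1 + eta) * g x).
  by rewrite mulr_ge0 ?dot_sqr_ge0// invr_ge0 ltW.
rewrite !dotDD// -subr_ge0 => H.
rewrite -subr_ge0; apply: le_trans H _; rewrite le_eqVlt; apply/orP; left.
apply/eqP; field; by rewrite gt_eqF.
Qed.

End square_integrable.

(** * Functions of finite energy and approximation *)
Section energy_space.
Context {R : realType} {N : nat}.
Local Notation E := 'rV[R]_N.
Local Notation dx := (@lebesgue_rV R N).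
Local Notation dxdy := (dx \x dx)%E.
Variable s : R.
Implicit Types (u v phi psi : E -> R) (x y : E) (Omega : set E).

(** With this weight the energy is an L^2 inner product on pairs of points, so
    the algebra of [dot] covers the energy and the L^2 norm at once. *)
Definition weighted_diff u (z : E * E) : R :=
  (u z.1 - u z.2) * Num.sqrt (gagliardo_kernel s z).

Lemma weighted_diffM u v z : weighted_diff u z * weighted_diff v z =
  (u z.1 - u z.2) * (v z.1 - v z.2) * gagliardo_kernel s z.
Proof.
by rewrite /weighted_diff mulrACA -expr2 sqr_sqrtr// kernel_ge0.
Qed.

Lemma weighted_diff_sqr u : (fun z => weighted_diff u z ^+ 2) = energy_density s u.
Proof. by apply/funext => z; rewrite expr2 weighted_diffM -expr2. Qed.

Lemma weighted_diffD a b u v : weighted_diff (fun x => a * u x + b * v x) =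
  (fun z => a * weighted_diff u z + b * weighted_diff v z).
Proof. by apply/funext => z; rewrite /weighted_diff; ring. Qed.

Lemma weighted_diffB u v : weighted_diff (fun x => u x - v x) =
  (fun z => weighted_diff u z - weighted_diff v z).
Proof. by apply/funext => z; rewrite /weighted_diff; ring. Qed.

Lemma measurable_weighted_diff u : measurable_fun setT u ->
  measurable_fun setT (weighted_diff u).
Proof.
move=> mu; apply: (measurable_funM (measurable_diff mu)).
apply: (measurableT_comp _ (measurable_gagliardo_kernel s)).
by apply: continuous_measurable_fun; exact: sqrt_continuous.
Qed.

Definition finite_energy u := L2fun dx u /\ L2fun dxdy (weighted_diff u).

Definition energy u : R := dot dxdy (weighted_diff u) (weighted_diff u).
Definition mass u : R := dot dx u u.

Lemma gagliardo_formE u v :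
  gagliardo_form s u v = dot dxdy (weighted_diff u) (weighted_diff v).
Proof. by apply: eq_Rintegral => z _; rewrite weighted_diffM. Qed.

Lemma gagliardo_sqE u : gagliardo_sq s u =
  (\int[dxdy]_z (weighted_diff u z ^+ 2)%:E)%E.
Proof.
by apply: eq_integral => z _; rewrite [in RHS]expr2 weighted_diffM -expr2.
Qed.

Lemma gagliardo_sq_energy u : finite_energy u -> gagliardo_sq s u = (energy u)%:E.
Proof. by move=> [_ Lu]; rewrite gagliardo_sqE dotE. Qed.

Lemma finite_energyP u : measurable_fun setT u ->
  (\int[dx]_x (u x ^+ 2)%:E < +oo)%E -> (gagliardo_sq s u < +oo)%E ->
  finite_energy u.
Proof.
move=> mu u2 uQ; split; first exact: L2fun_lty.
apply: L2fun_lty; first exact: measurable_weighted_diff.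
by rewrite -gagliardo_sqE.
Qed.

Lemma finite_energyD a b u v : finite_energy u -> finite_energy v ->
  finite_energy (fun x => a * u x + b * v x).
Proof.
move=> [u1 u2] [v1 v2]; split; first exact: L2funD.
by rewrite weighted_diffD; exact: L2funD.
Qed.

Lemma energy_ge0 u : 0 <= energy u. Proof. exact: dot_sqr_ge0. Qed.
Lemma mass_ge0 u : 0 <= mass u. Proof. exact: dot_sqr_ge0. Qed.

Lemma energyZ a u : finite_energy u -> energy (fun x => a * u x) = a ^+ 2 * energy u.
Proof.
move=> [_ Lu]; rewrite -dotZZ// /energy; congr dot; apply/funext => z;
  by rewrite /weighted_diff; ring.
Qed.

Lemma massZ a u : finite_energy u -> mass (fun x => a * u x) = a ^+ 2 * mass u.
Proof. by move=> [Lu _]; exact: dotZZ. Qed.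

Lemma finite_energyZ a u : finite_energy u -> finite_energy (fun x => a * u x).
Proof.
move=> fu; have := finite_energyD a 0 fu fu.
by under eq_fun do rewrite mul0r addr0.
Qed.

Lemma finite_energyB u v : finite_energy u -> finite_energy v ->
  finite_energy (fun x => u x - v x).
Proof.
move=> fu fv; have := finite_energyD 1 (-1) fu fv.
by under eq_fun do rewrite mul1r mulN1r.
Qed.

Lemma energy_near_le eta u v : 0 < eta -> finite_energy u -> finite_energy v ->
  energy u <= (1 + eta) * energy v + (1 + eta^-1) * energy (fun x => u x - v x).
Proof.
move=> e0 [_ Lu] [_ Lv]; apply: le_trans (dot_near_le e0 Lu Lv) _.
by rewrite /energy weighted_diffB.
Qed.

Lemma mass_near_le eta u v : 0 < eta -> finite_energy u -> finite_energy v ->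
  mass u <= (1 + eta) * mass v + (1 + eta^-1) * mass (fun x => u x - v x).
Proof. by move=> e0 [Lu _] [Lv _]; exact: dot_near_le. Qed.

Hypothesis s01 : 0 < s < 1.

Lemma test_finite_energy Omega phi : test_function Omega phi -> finite_energy phi.
Proof.
move=> tphi; apply: finite_energyP.
- exact: measurable_test tphi.
- have [M M0 HM] := test_function_bounded tphi.
  have m2 : measurable_fun setT (fun x => phi x ^+ 2).
    by apply: measurable_funX; exact: measurable_test tphi.
  have [||_ I2] := integrableP _ _ _ (@test_function_integrable _ _ Omega phi
      (fun x => phi x ^+ 2) tphi m2 _ _).
  + by move=> x ->; rewrite expr0n.
  + by exists (M ^+ 2) => x; rewrite normrX lerXn2r ?nnegrE.
  apply: le_lt_trans I2; rewrite le_eqVlt; apply/orP; left; apply/eqP.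
  by apply: eq_integral => x _ /=; rewrite ger0_norm// sqr_ge0.
- exact: test_function_energy_lty tphi.
Qed.

Lemma Lnorm_on_powR Omega q u : 0 < q -> (forall x, ~ Omega x -> u x = 0) ->
  (Lnorm_on Omega q u `^ q = \int[dx]_x (`|u x| `^ q)%:E)%E.
Proof.
move=> q0 uO; rewrite /Lnorm_on powR_Lnorm ?gt_eqF//.
have -> : (EFin \o u) \_ Omega = EFin \o u.
  apply/funext => x; rewrite /patch; case: ifPn => // /negP xO.
  by rewrite /= uO// => Ox; apply: xO; rewrite inE.
by apply: eq_integral => x _.
Qed.

Lemma Lnorm2_sqr Omega u : (forall x, ~ Omega x -> u x = 0) ->
  (Lnorm_on Omega 2 u `^ 2 = \int[dx]_x (u x ^+ 2)%:E)%E.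
Proof.
move=> uO; rewrite Lnorm_on_powR//; apply: eq_integral => x _.
by rewrite sqr_powR// real_normK ?num_real.
Qed.

Lemma L2_cvg_small Omega (u_ : nat -> E -> R) v (e : R) : 0 < e ->
  (forall n x, ~ Omega x -> u_ n x = v x) -> L2_cvg Omega u_ v ->
  \forall n \near \oo, (\int[dx]_x ((u_ n x - v x) ^+ 2)%:E <= e%:E)%E.
Proof.
move=> e0 uv0 uv.
have se : (0 < (Num.sqrt e)%:E)%E by rewrite lte_fin sqrtr_gt0.
have nb : nbhs (0%E : \bar R) [set y | (y < (Num.sqrt e)%:E)%E].
  by apply: open_nbhs_nbhs; split => //; exact: open_ereal_lt_ereal.
have : \forall n \near \oo,
  (Lnorm_on Omega 2 (u_ n \- v)%R < (Num.sqrt e)%:E)%E by exact: (uv _ nb).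
apply: filterS => n un.
rewrite -(@Lnorm2_sqr Omega (u_ n \- v)); last first.
  by move=> x Ox /=; rewrite uv0// subrr.
have e2 : e%:E = ((Num.sqrt e)%:E `^ 2)%E.
  by rewrite poweR_EFin sqr_powR ?sqrtr_ge0// sqr_sqrtr// ltW.
rewrite e2; apply: gt0_ler_poweR => //; rewrite ?in_itv/= ?andbT ?leey ?Lnorm_ge0 ?ltW//.
Qed.

Lemma exists_fast_subseq (g : nat -> E -> R) (n0 : nat) :
  (forall e : R, 0 < e -> \forall n \near \oo, (\int[dx]_x (g n x ^+ 2)%:E <= e%:E)%E) ->
  exists k : nat -> nat, forall j, (n0 <= k j)%N /\
    (\int[dx]_x (g (k j) x ^+ 2)%:E <= (2^-1 ^+ j)%:E)%E.
Proof.
move=> H.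
have /choice[k kP] : forall j, exists m, (n0 <= m)%N /\
    (\int[dx]_x (g m x ^+ 2)%:E <= (2^-1 ^+ j)%:E)%E.
  move=> j; have h0 : 0 < 2^-1 ^+ j :> R by rewrite exprn_gt0.
  have [n1 _ Hn] := H _ h0; exists (maxn n0 n1); rewrite leq_maxl; split => //.
  by apply: Hn; rewrite /= leq_maxr.
by exists k.
Qed.

Lemma ae_cvg_fast (f_ : nat -> E -> R) (f : E -> R) :
  (forall n, measurable_fun setT (f_ n)) -> measurable_fun setT f ->
  (forall j, (\int[dx]_x ((f_ j x - f x) ^+ 2)%:E <= (2^-1 ^+ j)%:E)%E) ->
  {ae dx, forall x, f_ ^~ x @ \oo --> f x}.
Proof.
move=> mf_ mf H.
have := @ae_cvg0_summable _ _ _ dx (fun j x => (f_ j x - f x) ^+ 2).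
have m2 n : measurable_fun setT (fun x => (f_ n x - f x) ^+ 2).
  by apply: measurable_funX; exact: (measurable_funB (mf_ n) mf).
move=> /(_ m2 (fun n x => sqr_ge0 _) H); apply: filterS => x.
move=> c0; apply/cvgrPdist_lt => e e0.
have e2 : 0 < e ^+ 2 by rewrite exprn_gt0.
move/cvgrPdist_lt : c0 => /(_ _ e2); apply: filterS => n /=.
rewrite sub0r normrN ger0_norm ?sqr_ge0// distrC -[X in X < _]real_normK ?num_real//.
by rewrite ltr_pXn2r// nnegrE// ltW.
Qed.

Lemma weighted_diff_cvg (f_ : nat -> E -> R) (f : E -> R) z :
  f_ ^~ z.1 @ \oo --> f z.1 -> f_ ^~ z.2 @ \oo --> f z.2 ->
  (fun n => weighted_diff (f_ n) z) @ \oo --> weighted_diff f z.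
Proof. by move=> c1 c2; apply: cvgM; [exact: cvgB|exact: cvg_cst]. Qed.

(** The Cauchy sequence converges to u for the energy itself: along a
    subsequence it converges almost everywhere, and Fatou passes to the limit
    in the energy of the differences. *)
Lemma D0_approx Omega u : D0 Omega s u -> forall e : R, 0 < e ->
  exists phi, [/\ test_function Omega phi,
    (\int[dx]_x ((u x - phi x) ^+ 2)%:E <= e%:E)%E &
    (gagliardo_sq s (fun x => (u x - phi x)%R) <= e%:E)%E].
Proof.
move=> [mu uO [phi_ [tphi cphi uphi]]] e e0.
have mphi n : measurable_fun setT (phi_ n) := measurable_test (tphi n).
have small (d : R) : 0 < d ->
    \forall n \near \oo, (\int[dx]_x ((phi_ n x - u x) ^+ 2)%:E <= d%:E)%E.
  move=> d0; apply: (L2_cvg_small d0 _ uphi) => n x Ox.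
  by rewrite uO// (test_function_off (tphi n)).
have [n0 Hn0] := cphi e e0.
have [n1 _ Hn1] := small _ e0.
pose n := maxn n0 n1; exists (phi_ n); split=> //.
  have -> : (fun x => ((u x - phi_ n x) ^+ 2)%:E) =
            (fun x => ((phi_ n x - u x) ^+ 2)%:E).
    by apply/funext => x; rewrite -opprB sqrrN.
  by apply: Hn1; rewrite /= leq_maxr.
have [k Hk] := exists_fast_subseq n0 small.
have cv : {ae dx, forall x, (fun j => phi_ (k j) x) @ \oo --> u x}.
  apply: ae_cvg_fast => // j; exact: (Hk j).2.
rewrite gagliardo_sqE.
apply: (@le_fatou_ae _ _ _ dxdy
  (fun j z => weighted_diff (fun x => phi_ (k j) x - phi_ n x) z ^+ 2)).
- move=> j; apply: measurable_funX; apply: measurable_weighted_diff.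
  exact: (measurable_funB (mphi _) (mphi _)).
- apply: measurable_funX; apply: measurable_weighted_diff.
  exact: (measurable_funB mu (mphi _)).
- by move=> j z; exact: sqr_ge0.
- by move=> z; exact: sqr_ge0.
- have := ae_prod cv; apply: filterS => z [c1 c2].
  have H : (fun j => weighted_diff (fun x => phi_ (k j) x - phi_ n x) z) @ \oo -->
      weighted_diff (fun x => u x - phi_ n x) z.
    by apply: weighted_diff_cvg; apply: cvgB => //; exact: cvg_cst.
  exact: (cvgM H H).
- move=> e' e'0; apply: nearW => j; rewrite -gagliardo_sqE.
  have nn0 : (n0 <= n)%N by rewrite leq_maxl.
  apply: (le_trans (ltW (Hn0 _ _ (Hk j).1 nn0))).
  by rewrite lee_fin lerDl ltW.
Qed.

End energy_space.

(** * The completion as a vector space *)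
Section D0_space.
Context {R : realType} {N : nat}.
Local Notation E := 'rV[R]_N.
Local Notation dx := (@lebesgue_rV R N).
Local Notation dxdy := (dx \x dx)%E.
Variable s : R.
Hypothesis s01 : 0 < s < 1.
Variable Omega : set E.
Implicit Types (u v phi psi : E -> R) (x y : E).
Local Notation finite_energy := (finite_energy s).
Local Notation energy := (energy s).

Lemma D0_finite_energy u : D0 Omega s u -> finite_energy u.
Proof.
move=> Du; have [phi [tphi m e]] := D0_approx Du ltr01.
have [mu _ _] := Du.
have fphi := test_finite_energy s01 tphi.
have fd : finite_energy (fun x => u x - phi x).
  apply: finite_energyP; first exact: (measurable_funB mu (measurable_test tphi)).
    by apply: le_lt_trans m _; rewrite ltry.
  by apply: le_lt_trans e _; rewrite ltry.
have := finite_energyD 1 1 fd fphi.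
by under eq_fun do rewrite !mul1r subrK.
Qed.

Lemma D0_dense u : D0 Omega s u -> forall e : R, 0 < e ->
  exists phi, [/\ test_function Omega phi,
    mass (fun x => u x - phi x) <= e & energy (fun x => u x - phi x) <= e].
Proof.
move=> Du e e0; have [phi [tphi m q]] := D0_approx Du e0.
have fd := finite_energyB (D0_finite_energy Du) (test_finite_energy s01 tphi).
exists phi; split => //; first by rewrite -lee_fin -(dotE fd.1).
by rewrite -lee_fin -gagliardo_sq_energy.
Qed.

Lemma poweR2_le (a : \bar R) (e : R) : 0 <= e -> (0 <= a)%E ->
  (a `^ 2 <= (e ^+ 2)%:E)%E -> (a <= e%:E)%E.
Proof.
move=> e0; case: a => [r| |]//.
  rewrite lee_fin => r0; rewrite poweR_EFin !lee_fin sqr_powR//.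
  by rewrite ler_pXn2r// ?nnegrE.
by move=> _; rewrite poweRE pnatr_eq0 eqxx.
Qed.

(** Converse of [D0_dense]; it is how membership in the completion is checked. *)
Lemma D0_of_dense u : measurable_fun setT u -> (forall x, ~ Omega x -> u x = 0) ->
  finite_energy u ->
  (forall e : R, 0 < e -> exists phi, [/\ test_function Omega phi,
    mass (fun x => u x - phi x) <= e & energy (fun x => u x - phi x) <= e]) ->
  D0 Omega s u.
Proof.
move=> mu uO fu H; split => //.
have /choice[phi_ Hphi] : forall n, exists phi, [/\ test_function Omega phi,
    mass (fun x => u x - phi x) <= n.+1%:R^-1 ^+ 2 &
    energy (fun x => u x - phi x) <= n.+1%:R^-1 ^+ 2].
  by move=> n; apply: H; rewrite exprn_gt0// invr_gt0.
have tphi n : test_function Omega (phi_ n) by case: (Hphi n).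
have fphi n := test_finite_energy s01 (tphi n).
have fd n := finite_energyB fu (fphi n).
have inv0 (e : R) : 0 < e -> exists n0, forall n, (n0 <= n)%N -> n.+1%:R^-1 < e.
  move=> e0; have /cvgrPdist_lt/(_ _ e0)[n0 _ Hn] := @cvg_harmonic R.
  exists n0 => n n0n; have := Hn n n0n; rewrite /= sub0r normrN ger0_norm//.
exists phi_; split => //.
- move=> e e0; have e4 : 0 < Num.min 1 (e / 4) by rewrite lt_min ltr01 divr_gt0.
  have [n0 Hn0] := inv0 _ e4.
  have small n : (n0 <= n)%N -> energy (fun x => u x - phi_ n x) < e / 4.
    move=> n0n; have [_ _ h] := Hphi n; apply: le_lt_trans h _.
    have := Hn0 n n0n; rewrite lt_min => /andP[h1 h2].
    by apply: le_lt_trans h2; rewrite expr2 ler_piMl// ltW.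
  exists n0 => m n n0m n0n.
  have E1 : (phi_ m \- phi_ n) =
      (fun x => 1 * (u x - phi_ n x) + (-1) * (u x - phi_ m x)).
    by apply/funext => x /=; ring.
  have fmn : finite_energy (phi_ m \- phi_ n) by rewrite E1; exact: finite_energyD.
  rewrite gagliardo_sq_energy// lte_fin.
  have := energy_near_le ltr01 fmn (finite_energyZ (-1) (fd m)).
  rewrite energyZ//.
  rewrite (_ : (fun x => (phi_ m \- phi_ n) x - -1 * _) = (fun x => u x - phi_ n x)); last first.
    by apply/funext => x /=; ring.
  by have := small m n0m; have := small n n0n; rewrite invr1 sqrrN expr1n; lra.
- apply/fine_cvgP.
  have le n : (Lnorm_on Omega 2 (phi_ n \- u)%R <= (n.+1%:R^-1)%:E)%E.
    apply: poweR2_le; [by rewrite invr_ge0|exact: Lnorm_ge0|].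
    rewrite Lnorm2_sqr; last first.
      by move=> x Ox /=; rewrite uO// (test_function_off (tphi n))// subrr.
    rewrite (eq_integral (fun x => ((u x - phi_ n x) ^+ 2)%:E)); last first.
      by move=> x _ /=; rewrite -opprB sqrrN.
    by rewrite (dotE (fd n).1) lee_fin; case: (Hphi n).
  have fin n : Lnorm_on Omega 2 (phi_ n \- u)%R \is a fin_num.
    rewrite ge0_fin_numE; last exact: Lnorm_ge0.
    by apply: le_lt_trans (le n) _; rewrite ltry.
  split; first exact: nearW.
  apply/cvgrPdist_lt => e e0; have [n0 Hn0] := inv0 _ e0; exists n0 => // n /= n0n.
  rewrite sub0r normrN ger0_norm; last by rewrite fine_ge0// Lnorm_ge0.
  apply: le_lt_trans (Hn0 n n0n).
  by rewrite -lee_fin fineK.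
Qed.

Lemma D0D a b u v : D0 Omega s u -> D0 Omega s v ->
  D0 Omega s (fun x => a * u x + b * v x).
Proof.
move=> Du Dv; have fu := D0_finite_energy Du; have fv := D0_finite_energy Dv.
have f1 := finite_energyD a b fu fv.
apply: D0_of_dense => //.
- by case: f1 => -[].
- by move=> x Ox; case: Du => _ -> // _; case: Dv => _ -> // _; rewrite !mulr0 addr0.
move=> e e0; pose c := 2 * a ^+ 2 + 2 * b ^+ 2 + 1.
have c0 : 0 < c by rewrite ltr_wpDl// addr_ge0// mulr_ge0// sqr_ge0.
have ec : 0 < e / c by rewrite divr_gt0.
have [phi [tphi mphi ephi]] := D0_dense Du ec.
have [psi [tpsi mpsi epsi]] := D0_dense Dv ec.
exists (fun x => a * phi x + b * psi x); split; first exact: test_functionD.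
- have fd := finite_energyB fu (test_finite_energy s01 tphi).
  have fe := finite_energyB fv (test_finite_energy s01 tpsi).
  have fE := finite_energyD a b fd fe.
  have := mass_near_le ltr01 fE (finite_energyZ a fd).
  rewrite (massZ _ fd).
  rewrite (_ : (fun x => _ - a * _) = (fun x => b * (v x - psi x))); last first.
    by apply/funext => x; ring.
  rewrite (massZ _ fe).
  rewrite (_ : (fun x => a * u x + b * v x - _) =
    (fun x => a * (u x - phi x) + b * (v x - psi x))); last first.
    by apply/funext => x; ring.
  move=> /le_trans; apply; rewrite invr1.
  have h1 := ler_wpM2l (sqr_ge0 a) mphi; have h2 := ler_wpM2l (sqr_ge0 b) mpsi.
  rewrite -[leRHS](divfK (lt0r_neq0 c0)) /c mulrDr mulrDr mulr1.
  have := ltW ec; lra.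
- have fd := finite_energyB fu (test_finite_energy s01 tphi).
  have fe := finite_energyB fv (test_finite_energy s01 tpsi).
  have fE := finite_energyD a b fd fe.
  have := energy_near_le ltr01 fE (finite_energyZ a fd).
  rewrite energyZ//.
  rewrite (_ : (fun x => _ - a * _) = (fun x => b * (v x - psi x))); last first.
    by apply/funext => x; ring.
  rewrite energyZ//.
  rewrite (_ : (fun x => a * u x + b * v x - _) =
    (fun x => a * (u x - phi x) + b * (v x - psi x))); last first.
    by apply/funext => x; ring.
  move=> /le_trans; apply; rewrite invr1.
  have h1 := ler_wpM2l (sqr_ge0 a) ephi; have h2 := ler_wpM2l (sqr_ge0 b) epsi.
  rewrite -[leRHS](divfK (lt0r_neq0 c0)) /c mulrDr mulrDr mulr1.
  have := ltW ec; lra.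
Qed.

Lemma D0Z a u : D0 Omega s u -> D0 Omega s (fun x => a * u x).
Proof.
move=> Du; have := D0D a 0 Du Du.
by under eq_fun do rewrite mul0r addr0.
Qed.

(** Approximants with almost no excess energy, obtained from a small weight eta
    in [energy_near_le]. *)
Lemma D0_energy_approx u : D0 Omega s u -> forall e : R, 0 < e ->
  exists phi, [/\ test_function Omega phi,
    mass (fun x => u x - phi x) <= e & energy phi <= energy u + e].
Proof.
move=> Du e e0; have fu := D0_finite_energy Du.
pose eta := e / (2 * (energy u + 1)).
have E0 : 0 <= energy u := energy_ge0 s u.
have eta0 : 0 < eta by rewrite divr_gt0// mulr_gt0// ltr_wpDl.
pose d := Num.min e (e / (2 * (1 + eta^-1))).
have k0 : 0 < 1 + eta^-1 by rewrite addr_gt0// invr_gt0.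
have d0 : 0 < d by rewrite lt_min e0 divr_gt0// mulr_gt0.
have [phi [tphi m q]] := D0_dense Du d0.
exists phi; split => //; first by apply: le_trans m _; rewrite ge_min lexx.
have fphi := test_finite_energy s01 tphi.
apply: le_trans (energy_near_le eta0 fphi fu) _.
have -> : energy (fun x => phi x - u x) = energy (fun x => u x - phi x).
  rewrite -[RHS]mul1r -(expr1n _ 2) -sqrrN -energyZ; last exact: finite_energyB.
  by congr energy; apply/funext => x; ring.
have q' : energy (fun x => u x - phi x) <= e / (2 * (1 + eta^-1)).
  by apply: le_trans q _; rewrite ge_min lexx orbT.
have h1 : (1 + eta^-1) * energy (fun x => u x - phi x) <= e / 2.
  apply: le_trans (ler_wpM2l (ltW k0) q') _.
  move: k0; set k := 1 + _ => k0.
  by rewrite le_eqVlt; apply/orP; left; apply/eqP; field; rewrite gt_eqF.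
have h2 : eta * energy u <= e / 2.
  rewrite /eta mulrAC ler_pdivrMr ?mulr_gt0 ?ltr_wpDl//.
  have := ltW e0; set x := energy u in E0 *; nra.
by rewrite mulrDl mul1r; lra.
Qed.

End D0_space.

(** * The sign defect *)
Section sign_defect.
Context {R : realType} {N : nat}.
Local Notation E := 'rV[R]_N.
Local Notation dx := (@lebesgue_rV R N).
Local Notation dxdy := (dx \x dx)%E.
Variable s : R.
Implicit Types (u v phi psi f : E -> R) (x y : E) (Omega : set E).
Local Notation finite_energy := (finite_energy s).
Local Notation energy := (energy s).

Definition sign_defect u (z : E * E) : R :=
  energy_density s u z - energy_density s (fun x => `|u x|) z.

Lemma sign_defectE u z : sign_defect u z =
  2 * (`|u z.1 * u z.2| - u z.1 * u z.2) * gagliardo_kernel s z.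
Proof.
rewrite /sign_defect /energy_density normrM !sqrrB !real_normK ?num_real//; ring.
Qed.

Lemma sign_defect_ge0 u z : 0 <= sign_defect u z.
Proof.
by rewrite sign_defectE mulr_ge0 ?kernel_ge0// mulr_ge0// subr_ge0 ler_norm.
Qed.

Lemma measurable_sign_defect u : measurable_fun setT u ->
  measurable_fun setT (sign_defect u).
Proof.
move=> mu; apply: (measurable_funB (measurable_energy_density s mu)).
by apply: measurable_energy_density; exact: measurableT_comp.
Qed.

(** The density is positive on the product of the sets where f is positive and
    negative, so that product is a null set and one factor is null. *)
Lemma sign_defect0_sign f : measurable_fun setT f ->
  (\int[dxdy]_z (sign_defect f z)%:E <= 0)%E ->
  {ae dx, forall x, 0 <= f x} \/ {ae dx, forall x, f x <= 0}.
Proof.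
move=> mf f0.
have mE : measurable_fun setT (EFin \o sign_defect f).
  by apply/measurable_EFinP; exact: measurable_sign_defect.
have I0 : (\int[dxdy]_z `|(EFin \o sign_defect f) z|)%E = 0%E.
  apply/eqP; rewrite eq_le integral_ge0// andbT; apply: le_trans f0.
  rewrite le_eqVlt; apply/orP; left; apply/eqP; apply: eq_integral => z _ /=.
  by rewrite ger0_norm// sign_defect_ge0.
have /= [A [mA A0 sA]] := (ae_eq_integral_abs dxdy measurableT mE).1 I0.
pose P := f @^-1` `]0, +oo[%classic; pose M := f @^-1` `]-oo, 0[%classic.
have mP : measurable P.
  by rewrite -[X in measurable X]setTI; apply: mf => //; exact: measurable_itv.
have mM : measurable M.
  by rewrite -[X in measurable X]setTI; apply: mf => //; exact: measurable_itv.
have PM : P `*` M `<=` A.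
  move=> [x y] [] /=; rewrite /P /M /= !in_itv/= andbT => fx fy; apply: sA => /= h.
  have xNy : x != y by apply: contraTneq fx => ->; rewrite -leNgt ltW.
  have k0 : 0 < gagliardo_kernel s (x, y).
    rewrite invr_gt0 powR_gt0// lt_neqAle enorm_ge0 andbT eq_sym.
    by apply: contra xNy => /= /eqP xy0; apply/eqP; exact: (@enorm0_eq R N x y).
  have := h I => /= -[]; rewrite sign_defectE /= => /eqP.
  have fxy : f x * f y < 0 by rewrite pmulr_rlt0.
  rewrite mulf_eq0 (gt_eqF k0) orbF mulf_eq0 pnatr_eq0 /= ltr0_norm//.
  move=> /eqP; lra.
have PM0 : (dx P * dx M)%E = 0%E.
  rewrite -(product_measure1E dx dx mP mM); apply/eqP; rewrite -measure_le0.
  rewrite -[leRHS]A0; apply: le_measure => //; rewrite inE//; exact: measurableX.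
move/eqP : PM0; rewrite mule_eq0 => /orP[/eqP P0|/eqP M0]; [right|left].
  exists P; split => // x /=; rewrite /P /= in_itv/= andbT => /negP.
  by rewrite -ltNge.
exists M; split => // x /=; rewrite /M /= in_itv/= => /negP.
by rewrite -ltNge.
Qed.

(** Cauchy-Schwarz for the vectors (a, e) and (b, e). *)
Lemma smooth_abs_contraction (e a b : R) : 0 < e ->
  (smooth_abs e a - smooth_abs e b) ^+ 2 <= (a - b) ^+ 2.
Proof.
move=> e0; rewrite /smooth_abs.
have p (t : R) : 0 <= t ^+ 2 + e ^+ 2 by rewrite addr_ge0 ?sqr_ge0.
have sA := sqr_sqrtr (p a); have sB := sqr_sqrtr (p b).
have A0 := sqrtr_ge0 (a ^+ 2 + e ^+ 2); have B0 := sqrtr_ge0 (b ^+ 2 + e ^+ 2).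
set A := Num.sqrt _ in sA A0 *; set B := Num.sqrt _ in sB B0 *.
have : a * b + e ^+ 2 <= A * B.
  apply: le_trans (ler_norm _) _.
  rewrite -[leRHS]ger0_norm ?mulr_ge0// -ler_sqr ?nnegrE// !real_normK ?num_real//.
  rewrite exprMn sA sB -subr_ge0.
  rewrite (_ : _ - _ = (e * (a - b)) ^+ 2); first exact: sqr_ge0.
  by ring.
have -> : A - e - (B - e) = A - B by ring.
rewrite !sqrrB sA sB; lra.
Qed.

Lemma smooth_abs_dist (e t : R) : 0 < e -> `|smooth_abs e t - `|t| | <= e.
Proof.
move=> e0; rewrite /smooth_abs.
have p : 0 <= t ^+ 2 + e ^+ 2 by rewrite addr_ge0 ?sqr_ge0.
have h1 : `|t| <= Num.sqrt (t ^+ 2 + e ^+ 2).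
  by rewrite -sqrtr_sqr ler_wsqrtr// lerDl sqr_ge0.
have h2 : Num.sqrt (t ^+ 2 + e ^+ 2) <= `|t| + e.
  have te : 0 <= `|t| + e by rewrite addr_ge0// ltW.
  rewrite -[leRHS]ger0_norm// -sqrtr_sqr ler_wsqrtr// sqrrD real_normK ?num_real//.
  by rewrite -addrA lerD2l lerDr mulrn_wge0// mulr_ge0// ltW.
by rewrite ler_norml; apply/andP; split; lra.
Qed.

Lemma smooth_abs_sqr_ge (e t : R) : 0 < e ->
  t ^+ 2 - 2 * e * `|t| <= smooth_abs e t ^+ 2.
Proof.
move=> e0; rewrite /smooth_abs.
have p : 0 <= t ^+ 2 + e ^+ 2 by rewrite addr_ge0 ?sqr_ge0.
have h2 : Num.sqrt (t ^+ 2 + e ^+ 2) <= `|t| + e.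
  have te : 0 <= `|t| + e by rewrite addr_ge0// ltW.
  rewrite -[leRHS]ger0_norm// -sqrtr_sqr ler_wsqrtr// sqrrD real_normK ?num_real//.
  by rewrite -addrA lerD2l lerDr mulrn_wge0// mulr_ge0// ltW.
have := sqr_sqrtr p; set A := Num.sqrt _ in h2 *.
rewrite sqrrB => ->.
have := ler_wpM2l (ltW e0) h2; rewrite mulrDr -mulr_natl => H.
by rewrite expr2; lra.
Qed.

Hypothesis s01 : 0 < s < 1.
Variable Omega : set E.
Variable l : R.
Hypothesis l0 : 0 <= l.
Hypothesis lP : forall phi, test_function Omega phi -> l * mass phi <= energy phi.

(** The functions [smooth_abs e \o phi] are competitors, so their energy is at
    least l times their mass.  The energy that phi loses under [smooth_abs e]
    has a nonnegative density converging to the sign defect; Fatou concludes. *)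
Lemma test_sign_defect_le phi : test_function Omega phi ->
  (\int[dxdy]_z (sign_defect phi z)%:E <= (energy phi - l * mass phi)%:E)%E.
Proof.
move=> tphi; have fphi := test_finite_energy s01 tphi.
have mphi := measurable_test tphi.
pose e_ n : R := n.+1%:R^-1.
have e0 n : 0 < e_ n by rewrite invr_gt0.
pose F n := smooth_abs (e_ n) \o phi.
have tF n : test_function Omega (F n) by exact: test_function_smooth_abs.
have fF n := test_finite_energy s01 (tF n).
have mF n := measurable_test (tF n).
have Iphi : dx.-integrable setT (EFin \o (fun x => `|phi x|)).
  apply: (test_function_integrable tphi); first exact: measurableT_comp.
    by move=> x ->; rewrite normr0.
  have [M M0 HM] := test_function_bounded tphi.
  by exists M => x; rewrite normr_id.
pose K := \int[dx]_x `|phi x|.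
have K0 : 0 <= K by apply: Rintegral_ge0.
have massF n : mass phi - 2 * e_ n * K <= mass (F n).
  rewrite /mass /dot /K -(RintegralZl (2 * e_ n) measurableT Iphi).
  have I1 := L2fun_mul_integrable fphi.1 fphi.1.
  have I2 : dx.-integrable setT (EFin \o (fun x => 2 * e_ n * `|phi x|)).
    by have := integrableZl measurableT (2 * e_ n) Iphi; apply: eq_integrable.
  rewrite -RintegralB//; apply: le_Rintegral => //.
  - by have := integrableB measurableT I1 I2; apply: eq_integrable.
  - exact: (L2fun_mul_integrable (fF n).1 (fF n).1).
  - by move=> x _; rewrite -!expr2; exact: smooth_abs_sqr_ge.
have Iw u : finite_energy u -> dxdy.-integrable setT (EFin \o energy_density s u).
  by move=> [_ [_]]; rewrite weighted_diff_sqr.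
have Ew u : finite_energy u -> \int[dxdy]_z energy_density s u z = energy u.
  by move=> [_ L]; apply: eq_Rintegral => z _; rewrite weighted_diffM -expr2.
pose f n z := energy_density s phi z - energy_density s (F n) z.
have f0 n z : 0 <= f n z.
  rewrite subr_ge0 /energy_density ler_wpM2r ?kernel_ge0//.
  exact: smooth_abs_contraction.
have If n : (\int[dxdy]_z (f n z)%:E = (energy phi - energy (F n))%:E)%E.
  rewrite -(Ew _ fphi) -(Ew _ (fF n)) -(RintegralB measurableT (Iw _ fphi) (Iw _ (fF n))).
  rewrite integral_EFin_Rintegral//.
  by have := integrableB measurableT (Iw _ fphi) (Iw _ (fF n)); apply: eq_integrable.
apply: (@le_fatou_ae _ _ _ dxdy f).
- move=> n; exact: (measurable_funB (measurable_energy_density s mphi)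
    (measurable_energy_density s (mF n))).
- exact: measurable_sign_defect.
- exact: f0.
- exact: sign_defect_ge0.
- apply: aeW => z.
  have cF x : (fun n => F n x) @ \oo --> `|phi x|.
    apply/cvgrPdist_le => e ee.
    have /cvgrPdist_lt/(_ _ ee) := @cvg_harmonic R; apply: filterS => n /=.
    rewrite sub0r normrN ger0_norm// => en; rewrite distrC.
    exact: le_trans (smooth_abs_dist _ (e0 n)) (ltW en).
  apply: cvgB; first exact: cvg_cst.
  apply: cvgM; last exact: cvg_cst.
  have cFF : (fun n => F n z.1 - F n z.2) @ \oo --> `|phi z.1| - `|phi z.2|.
    by apply: cvgB; exact: cF.
  exact: (cvgM cFF cFF).
- move=> e ee.
  pose d := e / (2 * l * K + 1).
  have d0 : 0 < d by rewrite divr_gt0// ltr_wpDl// !mulr_ge0.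
  have /cvgrPdist_lt/(_ _ d0) := @cvg_harmonic R; apply: filterS => n /=.
  rewrite sub0r normrN ger0_norm// => en; rewrite If lee_fin.
  have h1 := lP (tF n); have h2 := ler_wpM2l l0 (massF n).
  have h3 : e_ n * (2 * l * K + 1) <= e.
    by rewrite -ler_pdivlMr ?ltW// ltr_wpDl// !mulr_ge0.
  have := e0 n; move: h3; rewrite mulrDr mulr1 => h3 h4.
  have : l * mass phi - e_ n * (2 * l * K) <= l * mass (F n).
    by apply: le_trans h2; rewrite le_eqVlt; apply/orP; left; apply/eqP; ring.
  lra.
Qed.

(** Replace each f_n by a close test function with almost the same energy; then
    [test_sign_defect_le] and Fatou apply. *)
Lemma limit_sign_defect_le (f_ : nat -> E -> R) f (c : R) :
  (forall n, D0 Omega s (f_ n)) -> L2fun dx f ->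
  (forall e : R, 0 < e -> \forall n \near \oo, mass (fun x => f_ n x - f x) <= e) ->
  (forall e : R, 0 < e -> \forall n \near \oo, energy (f_ n) <= c + e) ->
  (\int[dxdy]_z (sign_defect f z)%:E <= (c - l * mass f)%:E)%E.
Proof.
move=> Df Lf m_ e_.
have h0 j : 0 < 2^-1 ^+ j :> R by rewrite exprn_gt0.
have ff n := D0_finite_energy s01 (Df n).
have /choice[psi Hpsi] : forall j, exists psi, [/\ test_function Omega psi,
    mass (fun x => psi x - f x) <= 2^-1 ^+ j & energy psi <= c + 2 * 2^-1 ^+ j].
  move=> j; have h4 : 0 < 2^-1 ^+ j / 4 :> R by rewrite divr_gt0.
  have [n [Hn1 Hn2]] : exists n, mass (fun x => f_ n x - f x) <= 2^-1 ^+ j / 4 /\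
      energy (f_ n) <= c + 2^-1 ^+ j.
    have [n1 _ H1] := m_ _ h4; have [n2 _ H2] := e_ _ (h0 j).
    exists (maxn n1 n2); split; first by apply: H1; rewrite /= leq_maxl.
    by apply: H2; rewrite /= leq_maxr.
  have [psi [tpsi mpsi epsi]] := D0_energy_approx s01 (Df n) h4.
  exists psi; split => //; last by lra.
  have L1 : L2fun dx (fun x => psi x - f x).
    have := L2funD 1 (-1) (test_finite_energy s01 tpsi).1 Lf.
    by under eq_fun do rewrite mul1r mulN1r.
  have L2 : L2fun dx (fun x => f_ n x - f x).
    have := L2funD 1 (-1) (ff n).1 Lf.
    by under eq_fun do rewrite mul1r mulN1r.
  apply: le_trans (dot_near_le ltr01 L1 L2) _.
  rewrite (_ : (fun x => _ - (_ - _)) = (fun x => -1 * (f_ n x - psi x))); last first.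
    by apply/funext => x; ring.
  rewrite dotZZ; last first.
    have := L2funD 1 (-1) (ff n).1 (test_finite_energy s01 tpsi).1.
    by under eq_fun do rewrite mul1r mulN1r.
  move: Hn1 mpsi; rewrite /mass invr1 sqrrN expr1n; lra.
have tpsi j : test_function Omega (psi j) by case: (Hpsi j).
have fpsi j := test_finite_energy s01 (tpsi j).
have mpsi j := measurable_test (tpsi j).
have Ld j : L2fun dx (fun x => psi j x - f x).
  have := L2funD 1 (-1) (fpsi j).1 Lf.
  by under eq_fun do rewrite mul1r mulN1r.
have cv : {ae dx, forall x, psi ^~ x @ \oo --> f x}.
  apply: ae_cvg_fast => //; first by case: Lf.
  by move=> j; rewrite (dotE (Ld j)) lee_fin; case: (Hpsi j).
apply: (@le_fatou_ae _ _ _ dxdy (fun j => sign_defect (psi j))).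
- by move=> j; exact: measurable_sign_defect.
- by apply: measurable_sign_defect; case: Lf.
- by move=> j z; exact: sign_defect_ge0.
- by move=> z; exact: sign_defect_ge0.
- have := ae_prod cv; apply: filterS => z [c1 c2].
  have ce g_ (g : E -> R) : g_ ^~ z.1 @ \oo --> g z.1 -> g_ ^~ z.2 @ \oo --> g z.2 ->
      (fun n => energy_density s (g_ n) z) @ \oo --> energy_density s g z.
    move=> d1 d2; apply: cvgM; last exact: cvg_cst.
    have d12 : (fun n => g_ n z.1 - g_ n z.2) @ \oo --> g z.1 - g z.2 by exact: cvgB.
    exact: (cvgM d12 d12).
  apply: cvgB; first exact: ce.
  by apply: (ce (fun n x => `|psi n x|) (fun x => `|f x|)); exact: cvg_norm.
- move=> e e0.
  pose A := l * mass f + 1; have A0 : 0 < A by rewrite ltr_wpDl// mulr_ge0// mass_ge0.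
  pose eta := e / (2 * A); have eta0 : 0 < eta by rewrite divr_gt0// mulr_gt0.
  pose B := 2 + l * eta^-1 + 1.
  have B0 : 0 < B by rewrite ltr_wpDl// addr_ge0// mulr_ge0// invr_ge0 ltW.
  have d0 : 0 < e / (2 * B) by rewrite divr_gt0// mulr_gt0.
  have h1 : `|2^-1 : R| < 1 by rewrite ger0_norm ?invr_ge0// invf_lt1// ltr1n.
  have /cvgrPdist_lt/(_ _ d0) := cvg_geometric 1 h1; apply: filterS => j.
  rewrite /= mul1r sub0r normrN (ger0_norm (ltW (h0 j))) => hj.
  apply: le_trans (test_sign_defect_le (tpsi j)) _; rewrite lee_fin.
  have [_ mj ej] := Hpsi j.
  (* lower bound for the masses, from the square of eta f + (psi_j - f) *)
  have low : (1 - eta) * mass f - eta^-1 * mass (fun x => psi j x - f x) <= mass (psi j).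
    have L1 := L2funD eta 1 Lf (Ld j).
    have : 0 <= eta^-1 * mass (fun x => eta * f x + 1 * (psi j x - f x)).
      by rewrite mulr_ge0 ?mass_ge0// invr_ge0 ltW.
    rewrite {1}/mass dotDD//.
    have -> : mass (psi j) = mass (fun x => 1 * f x + 1 * (psi j x - f x)).
      by congr mass; apply/funext => x; ring.
    rewrite /mass dotDD//.
    have := dot_sqr_ge0 dx (fun x => psi j x - f x).
    set m1 := dot _ f f; set m2 := dot _ f _; set m3 := dot _ _ _ => m30.
    have -> : eta^-1 * (eta ^+ 2 * m1 + 2 * eta * 1 * m2 + 1 ^+ 2 * m3) =
        eta * m1 + 2 * m2 + eta^-1 * m3 by field; rewrite gt_eqF.
    rewrite !expr1n !mul1r !mulr1 mulrBl mul1r; lra.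
  have h2 := ler_wpM2l l0 low.
  have ie0 : 0 <= l * eta^-1 by rewrite mulr_ge0// invr_ge0 ltW.
  have h3 := ler_wpM2l ie0 mj.
  have h4 : eta * A = e / 2 by rewrite /eta; field; rewrite gt_eqF.
  have h5 : 2^-1 ^+ j * B <= e / 2.
    apply: le_trans (ler_wpM2r (ltW B0) (ltW hj)) _.
    by rewrite le_eqVlt; apply/orP; left; apply/eqP; field; rewrite gt_eqF.
  have := h0 j; set t := 2^-1 ^+ j in ej mj h3 h5 * => t0.
  move: h2 h4 h5; rewrite /A /B; have := mass_ge0 f.
  move: h3 ej; set m1 := mass f; set m3 := mass (fun x => _).
  rewrite !mulrBr !mulrBl !mulrDr !mulr1 => h3 ej m10.
  have E1 : l * (eta * m1) = eta * (l * m1) by ring.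
  have E2 : l * (eta^-1 * m3) = l * eta^-1 * m3 by ring.
  have E3 : t * (l * eta^-1) = l * eta^-1 * t by ring.
  rewrite ?mul1r ?E1 ?E2 ?E3; lra.
Qed.

End sign_defect.

(** * Orthogonal almost minimizers do not exist *)
Section orthogonal_pairs.
Context {R : realType} {N : nat}.
Local Notation E := 'rV[R]_N.
Local Notation dx := (@lebesgue_rV R N).
Local Notation dxdy := (dx \x dx)%E.
Variable s : R.
Hypothesis s01 : 0 < s < 1.
Variable Omega : set E.
Hypothesis oOmega : open Omega.
Implicit Types (u v phi psi f g : E -> R) (x y : E).
Local Notation energy := (energy s).

Lemma homo_leq_id (k : nat -> nat) : {homo k : m n / (m < n)%N} ->
  forall n, (n <= k n)%N.
Proof. by move=> kP; elim => // n /leq_ltn_trans; apply; exact: kP. Qed.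

(** The limit is set to 0 outside Omega, where the convergence over Omega says
    nothing. *)
Lemma D0_compact : compact_embedding Omega s ->
  forall u_ : nat -> E -> R, (forall n, D0 Omega s (u_ n)) ->
  (exists M : R, forall n, energy (u_ n) <= M) ->
  exists (k : nat -> nat) f, [/\ {homo k : m n / (m < n)%N}, L2fun dx f &
    forall e : R, 0 < e -> \forall n \near \oo, mass (fun x => u_ (k n) x - f x) <= e].
Proof.
move=> [_ cpt] u_ Du [M uM].
have fu n := D0_finite_energy s01 (Du n).
have [|k [v [kP mv uv]]] := cpt u_ Du.
  by exists M => n; rewrite gagliardo_sq_energy// lee_fin.
pose f x : R := v x * \1_Omega x.
have mf : measurable_fun setT f.
  apply: measurable_funM => //; apply: measurable_indic; exact: open_measurable_rV.
have fO x : ~ Omega x -> f x = 0.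
  by move=> Ox; rewrite /f indicE memNset// mulr0.
have uO n x : ~ Omega x -> u_ n x = 0 by case: (Du n) => _ + _; apply.
have uf : L2_cvg Omega (u_ \o k) f.
  rewrite /L2_cvg (_ : (fun n => _) = (fun n => Lnorm_on Omega 2 ((u_ \o k) n \- v)))//.
  apply/funext => n; rewrite /Lnorm_on; congr (Lnorm _ _ _); apply/funext => x.
  rewrite /patch; case: ifPn => //; rewrite inE /= => Ox.
  by rewrite /f indicE mem_set// mulr1.
have small (e : R) : 0 < e ->
    \forall n \near \oo, (\int[dx]_x ((u_ (k n) x - f x) ^+ 2)%:E <= e%:E)%E.
  by move=> e0; apply: (L2_cvg_small e0 _ uf) => n x Ox /=; rewrite fO// uO.
have mu n : measurable_fun setT (u_ n) by case: (Du n).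
have Ld n (e : R) : (\int[dx]_x ((u_ (k n) x - f x) ^+ 2)%:E <= e%:E)%E ->
    L2fun dx (fun x => u_ (k n) x - f x).
  move=> h; apply: L2fun_lty; first exact: (measurable_funB (mu _) mf).
  by apply: le_lt_trans h _; rewrite ltry.
exists k, f; split => //.
  have [n _ Hn] := small 1 ltr01.
  have := L2funD 1 (-1) (fu (k n)).1 (Ld n 1 (Hn n (leqnn n))).
  by congr L2fun; apply/funext => x; ring.
move=> e e0; have := small e e0; apply: filterS => n hn.
by rewrite -lee_fin -(dotE (Ld _ _ hn)).
Qed.

(** This keeps the limits of normalized sequences away from 0. *)
Lemma mass_limit_ge1 (a_ : nat -> E -> R) f : (forall n, L2fun dx (a_ n)) ->
  L2fun dx f -> (forall n, mass (a_ n) = 1) ->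
  (forall e : R, 0 < e -> \forall n \near \oo, mass (fun x => a_ n x - f x) <= e) ->
  1 <= mass f.
Proof.
move=> La Lf ma cv; apply/ler_addgt0Pr => e e0.
pose eta := e / (2 * (mass f + 1)).
have E0 : 0 <= mass f := mass_ge0 f.
have eta0 : 0 < eta by rewrite divr_gt0// mulr_gt0// ltr_wpDl.
have k0 : 0 < 1 + eta^-1 by rewrite addr_gt0// invr_gt0.
have d0 : 0 < e / (2 * (1 + eta^-1)) by rewrite divr_gt0// mulr_gt0.
have [n _ /(_ n (leqnn n)) Hn] := cv _ d0.
rewrite -(ma n); apply: le_trans (dot_near_le eta0 (La n) Lf) _.
have h1 : (1 + eta^-1) * mass (fun x => a_ n x - f x) <= e / 2.
  apply: le_trans (ler_wpM2l (ltW k0) Hn) _.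
  move: k0; set k := 1 + _ => k0.
  by rewrite le_eqVlt; apply/orP; left; apply/eqP; field; rewrite gt_eqF.
have h2 : eta * mass f <= e / 2.
  rewrite /eta mulrAC ler_pdivrMr ?mulr_gt0 ?ltr_wpDl//.
  have := ltW e0; set x := mass f in E0 *; nra.
by rewrite mulrDl mul1r; move: h1 h2; rewrite /mass; lra.
Qed.

Lemma mass_ae0 f : measurable_fun setT f -> {ae dx, forall x, f x = 0} -> mass f = 0.
Proof.
move=> mf f0; rewrite /mass /dot /Rintegral.
rewrite (@ae_eq_integral _ _ _ dx setT (cst 0%E)) ?integral0//.
  by apply/measurable_EFinP; exact: measurable_funM.
by apply: filterS f0 => x fx _ /=; rewrite fx mul0r.
Qed.

(** After changing signs f and g are nonnegative, so orthogonality makes their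
    supports disjoint; then f - g has no constant sign unless one of them is 0. *)
Lemma one_signed_plane_trivial f g : L2fun dx f -> L2fun dx g -> dot dx f g = 0 ->
  (forall a b, {ae dx, forall x, 0 <= a * f x + b * g x} \/
               {ae dx, forall x, a * f x + b * g x <= 0}) ->
  mass f = 0 \/ mass g = 0.
Proof.
move=> Lf Lg fg0 sgn.
have pos h : L2fun dx h -> {ae dx, forall x, 0 <= h x} \/ {ae dx, forall x, h x <= 0} ->
    exists2 c : R, c != 0 & {ae dx, forall x, 0 <= c * h x}.
  move=> _ [h0|h0]; first by exists 1; rewrite ?oner_eq0//; apply: filterS h0 => x; rewrite mul1r.
  exists (-1); first by rewrite oppr_eq0 oner_eq0.
  by apply: filterS h0 => x; rewrite mulN1r oppr_ge0.
have [|a a0 af] := pos f Lf.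
  have [h|h] := sgn 1 0; [left|right]; apply: filterS h => x;
    by rewrite mul1r mul0r addr0.
have [|b b0 bg] := pos g Lg.
  have [h|h] := sgn 0 1; [left|right]; apply: filterS h => x;
    by rewrite mul1r mul0r add0r.
have Laf := L2funZ a Lf; have Lbg := L2funZ b Lg.
pose r x := (a * f x) * (b * g x).
have r_ae : {ae dx, forall x, r x = 0}.
  have Ir := L2fun_mul_integrable Laf Lbg.
  have mr : measurable_fun setT (EFin \o r) by case/integrableP: Ir.
  have r0 : (\int[dx]_x `|(EFin \o r) x| = 0)%E.
    transitivity (\int[dx]_x (r x)%:E)%E.
      apply: ae_eq_integral => //; first exact: measurableT_comp.
      apply: filterS2 af bg => x fx gx _ /=.
      by rewrite ger0_norm// mulr_ge0.
    rewrite integral_EFin_Rintegral// -[\int[dx]_x r x]/(dot dx _ _).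
    by rewrite dotZl// dotC dotZl// dotC fg0 !mulr0.
  have := (ae_eq_integral_abs dx measurableT mr).1 r0.
  by apply: filterS => x /(_ I) /= [].
have := sgn a (- b) => -[h|h]; [right|left].
  have g0 : {ae dx, forall x, g x = 0}.
    apply: filterS3 bg r_ae h => x bg0 /eqP; rewrite /r mulf_eq0 => /orP[/eqP ->|].
      rewrite mulNr add0r oppr_ge0 => bg1.
      have /eqP : b * g x = 0 by apply/eqP; rewrite eq_le bg1 bg0.
      by rewrite mulf_eq0 (negbTE b0) /= => /eqP.
    by rewrite mulf_eq0 (negbTE b0) /= => /eqP.
  by apply: mass_ae0 => //; case: Lg.
have f0 : {ae dx, forall x, f x = 0}.
  apply: filterS3 af r_ae h => x af0 /eqP; rewrite /r mulf_eq0 => /orP[|/eqP].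
    by rewrite mulf_eq0 (negbTE a0) /= => /eqP.
  rewrite mulNr => ->; rewrite subr0 => af1.
  have /eqP : a * f x = 0 by apply/eqP; rewrite eq_le af1 af0.
  by rewrite mulf_eq0 (negbTE a0) /= => /eqP.
by apply: mass_ae0 => //; case: Lf.
Qed.

(** Combine compactness with [limit_sign_defect_le] for all combinations of the
    two sequences.  Their orthogonality for the energy turns into orthogonality
    of the limits in L^2. *)
Lemma no_orthogonal_near_minimizers (l : R) (a_ b_ : nat -> E -> R) :
  compact_embedding Omega s -> 0 < l ->
  (forall phi, test_function Omega phi -> l * mass phi <= energy phi) ->
  (forall n, D0 Omega s (a_ n)) -> (forall n, D0 Omega s (b_ n)) ->
  (forall n, mass (a_ n) = 1) -> (forall n, mass (b_ n) = 1) ->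
  (forall n, dot dxdy (weighted_diff s (a_ n)) (weighted_diff s (b_ n)) = 0) ->
  (forall e : R, 0 < e -> \forall n \near \oo, energy (a_ n) <= l + e) ->
  (forall e : R, 0 < e -> \forall n \near \oo, energy (b_ n) <= l + e) ->
  False.
Proof.
move=> cpt l0 lP Da Db ma mb ab0 ea eb.
have [na _ Hna] := ea 1 ltr01; have [nb _ Hnb] := eb 1 ltr01.
pose n0 := maxn na nb.
have [||k1 [f [k1P Lf cf]]] := D0_compact cpt (u_ := fun n => a_ (n + n0)%N).
- by move=> n; exact: Da.
- exists (l + 1) => n; apply: Hna => /=.
  by rewrite (leq_trans (leq_maxl na nb))// leq_addl.
have [||k2 [g [k2P Lg cg]]] := D0_compact cpt (u_ := fun n => b_ (k1 n + n0)%N).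
- by move=> n; exact: Db.
- exists (l + 1) => n; apply: Hnb => /=.
  by rewrite (leq_trans (leq_maxr na nb))// leq_addl.
pose k n := (k1 (k2 n) + n0)%N.
have kn n : (n <= k n)%N.
  rewrite /k (leq_trans (homo_leq_id k2P n))// (leq_trans (homo_leq_id k1P _))//.
  exact: leq_addr.
have sub (P : nat -> Prop) : (\forall n \near \oo, P n) -> \forall n \near \oo, P (k n).
  by move=> [m _ Pm]; exists m => // n /= mn; apply: Pm => /=; exact: leq_trans (kn n).
have sub2 (P : nat -> Prop) : (\forall n \near \oo, P n) -> \forall n \near \oo, P (k2 n).
  move=> [m _ Pm]; exists m => // n /= mn; apply: Pm => /=.
  exact: leq_trans (homo_leq_id k2P n).
have fa n := D0_finite_energy s01 (Da n); have fb n := D0_finite_energy s01 (Db n).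
have ca (e : R) : 0 < e -> \forall n \near \oo, mass (fun x => a_ (k n) x - f x) <= e.
  by move=> e0; exact: (sub2 _ (cf e e0)).
have Mf := mass_limit_ge1 (fun n => (fa (k n)).1) Lf (fun n => ma (k n)) ca.
have Mg := mass_limit_ge1 (fun n => (fb (k n)).1) Lg (fun n => mb (k n)) cg.
have sgn_le a b : (\int[dxdy]_z (sign_defect s (fun x => a * f x + b * g x) z)%:E <=
    ((a ^+ 2 + b ^+ 2) * l - l * mass (fun x => a * f x + b * g x))%:E)%E.
  apply: (@limit_sign_defect_le _ _ s s01 Omega l (ltW l0) lP
    (fun n x => a * a_ (k n) x + b * b_ (k n) x)).
  - by move=> n; exact: D0D.
  - exact: L2funD.
  - move=> e e0; pose c := 2 * a ^+ 2 + 2 * b ^+ 2 + 1.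
    have c0 : 0 < c by rewrite ltr_wpDl// addr_ge0// mulr_ge0// sqr_ge0.
    have ec : 0 < e / c by rewrite divr_gt0.
    apply: filterS2 (ca _ ec) (cg _ ec) => n h1 h2.
    have L1 : L2fun dx (fun x => a_ (k n) x - f x).
      have := L2funD 1 (-1) (fa (k n)).1 Lf.
      by under eq_fun do rewrite mul1r mulN1r.
    have L2 : L2fun dx (fun x => b_ (k n) x - g x).
      have := L2funD 1 (-1) (fb (k n)).1 Lg.
      by under eq_fun do rewrite mul1r mulN1r.
    have := dot_near_le ltr01 (L2funD a b L1 L2) (L2funZ a L1).
    rewrite dotZZ//.
    rewrite (_ : (fun x => _ - a * _) = (fun x => b * (b_ (k n) x - g x))); last first.
      by apply/funext => x; ring.
    rewrite dotZZ// /mass.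
    rewrite (_ : (fun x => a * a_ (k n) x + _ - _) =
      (fun x => a * (a_ (k n) x - f x) + b * (b_ (k n) x - g x))); last first.
      by apply/funext => x; ring.
    move=> /le_trans; apply; rewrite invr1.
    have h1' := ler_wpM2l (sqr_ge0 a) h1; have h2' := ler_wpM2l (sqr_ge0 b) h2.
    rewrite -[leRHS](divfK (lt0r_neq0 c0)) /c mulrDr mulrDr mulr1.
    move: h1' h2'; rewrite /mass; have := ltW ec; lra.
  - move=> e e0; pose c := a ^+ 2 + b ^+ 2 + 1.
    have c0 : 0 < c by rewrite ltr_wpDl// addr_ge0// sqr_ge0.
    have ec : 0 < e / c by rewrite divr_gt0.
    apply: filterS2 (sub _ (ea _ ec)) (sub _ (eb _ ec)) => n h1 h2.
    rewrite /energy weighted_diffD (dotDD _ _ (fa _).2 (fb _).2) ab0 mulr0 addr0.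
    have h1' := ler_wpM2l (sqr_ge0 a) h1; have h2' := ler_wpM2l (sqr_ge0 b) h2.
    rewrite -[e in leRHS](divfK (lt0r_neq0 c0)) /c mulrDr mulrDr mulr1 mulrDl.
    move: h1' h2'; rewrite /energy !mulrDr; have := ltW ec; lra.
have massE a b : mass (fun x => a * f x + b * g x) =
    a ^+ 2 * mass f + 2 * a * b * dot dx f g + b ^+ 2 * mass g by exact: dotDD.
have defect0 a b : 0 <= (a ^+ 2 + b ^+ 2) * l - l * mass (fun x => a * f x + b * g x).
  rewrite -lee_fin; apply: le_trans (sgn_le a b); apply: integral_ge0 => z _.
  by rewrite lee_fin sign_defect_ge0.
(* compare the combinations f + g and f - g *)
have S0 : dot dx f g = 0.
  have := defect0 1 1; have := defect0 1 (-1); rewrite !massE sqrrN expr1n.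
  set m1 := mass f in Mf *; set m2 := mass g in Mg *; set S := dot _ _ _.
  rewrite !mulr1 !mul1r => d1 d2.
  have {}d1 : 0 <= l * (2 - m1 - m2 + 2 * S).
    apply: le_trans d1 _.
    by rewrite le_eqVlt; apply/orP; left; apply/eqP; ring.
  have {}d2 : 0 <= l * (2 - m1 - m2 - 2 * S).
    apply: le_trans d2 _.
    by rewrite le_eqVlt; apply/orP; left; apply/eqP; ring.
  rewrite pmulr_rge0// in d1; rewrite pmulr_rge0// in d2.
  by apply/eqP; rewrite eq_le; apply/andP; split; lra.
have [] := @one_signed_plane_trivial f g Lf Lg S0.
- move=> a b; apply: (@sign_defect0_sign _ _ s).
    by case: (L2funD a b Lf Lg).
  apply: le_trans (sgn_le a b) _; rewrite lee_fin massE S0 mulr0 addr0.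
  rewrite [_ * l]mulrC -mulrBr pmulr_rle0//.
  have := ler_wpM2l (sqr_ge0 a) Mf; have := ler_wpM2l (sqr_ge0 b) Mg; lra.
- by move=> mf0; move: Mf; rewrite mf0 ler10.
- by move=> mg0; move: Mg; rewrite mg0 ler10.
Qed.

End orthogonal_pairs.

(** * Continuity of the first eigenvalue at exponent 2 *)
Section rayleigh.
Context {R : realType} {N : nat}.
Local Notation E := 'rV[R]_N.
Local Notation dx := (@lebesgue_rV R N).
Local Notation dxdy := (dx \x dx)%E.
Variable s : R.
Hypothesis s01 : 0 < s < 1.
Variable Omega : set E.
Implicit Types (u v phi psi f g : E -> R) (x y : E) (q theta e : R).
Local Notation energy := (energy s).

Definition pmass q u : R := \int[dx]_x (`|u x| `^ q).

Lemma integral_on_Omega (f : E -> R) : (forall x, ~ Omega x -> f x = 0) ->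
  (\int[dx]_(x in Omega) (f x)%:E = \int[dx]_x (f x)%:E)%E.
Proof.
move=> fO; rewrite integral_mkcond; apply: eq_integral => x _.
by rewrite /patch; case: ifPn => // /negP nx; rewrite fO// => Ox; apply: nx; rewrite inE.
Qed.

Lemma measurable_powabs q u : measurable_fun setT u ->
  measurable_fun setT (fun x => `|u x| `^ q).
Proof.
move=> mu; apply: (measurableT_comp (measurable_powR q)).
exact: measurableT_comp.
Qed.

Lemma test_pmass_integrable q phi : 0 < q -> test_function Omega phi ->
  dx.-integrable setT (EFin \o (fun x => `|phi x| `^ q)).
Proof.
move=> q0 tphi; apply: (test_function_integrable tphi).
- exact: (measurable_powabs _ (measurable_test tphi)).
- by move=> x ->; rewrite normr0 powR0// gt_eqF.
- have [M M0 HM] := test_function_bounded tphi.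
  exists (M `^ q) => x; rewrite ger0_norm ?powR_ge0//.
  by apply: powR_homo => //; exact: ltW.
Qed.

Lemma lambda1_ge0 q : (0 <= lambda1 Omega s q)%E.
Proof.
apply: le_ereal_inf_tmp => _ [phi _ <-]; apply: integral_ge0 => z _.
by rewrite lee_fin mulr_ge0 ?sqr_ge0 ?kernel_ge0.
Qed.

Lemma pmassZ c q phi : 0 <= c -> 0 < q -> test_function Omega phi ->
  pmass q (fun x => c * phi x) = c `^ q * pmass q phi.
Proof.
move=> c0 q0 tphi; rewrite /pmass.
rewrite -(RintegralZl (c `^ q) measurableT (test_pmass_integrable q0 tphi)).
by apply: eq_Rintegral => x _; rewrite normrM (ger0_norm c0) powRM.
Qed.

Lemma test_functionZ c phi : test_function Omega phi ->
  test_function Omega (fun x => c * phi x).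
Proof.
move=> tphi; have := test_functionD c 0 tphi tphi.
by under eq_fun do rewrite mul0r addr0.
Qed.

Lemma lambda1_le q phi : 0 < q -> test_function Omega phi -> 0 < pmass q phi ->
  (lambda1 Omega s q <= (energy phi / pmass q phi `^ (2 / q))%:E)%E.
Proof.
move=> q0 tphi P0; pose c := pmass q phi `^ (- q^-1).
have c0 : 0 < c by exact: powR_gt0.
have tc := test_functionZ c tphi.
have fphi := test_finite_energy s01 tphi.
apply: ge_ereal_inf; exists (gagliardo_sq s (fun x => c * phi x)).
  exists (fun x => c * phi x) => //; split => //.
  rewrite integral_on_Omega; last first.
    by move=> x Ox; rewrite (test_function_off tc)// normr0 powR0// gt_eqF.
  rewrite (integral_EFin_Rintegral (test_pmass_integrable q0 tc)).
  rewrite -/(pmass q (fun x => c * phi x)) pmassZ ?(ltW c0)//.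
  rewrite /c -powRrM mulNr mulVf ?gt_eqF// powR_inv1 ?(ltW P0)// mulVf ?gt_eqF//.
rewrite (gagliardo_sq_energy (test_finite_energy s01 tc)) lee_fin energyZ//.
rewrite mulrC /c -powR_mulrn ?powR_ge0// -powRrM mulNr powRN mulrC [q^-1 * _]mulrC.
by rewrite mulrC.
Qed.

Lemma lambda1_fin q phi : 0 < q -> test_function Omega phi -> 0 < pmass q phi ->
  lambda1 Omega s q = (fine (lambda1 Omega s q))%:E.
Proof.
move=> q0 tphi P0; rewrite fineK// ge0_fin_numE ?lambda1_ge0//.
by apply: le_lt_trans (lambda1_le q0 tphi P0) _; rewrite ltry.
Qed.

Lemma pmass2 phi : pmass 2 phi = mass phi.
Proof.
apply: eq_Rintegral => x _.
by rewrite sqr_powR// real_normK ?num_real// expr2.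
Qed.

Lemma lambda1_2_le phi : test_function Omega phi ->
  fine (lambda1 Omega s 2) * mass phi <= energy phi.
Proof.
move=> tphi; have := mass_ge0 phi; rewrite le_eqVlt => /predU1P[<-|m0].
  by rewrite mulr0 energy_ge0.
rewrite -ler_pdivlMr//.
have m0' : 0 < pmass 2 phi by rewrite pmass2.
have := lambda1_le (ltr0n R 2) tphi m0'.
rewrite (lambda1_fin (ltr0n R 2) tphi m0') lee_fin divff ?pnatr_eq0// powRr1 ?(ltW m0')//.
by rewrite pmass2.
Qed.

(** A test function which is almost optimal for exponent 2 is a competitor for
    all nearby exponents, and its L^q norm drops by an amount of order q - 2 at most. *)
Lemma lambda1_limsup phi0 : test_function Omega phi0 -> 0 < mass phi0 ->
  forall e, 0 < e -> exists2 eta : R, 0 < eta & forall theta, 0 < theta < eta ->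
    fine (lambda1 Omega s (2 + theta)) <= fine (lambda1 Omega s 2) + e.
Proof.
move=> tphi0 m0 e e0; set l := fine (lambda1 Omega s 2).
have m0' : 0 < pmass 2 phi0 by rewrite pmass2.
have lE := lambda1_fin (ltr0n R 2) tphi0 m0'.
have [phi [tphi mphi ephi]] : exists phi, [/\ test_function Omega phi,
    mass phi = 1 & energy phi <= l + e / 2].
  have lf : lambda1 Omega s 2 \is a fin_num by rewrite lE.
  have e20 : 0 < e / 2 by rewrite divr_gt0.
  have [_ [phi [tphi I1] <-] h] := lb_ereal_inf_adherent e20 lf.
  exists phi; split => //.
    apply: EFin_inj; rewrite -I1 integral_on_Omega.
      rewrite (integral_EFin_Rintegral (test_pmass_integrable (ltr0n R 2) tphi)).
      by rewrite -pmass2.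
    by move=> x Ox; rewrite (test_function_off tphi)// normr0 powR0// pnatr_eq0.
  rewrite -lee_fin -(gagliardo_sq_energy (test_finite_energy s01 tphi)).
  apply: ltW; apply: lt_le_trans h _.
  by rewrite -/(lambda1 Omega s 2) lE EFinD.
pose K := \int[dx]_x `|phi x|.
have K0 : 0 <= K by apply: Rintegral_ge0.
(* with theta A < e / 2 one gets l + e / 2 <= (l + e) (1 - theta K) *)
pose A := K * (l + e) + 1.
have l0 : 0 <= l by rewrite fine_ge0// lambda1_ge0.
have A0 : 0 < A by rewrite ltr_wpDl// mulr_ge0// addr_ge0// ltW.
exists (Num.min 1 (e / 2 / A)); first by rewrite lt_min ltr01 !divr_gt0.
move=> theta /andP[t0]; rewrite lt_min => /andP[t1 tA].
have q0 : 0 < 2 + theta by rewrite addr_gt0.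
have {}tA : theta * A < e / 2 by rewrite -ltr_pdivlMr.
have Iphi : dx.-integrable setT (EFin \o (fun x => `|phi x|)).
  have := test_pmass_integrable ltr01 tphi.
  by apply: eq_integrable => // x _ /=; rewrite powRr1.
have fphi := test_finite_energy s01 tphi.
have P1 : 1 - theta * K <= pmass (2 + theta) phi.
  rewrite -[X in X - _]mphi /pmass /mass /dot /K -(RintegralZl theta measurableT Iphi).
  have I1 := L2fun_mul_integrable fphi.1 fphi.1.
  have I2 : dx.-integrable setT (EFin \o (fun x => theta * `|phi x|)).
    by have := integrableZl measurableT theta Iphi; apply: eq_integrable.
  rewrite -RintegralB//; apply: le_Rintegral => //.
  - by have := integrableB measurableT I1 I2; apply: eq_integrable.
  - exact: (test_pmass_integrable q0 tphi).
  - move=> x _; rewrite -expr2 -real_normK ?num_real//.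
    by apply: sqr_le_powR_near2; rewrite ?t0 ?t1.
have tK : theta * K * (l + e) < e / 2.
  by apply: le_lt_trans tA; rewrite /A -mulrA ler_wpM2l ?(ltW t0)// lerDl.
have tK1 : theta * K < 1.
  rewrite ltNge; apply/negP => h.
  have := ler_wpM2r (addr_ge0 l0 (ltW e0)) h; rewrite mul1r; lra.
have P0 : 0 < pmass (2 + theta) phi by apply: lt_le_trans P1; rewrite subr_gt0.
have := lambda1_le q0 tphi P0; rewrite (lambda1_fin q0 tphi P0) lee_fin.
move=> /le_trans; apply; rewrite ler_pdivrMr ?powR_gt0//.
have P2 : 1 - theta * K <= pmass (2 + theta) phi `^ (2 / (2 + theta)).
  have [p1|p1] := leP 1 (pmass (2 + theta) phi).
    apply: (@le_trans _ _ 1); first by rewrite gerBl mulr_ge0// ltW.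
    rewrite -[leLHS](powRr0 (pmass (2 + theta) phi)); apply: ler_powR => //.
    by rewrite divr_ge0// ltW.
  apply: le_trans P1 _; apply: ger1_powR; first by rewrite P0 ltW.
  by rewrite ler_pdivrMr// mul1r lerDl ltW.
have le0 : 0 <= l + e by rewrite addr_ge0// ltW.
apply: le_trans (ler_wpM2l le0 P2).
apply: le_trans ephi _; rewrite mulrBr mulr1 [X in _ - X]mulrC; lra.
Qed.

End rayleigh.

(** * Differences of normalized eigenfunctions *)
Section eigenfunctions.
Context {R : realType} {N : nat}.
Local Notation E := 'rV[R]_N.
Local Notation dx := (@lebesgue_rV R N).
Local Notation dxdy := (dx \x dx)%E.
Variable s : R.
Hypothesis s01 : 0 < s < 1.
Hypothesis N0 : (0 < N)%N.
Variable Omega : set E.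
Implicit Types (u v phi psi f g : E -> R) (x y : E) (q theta e l : R).
Local Notation energy := (energy s).
Local Notation wd := (weighted_diff s).
(** Any exponent strictly between 2 and the critical one could serve; for this
    one the embedding is elementary. *)
Definition gn_exponent : R := 2 + 4 * s / N%:R.
Local Notation p := gn_exponent.

Lemma gn_exponent_gt2 : 2 < p.
Proof.
by case/andP: s01 => s0 _; rewrite ltrDl divr_gt0 ?ltr0n// mulr_gt0.
Qed.

Lemma pmass_gn : exists2 C : R, 0 < C & forall u (k : R), finite_energy s u ->
  0 < k -> mass u <= k ->
  dx.-integrable setT (EFin \o (fun x => `|u x| `^ p)) /\
  pmass p u <= C * k `^ (2 * s / N%:R) * energy u.
Proof.
have s0 : 0 < s by case/andP: s01.
have [C C0 HC] := @gagliardo_nirenberg R N s N0 s0; exists C => // u k fu k0 mk.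
have mu : measurable_fun setT u by case: fu => -[].
have := HC u k mu k0; rewrite (dotE fu.1) lee_fin => /(_ mk).
rewrite (gagliardo_sq_energy fu) -EFinM => h.
have I : dx.-integrable setT (EFin \o (fun x => `|u x| `^ p)).
  apply: integrable_ge0_lty; first exact: measurable_powabs.
    by move=> x; exact: powR_ge0.
  by apply: le_lt_trans h _; rewrite ltry.
by split => //; rewrite -lee_fin -integral_EFin_Rintegral.
Qed.

Lemma pmass_integrable q u : finite_energy s u -> 2 <= q <= p ->
  dx.-integrable setT (EFin \o (fun x => `|u x| `^ q)).
Proof.
move=> fu qp; have [C C0 HC] := pmass_gn.
have k0 : 0 < mass u + 1 by rewrite ltr_wpDl ?mass_ge0.
have mk : mass u <= mass u + 1 by rewrite lerDl.
have [Ip _] := HC u _ fu k0 mk.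
have mu : measurable_fun setT u by case: fu => -[].
apply: (integrable_dominated (g := fun x => u x ^+ 2 + `|u x| `^ p)).
- exact: measurable_powabs.
- move=> x; rewrite ger0_norm ?powR_ge0// -[u x ^+ 2]real_normK ?num_real//.
  exact: powR_le_interp.
- have := integrableD measurableT fu.1.2 Ip; by apply: eq_integrable.
Qed.

(** The equation after scaling the L^q norm to 1, q = 2 + theta; the norm factor
    disappears and the integral runs over the whole space. *)
Definition normalized_eigenfunction theta l u := [/\ D0 Omega s u,
  pmass (2 + theta) u = 1 &
  forall phi, D0 Omega s phi ->
    dot dxdy (wd u) (wd phi) = l * \int[dx]_x (`|u x| `^ theta * u x * phi x)].

Lemma D0_off u : D0 Omega s u -> forall x, ~ Omega x -> u x = 0.
Proof. by case. Qed.

Lemma D0_measurable u : D0 Omega s u -> measurable_fun setT u.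
Proof. by case. Qed.

Lemma source_integrable theta u phi : 0 < theta -> 2 + theta <= p ->
  D0 Omega s u -> D0 Omega s phi ->
  dx.-integrable setT (EFin \o (fun x => `|u x| `^ theta * u x * phi x)).
Proof.
move=> t0 tp Du Dphi.
have qp : 2 <= 2 + theta <= p by rewrite tp lerDl ltW.
have Iu := pmass_integrable (D0_finite_energy s01 Du) qp.
have Iphi := pmass_integrable (D0_finite_energy s01 Dphi) qp.
have mu := D0_measurable Du; have mphi := D0_measurable Dphi.
apply: (integrable_dominated
  (g := fun x => `|u x| `^ (2 + theta) + `|phi x| `^ (2 + theta))).
- apply: measurable_funM => //; apply: measurable_funM => //.
  exact: measurable_powabs.
- move=> x; rewrite !normrM (ger0_norm (powR_ge0 _ _)).
  rewrite -[X in _ * X * _]powRr1// -powR_split// -[X in _ * X]powRr1//.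
  rewrite (_ : 2 + theta = (theta + 1) + 1); last by ring.
  by apply: powRM_le_sum => //; rewrite addr_gt0.
- have := integrableD measurableT Iu Iphi; by apply: eq_integrable.
Qed.

Lemma normalized_eigenfunctionN theta l u : 0 < theta -> 2 + theta <= p ->
  normalized_eigenfunction theta l u ->
  normalized_eigenfunction theta l (fun x => -1 * u x).
Proof.
move=> t0 tp [Du u1 uE]; split; first exact: D0Z.
  by rewrite -[RHS]u1; apply: eq_Rintegral => x _; rewrite mulN1r normrN.
move=> phi Dphi; have fu := D0_finite_energy s01 Du.
have fphi := D0_finite_energy s01 Dphi.
rewrite (_ : wd _ = (fun z => -1 * wd u z)); last first.
  by apply/funext => z; rewrite /weighted_diff; ring.
rewrite (dotZl _ fu.2 fphi.2) uE//.
rewrite mulrCA -(RintegralZl (-1) measurableT (source_integrable t0 tp Du Dphi)).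
by congr (_ * _); apply: eq_Rintegral => x _; rewrite mulN1r normrN; ring.
Qed.

Lemma normalized_energy theta l u : 0 < theta ->
  normalized_eigenfunction theta l u -> energy u = l.
Proof.
move=> t0 [Du u1 uE]; rewrite /energy uE// -[RHS]mulr1 -u1; congr (_ * _).
apply: eq_Rintegral => x _; rewrite addrC powR_split// sqr_powR//.
by rewrite real_normK ?num_real// -mulrA expr2.
Qed.

Definition unit_diff u v x : R := (Num.sqrt (mass (fun x => u x - v x)))^-1 * (u x - v x).

Lemma D0B u v : D0 Omega s u -> D0 Omega s v -> D0 Omega s (fun x => u x - v x).
Proof.
move=> Du Dv; have := D0D s01 1 (-1) Du Dv.
by congr D0; apply/funext => x; ring.
Qed.

Lemma unit_diff_D0 u v : D0 Omega s u -> D0 Omega s v -> D0 Omega s (unit_diff u v).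
Proof. by move=> Du Dv; apply: D0Z => //; exact: D0B. Qed.

Lemma unit_diff_mass u v : D0 Omega s u -> D0 Omega s v ->
  0 < mass (fun x => u x - v x) -> mass (unit_diff u v) = 1.
Proof.
move=> Du Dv m0; rewrite /unit_diff (massZ _ (D0_finite_energy s01 (D0B Du Dv))).
by rewrite exprVn sqr_sqrtr ?ltW// mulVf// gt_eqF.
Qed.

(** Test the difference of the two equations with the difference of the
    functions and apply [sgn_pow_diff_le] pointwise. *)
Lemma unit_diff_energy_le theta l u v : 0 < theta < p - 2 -> 0 <= l ->
  normalized_eigenfunction theta l u -> normalized_eigenfunction theta l v ->
  0 < mass (fun x => u x - v x) ->
  energy (unit_diff u v) <= l * ((1 + theta) * (1 + theta / (p - 2) *
    (pmass p u + pmass p v + 2 * pmass p (unit_diff u v)))).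
Proof.
move=> /andP[t0 tp] l0 nu nv m0.
have tp' : 2 + theta <= p by rewrite -lerBrDl ltW.
have [Du _ uE] := nu; have [Dv _ vE] := nv.
pose W x := u x - v x; pose t := Num.sqrt (mass W); pose w := unit_diff u v.
have tt0 : 0 < t by rewrite sqrtr_gt0.
have DW : D0 Omega s W by exact: D0B.
have Dw : D0 Omega s w by exact: unit_diff_D0.
have fu := D0_finite_energy s01 Du; have fv := D0_finite_energy s01 Dv.
have fW := D0_finite_energy s01 DW; have fw := D0_finite_energy s01 Dw.
have WE x : u x - v x = t * w x by rewrite /w /unit_diff mulrA divff ?mul1r// gt_eqF.
pose S x := `|u x| `^ theta * u x - `|v x| `^ theta * v x.
have Iu := source_integrable t0 tp' Du Dw.
have Iv := source_integrable t0 tp' Dv Dw.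
have ES : energy w = l * \int[dx]_x (t^-1 * (S x * w x)).
  have -> : energy w = t^-1 * (dot dxdy (wd u) (wd w) - dot dxdy (wd v) (wd w)).
    rewrite /energy {1}(_ : wd w = (fun z => t^-1 * wd u z + (- t^-1) * wd v z)).
      by rewrite (dotDl _ _ fu.2 fv.2 fw.2); ring.
    by apply/funext => z; rewrite /weighted_diff /w /unit_diff -/t; ring.
  rewrite uE// vE// -mulrBr -(RintegralB measurableT Iu Iv) mulrCA; congr (_ * _).
  rewrite -RintegralZl//.
    by apply: eq_Rintegral => x _; rewrite /S mulrBl.
  by have := integrableB measurableT Iu Iv; apply: eq_integrable.
rewrite -/w ES; apply: ler_wpM2l => //.
have pp : 2 <= p <= p by rewrite lexx ltW// gn_exponent_gt2.
have Ipu := pmass_integrable fu pp; have Ipv := pmass_integrable fv pp.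
have Ipw := pmass_integrable fw pp.
have I2 : dx.-integrable setT (EFin \o (fun x => 2 * `|w x| `^ p)).
  by have := integrableZl measurableT 2 Ipw; apply: eq_integrable.
have I3 : dx.-integrable setT (EFin \o (fun x => `|u x| `^ p + `|v x| `^ p)).
  by have := integrableD measurableT Ipu Ipv; apply: eq_integrable.
have I4 : dx.-integrable setT
    (EFin \o (fun x => `|u x| `^ p + `|v x| `^ p + 2 * `|w x| `^ p)).
  by have := integrableD measurableT I3 I2; apply: eq_integrable.
have I5 : dx.-integrable setT (EFin \o (fun x => theta / (p - 2) *
    (`|u x| `^ p + `|v x| `^ p + 2 * `|w x| `^ p))).
  by have := integrableZl measurableT (theta / (p - 2)) I4; apply: eq_integrable.
have I6 : dx.-integrable setT (EFin \o (fun x => w x ^+ 2 + theta / (p - 2) *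
    (`|u x| `^ p + `|v x| `^ p + 2 * `|w x| `^ p))).
  by have := integrableD measurableT fw.1.2 I5; apply: eq_integrable.
have -> : (1 + theta) * (1 + theta / (p - 2) * (pmass p u + pmass p v + 2 * pmass p w)) =
  \int[dx]_x ((1 + theta) * (w x ^+ 2 + theta / (p - 2) *
    (`|u x| `^ p + `|v x| `^ p + 2 * `|w x| `^ p))).
  rewrite (RintegralZl _ measurableT I6) (RintegralD measurableT fw.1.2 I5).
  rewrite (RintegralZl _ measurableT I4) (RintegralD measurableT I3 I2).
  rewrite (RintegralD measurableT Ipu Ipv) (RintegralZl _ measurableT Ipw).
  by rewrite -(unit_diff_mass Du Dv m0).
apply: le_Rintegral => //.
- have I7 := integrableB measurableT Iu Iv.
  have := integrableZl measurableT t^-1 I7; apply: eq_integrable => // x _ /=.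
  by rewrite /S mulrBl.
- by have := integrableZl measurableT (1 + theta) I6; apply: eq_integrable.
- move=> x _; rewrite mulrC.
  by apply: sgn_pow_diff_le => //; rewrite t0.
Qed.

(** The L^p masses in [unit_diff_energy_le] are bounded by [pmass_gn]: for u and
    v by a constant, for the difference by a multiple of its energy X.  The
    result X <= l + theta (D1 + D2 X) is solved for X. *)
Lemma unit_diff_energy_limit CP L : 0 < CP -> 0 < L ->
  (forall u, D0 Omega s u -> mass u <= CP * energy u) ->
  forall e, 0 < e -> exists2 eta, 0 < eta & forall theta l u v,
    0 < theta < eta -> 0 <= l <= L ->
    normalized_eigenfunction theta l u -> normalized_eigenfunction theta l v ->
    0 < mass (fun x => u x - v x) -> energy (unit_diff u v) <= l + e.
Proof.
move=> CP0 L0 HP e e0; have [C C0 HC] := pmass_gn.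
have r0 : 0 < p - 2 by rewrite subr_gt0 gn_exponent_gt2.
pose k := CP * L; have k0 : 0 < k by rewrite mulr_gt0.
have [P P0 PE] : exists2 P : R, 0 <= P & P = C * k `^ (2 * s / N%:R) * L.
  by eexists; [|reflexivity]; rewrite !mulr_ge0 ?powR_ge0// ltW.
pose D1 := L + 4 * L * P / (p - 2); pose D2 := 4 * L * C / (p - 2).
have D10 : 0 <= D1 by rewrite addr_ge0 ?(ltW L0)// divr_ge0 ?(ltW r0)// !mulr_ge0// ltW.
have D20 : 0 <= D2 by rewrite divr_ge0 ?(ltW r0)// !mulr_ge0// ltW.
pose B := D1 + D2 * (L + e) + 1.
have B0 : 0 < B by rewrite ltr_wpDl// addr_ge0// mulr_ge0// addr_ge0// ltW.
pose eta := Num.min 1 (Num.min (p - 2) (Num.min (e / B) (D2 + 1)^-1)).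
exists eta; first by rewrite !lt_min ltr01 r0 divr_gt0// invr_gt0 ltr_wpDl.
move=> theta l u v /andP[t0]; rewrite !lt_min => /and4P[t1 tr tB tD].
move=> /andP[l0 lL] nu nv m0.
have [Du _ _] := nu; have [Dv _ _] := nv.
have Dw := unit_diff_D0 Du Dv.
have fw := D0_finite_energy s01 Dw.
have pU f : normalized_eigenfunction theta l f -> pmass p f <= P.
  move=> nf; have [Df _ _] := nf; have ff := D0_finite_energy s01 Df.
  have fe := normalized_energy t0 nf.
  have mk : mass f <= k.
    by apply: le_trans (HP f Df) _; rewrite fe ler_wpM2l// ltW.
  have [_ /le_trans] := HC f k ff k0 mk; apply.
  by rewrite fe PE ler_wpM2l// mulr_ge0 ?powR_ge0// ltW.
have pw : pmass p (unit_diff u v) <= C * energy (unit_diff u v).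
  have mw : mass (unit_diff u v) <= 1 by rewrite unit_diff_mass.
  by have [_] := HC _ 1 fw ltr01 mw; rewrite powR1 mulr1.
have tr' : 0 < theta < p - 2 by rewrite t0.
have := unit_diff_energy_le tr' l0 nu nv m0.
have := energy_ge0 s (unit_diff u v); set X := energy _ in pw * => X0 H.
have {H} : X <= l + theta * (D1 + D2 * X).
  apply: le_trans H _.
  set d := theta / (p - 2); set Q := pmass p u + _ + _.
  have d0 : 0 < d by rewrite divr_gt0.
  have QX : Q <= 2 * P + 2 * (C * X) by have := pU u nu; have := pU v nv; rewrite /Q; lra.
  have PX0 : 0 <= 2 * P + 2 * (C * X) by rewrite addr_ge0// !mulr_ge0// ltW.
  apply: (@le_trans _ _ (l * ((1 + theta) * (1 + d * (2 * P + 2 * (C * X)))))).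
    rewrite !ler_wpM2l ?addr_ge0 ?(ltW t0)// lerD2l ler_wpM2l// ltW//.
  set Y := 2 * P + _ in QX PX0 *.
  have dY0 : 0 <= d * Y by rewrite mulr_ge0// ltW.
  have -> : l * ((1 + theta) * (1 + d * Y)) = l + l * (theta + (1 + theta) * (d * Y)) by ring.
  rewrite lerD2l; apply: (@le_trans _ _ (L * (theta + 2 * (d * Y)))).
    apply: ler_pM => //; first by rewrite addr_ge0 ?(ltW t0)// mulr_ge0// addr_ge0// ltW.
    by rewrite lerD2l ler_wpM2r//; lra.
  by rewrite le_eqVlt; apply/orP; left; apply/eqP; rewrite /Y /D1 /D2 /d; field; rewrite gt_eqF.
move=> H; rewrite leNgt; apply/negP => lX.
have tD1 : theta * D2 < 1.
  move: tD; rewrite -[X in _ < X]mul1r ltr_pdivlMr ?ltr_wpDl// mulrDr mulr1; lra.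
have tB1 : theta * B < e by rewrite -ltr_pdivlMr.
have H1 : X * (1 - theta * D2) <= l + theta * D1.
  by move: H; rewrite mulrBr mulr1 mulrDr; set a := theta * (D2 * X);
    rewrite (_ : X * (theta * D2) = a); [lra|rewrite /a; ring].
have H2 : (l + e) * (1 - theta * D2) < X * (1 - theta * D2) by rewrite ltr_pM2r ?subr_gt0.
have H3 : theta * (D2 * (l + e)) <= theta * (D2 * (L + e)).
  by rewrite !ler_wpM2l ?(ltW t0)// lerD2r.
have E1 : (l + e) * (1 - theta * D2) = l + e - theta * (D2 * (l + e)) by ring.
have E2 : theta * B = theta * D1 + theta * (D2 * (L + e)) + theta by rewrite /B; ring.
by rewrite E1 in H2; rewrite E2 in tB1; lra.
Qed.

End eigenfunctions.

(** * Simplicity near exponent 2 *)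
Section simplicity.
Context {R : realType} {N : nat}.
Local Notation E := 'rV[R]_N.
Local Notation dx := (@lebesgue_rV R N).
Local Notation dxdy := (dx \x dx)%E.
Variable s : R.
Hypothesis s01 : 0 < s < 1.
Hypothesis N0 : (0 < N)%N.
Variable Omega : set E.
Implicit Types (u v phi psi f g : E -> R) (x y : E) (q theta e l : R).
Local Notation energy := (energy s).
Local Notation p := (@gn_exponent R N s).

Lemma test_poincare : compact_embedding Omega s ->
  exists2 C : R, 0 < C & forall phi, test_function Omega phi -> mass phi <= C * energy phi.
Proof.
move=> [[C HC] _]; exists (`|C| + 1); first by rewrite ltr_wpDl.
move=> phi tphi; have := HC phi tphi.
have fphi := test_finite_energy s01 tphi.
have := Lnorm2_sqr (test_function_off tphi); rewrite (dotE fphi.1).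
rewrite (gagliardo_sq_energy fphi) -EFinM.
have := Lnorm_ge0 dx 2%:E ((EFin \o phi) \_ Omega); rewrite -/(Lnorm_on Omega 2 phi).
case: (Lnorm_on Omega 2 phi) => [a| |]//.
rewrite lee_fin poweR_EFin => a0 [aE]; rewrite -EFin_expe lee_fin -sqr_powR// aE.
move=> /le_trans; apply; rewrite ler_wpM2r ?energy_ge0//.
by rewrite (le_trans (ler_norm _))// lerDl.
Qed.

(** The constant is not sharp; it serves only to bound the L^2 norms of
    eigenfunctions. *)
Lemma D0_poincare C : 0 < C ->
  (forall phi, test_function Omega phi -> mass phi <= C * energy phi) ->
  forall u, D0 Omega s u -> mass u <= 4 * C * energy u.
Proof.
move=> C0 HC u Du; apply/ler_addgt0Pr => e e0.
pose d := e / (2 + 4 * C).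
have k0 : 0 < 2 + 4 * C by rewrite addr_gt0// mulr_gt0.
have d0 : 0 < d by rewrite divr_gt0.
have [phi [tphi m q]] := D0_dense s01 Du d0.
have fu := D0_finite_energy s01 Du; have fphi := test_finite_energy s01 tphi.
have h1 := mass_near_le ltr01 fu fphi; have h2 := energy_near_le ltr01 fphi fu.
have h3 := ler_wpM2l (ltW C0) h2; have h4 := HC phi tphi.
have E1 : energy (fun x => phi x - u x) = energy (fun x => u x - phi x).
  rewrite -[RHS]mul1r -(expr1n _ 2) -sqrrN -energyZ; last exact: finite_energyB.
  by congr energy; apply/funext => x; ring.
rewrite E1 in h3; have h5 := ler_wpM2l (ltW C0) q.
have E2 : e = d * (2 + 4 * C) by rewrite /d divfK// gt_eqF.
rewrite E2; move: h1 h3; rewrite invr1 !mulrDr !mulrDl !mul1r; lra.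
Qed.

Lemma eigenfunction_normalize theta l u : 0 < theta -> 2 + theta <= p ->
  eigenfunction Omega s (2 + theta) l u ->
  exists2 c : R, 0 < c & normalized_eigenfunction s Omega theta l (fun x => c * u x).
Proof.
move=> t0 tp [Du u0 uE]; have fu := D0_finite_energy s01 Du.
have q0 : 0 < 2 + theta by rewrite addr_gt0.
have qp : 2 <= 2 + theta <= p by rewrite tp lerDl ltW.
have Iu := pmass_integrable s01 N0 fu qp.
have mu := D0_measurable Du.
pose I := pmass (2 + theta) u.
have I0 : 0 < I.
  rewrite lt_neqAle; apply/andP; split; last first.
    by apply: Rintegral_ge0 => x _; exact: powR_ge0.
  apply/negP => /eqP I0; apply: u0.
  have mm : measurable_fun setT (EFin \o (fun x => `|u x| `^ (2 + theta))).
    by case/integrableP: Iu.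
  have : (\int[dx]_x `|(EFin \o (fun x => `|u x|%R `^ (2 + theta))%R) x| = 0)%E.
    rewrite -[RHS]/(0%:E) I0 -(integral_EFin_Rintegral Iu).
    by apply: eq_integral => x _ /=; rewrite ger0_norm// powR_ge0.
  move=> /(ae_eq_integral_abs dx measurableT mm).1; apply: filterS => x /(_ Logic.I) /= [] .
  by move=> /powR_eq0_eq0 /eqP; rewrite normr_eq0 => /eqP.
pose A := fine (Lnorm_on Omega (2 + theta) u).
have LE : (Lnorm_on Omega (2 + theta) u `^ (2 + theta) = I%:E)%E.
  by rewrite (Lnorm_on_powR q0 (D0_off Du)) (integral_EFin_Rintegral Iu).
have A0' := Lnorm_ge0 dx (2 + theta)%:E ((EFin \o u) \_ Omega).
have AE : A `^ (2 + theta) = I.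
  move: LE A0'; rewrite /A -/(Lnorm_on Omega (2 + theta) u).
  case: (Lnorm_on _ _ _) => [a| |]//; first by rewrite poweR_EFin => -[].
  by rewrite poweRyr ?gt_eqF.
have A0 : 0 < A.
  rewrite lt_neqAle fine_ge0// andbT; apply/negP => /eqP A0.
  by move: AE I0; rewrite -A0 powR0 ?gt_eqF// => <-; rewrite ltxx.
exists A^-1; first by rewrite invr_gt0.
have Ai0 : 0 <= A^-1 by rewrite invr_ge0 ltW.
split; first exact: D0Z.
  transitivity (\int[dx]_x (I^-1 * `|u x| `^ (2 + theta))).
    apply: eq_Rintegral => x _; rewrite normrM (ger0_norm Ai0) powRM//.
    by rewrite invr_powR ?ltW// AE.
  by rewrite (RintegralZl _ measurableT Iu) -/(pmass (2 + theta) u) -/I mulVf// gt_eqF.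
move=> phi Dphi; have fphi := D0_finite_energy s01 Dphi.
have Is := source_integrable s01 N0 t0 tp Du Dphi.
rewrite (_ : weighted_diff s _ = (fun z => A^-1 * weighted_diff s u z)); last first.
  by apply/funext => z; rewrite /weighted_diff; ring.
rewrite (dotZl _ fu.2 fphi.2) -gagliardo_formE uE// -/A.
have thE : 2 + theta - 2 = theta by ring.
have thN : 2 - (2 + theta) = - theta by ring.
rewrite thE thN Rintegral_mkcond.
rewrite (_ : \int[dx]_x ((fun x => _) \_ Omega) x =
             \int[dx]_x (`|u x| `^ theta * u x * phi x)); last first.
  apply: eq_Rintegral => x _; rewrite /patch; case: ifPn => // /negP nx.
  rewrite (D0_off Du) ?mulr0 ?mul0r// => Ox; apply: nx; by rewrite inE.
rewrite [LHS](_ : _ = l * (A^-1 * A `^ (- theta) *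
  \int[dx]_x (`|u x| `^ theta * u x * phi x))); last by ring.
congr (_ * _).
transitivity (\int[dx]_x (A^-1 * A `^ (- theta) * (`|u x| `^ theta * u x * phi x))).
  by rewrite RintegralZl.
apply: eq_Rintegral => x _; rewrite normrM (ger0_norm Ai0) powRM// invr_powR ?ltW//.
by rewrite powRN; ring.
Qed.

Lemma lambda1_2_gt0 C phi0 : 0 < C ->
  (forall phi, test_function Omega phi -> mass phi <= C * energy phi) ->
  test_function Omega phi0 -> 0 < mass phi0 -> 0 < fine (lambda1 Omega s 2).
Proof.
move=> C0 HC tphi0 m0; have m0' : 0 < pmass 2 phi0 by rewrite pmass2.
apply: (@lt_le_trans _ _ C^-1); first by rewrite invr_gt0.
rewrite -lee_fin -(lambda1_fin s01 (ltr0n R 2) tphi0 m0').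
apply: le_ereal_inf_tmp => _ [phi [tphi I1] <-].
have mphi : mass phi = 1.
  apply: EFin_inj; rewrite -I1 integral_on_Omega.
    rewrite (integral_EFin_Rintegral (test_pmass_integrable (ltr0n R 2) tphi)).
    by rewrite -pmass2.
  by move=> x Ox; rewrite (test_function_off tphi)// normr0 powR0// pnatr_eq0.
rewrite (gagliardo_sq_energy (test_finite_energy s01 tphi)) lee_fin.
by rewrite -(ler_pM2l C0) divff ?gt_eqF// -mphi; exact: HC.
Qed.

(** The form on u - v and u + v is the difference of the two energies, which are
    both equal to l. *)
Lemma unit_diff_orthogonal theta l u v : 0 < theta -> 2 + theta <= p ->
  normalized_eigenfunction s Omega theta l u ->
  normalized_eigenfunction s Omega theta l v ->
  dot dxdy (weighted_diff s (unit_diff u v))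
           (weighted_diff s (unit_diff u (fun x => -1 * v x))) = 0.
Proof.
move=> t0 tp nu nv; have [Du _ _] := nu; have [Dv _ _] := nv.
have fu := D0_finite_energy s01 Du; have fv := D0_finite_energy s01 Dv.
set a := (Num.sqrt (mass (fun x => u x - v x)))^-1.
set b := (Num.sqrt (mass (fun x => u x - -1 * v x)))^-1.
rewrite [X in dot _ X](_ : _ =
  (fun z => a * weighted_diff s u z + (- a) * weighted_diff s v z)); last first.
  by apply/funext => z; rewrite /weighted_diff /unit_diff -/a; ring.
rewrite [X in dot _ _ X](_ : _ =
  (fun z => b * weighted_diff s u z + b * weighted_diff s v z)); last first.
  by apply/funext => z; rewrite /weighted_diff /unit_diff -/b; ring.
have Lb := L2funD b b fu.2 fv.2.
rewrite (dotDl _ _ fu.2 fv.2 Lb) !(dotC _ _ (fun z => b * _ + _)).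
rewrite !dotDl ?fu.2 ?fv.2//; try exact: fu.2; try exact: fv.2.
rewrite -/(energy u) -/(energy v).
have -> : energy u = l by exact: normalized_energy nu.
have -> : energy v = l by exact: normalized_energy nv.
by rewrite (dotC _ (weighted_diff s v)); ring.
Qed.

(** Functions that are not proportional stay distinct under every scaling; in
    particular both the difference and the sum of their normalizations are
    nonzero. *)
Lemma mass_diff_gt0 c d u v : 0 < c -> D0 Omega s u -> D0 Omega s v ->
  ~ (exists k : R, {ae dx, forall x, u x = k * v x}) ->
  0 < mass (fun x => c * u x - d * v x).
Proof.
move=> c0 Du Dv np; rewrite lt_neqAle mass_ge0 andbT; apply/negP => /eqP m0.
have fW : finite_energy s (fun x => c * u x - d * v x).
  by apply: (@D0_finite_energy _ _ _ s01 Omega); apply: D0B => //; exact: D0Z.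
apply: np; exists (d / c); have := dot0_ae fW.1 (esym m0).
apply: filterS => x /eqP; rewrite subr_eq0 => /eqP E1.
by rewrite mulrAC -E1 [c * _]mulrC mulfK// gt_eqF.
Qed.

Lemma exists_test_mass_gt0 theta l u : 0 < theta ->
  normalized_eigenfunction s Omega theta l u ->
  exists phi, test_function Omega phi /\ 0 < mass phi.
Proof.
move=> t0 [Du u1 _]; have fu := D0_finite_energy s01 Du.
have m0 : 0 < mass u.
  rewrite lt_neqAle mass_ge0 andbT; apply/negP => /eqP m0.
  have := dot0_ae fu.1 (esym m0) => u0.
  have : pmass (2 + theta) u = 0.
    rewrite /pmass /Rintegral (@ae_eq_integral _ _ _ dx setT (cst 0%E)) ?integral0//.
      apply/measurable_EFinP; exact: (measurable_powabs _ (D0_measurable Du)).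
    apply: filterS u0 => x ux _ /=; rewrite ux normr0 powR0// gt_eqF//.
    by rewrite addr_gt0.
  by rewrite u1 => /eqP; rewrite oner_eq0.
have d0 : 0 < mass u / 4 by rewrite divr_gt0.
have [phi [tphi m _]] := D0_dense s01 Du d0.
exists phi; split => //.
have := mass_near_le ltr01 fu (test_finite_energy s01 tphi).
rewrite invr1; lra.
Qed.

Lemma gn_exponent_subcritical : (p%:E < @critical_exponent R N s)%E.
Proof.
rewrite /critical_exponent; case: ifPn => [sN|_]; last by rewrite ltry.
have s0 : 0 < s by case/andP: s01.
have n0 : 0 < N%:R :> R by rewrite ltr0n.
have d0 : 0 < N%:R - 2 * s by rewrite subr_gt0.
rewrite lte_fin ltr_pdivlMr// /gn_exponent -subr_gt0.
rewrite (_ : _ - _ = 8 * s ^+ 2 / N%:R); last by field; rewrite gt_eqF.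
by rewrite divr_gt0// mulr_gt0// exprn_gt0.
Qed.

(** Failure at exponents tending to 2 would give, through normalized differences
    and sums, the sequences excluded by [no_orthogonal_near_minimizers]. *)
Lemma simple_near_2 : open Omega -> compact_embedding Omega s ->
  exists2 r : R, 0 < r <= p - 2 &
    forall theta, 0 < theta < r -> lambda1_simple Omega s (2 + theta).
Proof.
move=> oO cpt; apply: contrapT => nsimple.
have r0 : 0 < p - 2 by rewrite subr_gt0 gn_exponent_gt2.
pose lam theta := fine (lambda1 Omega s (2 + theta)).
have bad n : exists x : R * ((E -> R) * (E -> R)),
    [/\ 0 < x.1 < (p - 2) / n.+1%:R,
      normalized_eigenfunction s Omega x.1 (lam x.1) x.2.1,
      normalized_eigenfunction s Omega x.1 (lam x.1) x.2.2,
      0 < mass (fun y => x.2.1 y - x.2.2 y) &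
      0 < mass (fun y => x.2.1 y - -1 * x.2.2 y)].
  apply: contrapT => nbad; apply: nsimple; exists ((p - 2) / n.+1%:R).
    by rewrite divr_gt0//= ler_pdivrMr// ler_peMr ?(ltW r0)// ler1n.
  move=> theta tn u v eu ev; apply: contrapT => np; apply: nbad.
  have /andP[t0 t1] := tn.
  have tp : 2 + theta <= p.
    rewrite -lerBrDl; apply: le_trans (ltW t1) _.
    by rewrite ler_pdivrMr// ler_peMr ?(ltW r0)// ler1n.
  have [c c0 nu] := eigenfunction_normalize t0 tp eu.
  have [d d0 nv] := eigenfunction_normalize t0 tp ev.
  have Du : D0 Omega s u by case: eu.
  have Dv : D0 Omega s v by case: ev.
  exists (theta, ((fun x => c * u x), (fun x => d * v x))); split => //=.
    exact: (mass_diff_gt0 d c0 Du Dv np).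
  have := mass_diff_gt0 (- d) c0 Du Dv np.
  by congr (_ < mass _); apply/funext => x; ring.
have {bad}/choice[X HX] := bad.
pose th n := (X n).1; pose U n := (X n).2.1; pose V n := (X n).2.2.
have th0 n : 0 < th n by case: (HX n) => /andP[].
have thr n : th n < (p - 2) / n.+1%:R by case: (HX n) => /andP[].
have thp n : 2 + th n <= p.
  rewrite -lerBrDl; apply: le_trans (ltW (thr n)) _.
  by rewrite ler_pdivrMr// ler_peMr ?(ltW r0)// ler1n.
have nU n : normalized_eigenfunction s Omega (th n) (lam (th n)) (U n) by case: (HX n).
have nV n : normalized_eigenfunction s Omega (th n) (lam (th n)) (V n) by case: (HX n).
pose V' n x := -1 * V n x.
have nV' n : normalized_eigenfunction s Omega (th n) (lam (th n)) (V' n).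
  exact: normalized_eigenfunctionN.
have mU n : 0 < mass (fun y => U n y - V n y) by case: (HX n).
have mU' n : 0 < mass (fun y => U n y - V' n y) by case: (HX n).
have DU n : D0 Omega s (U n) by case: (nU n).
have DV n : D0 Omega s (V n) by case: (nV n).
have DV' n : D0 Omega s (V' n) by case: (nV' n).
have [phi0 [tphi0 m0]] := exists_test_mass_gt0 (th0 0%N) (nU 0%N).
have [C C0 HC] := test_poincare cpt.
have l0 := lambda1_2_gt0 C0 HC tphi0 m0.
set l := fine (lambda1 Omega s 2) in l0.
have CP0 : 0 < 4 * C by rewrite mulr_gt0.
have L0 : 0 < l + 1 by rewrite addr_gt0.
have th_small (eta : R) : 0 < eta -> \forall n \near \oo, th n < eta.
  move=> e0; have d0 : 0 < eta / (p - 2) by rewrite divr_gt0.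
  have /cvgrPdist_lt/(_ _ d0) := @cvg_harmonic R; apply: filterS => n /=.
  rewrite sub0r normrN ger0_norm// => hn; apply: lt_trans (thr n) _.
  by rewrite mulrC -ltr_pdivlMr.
have lim (V1 : nat -> E -> R) :
    (forall n, normalized_eigenfunction s Omega (th n) (lam (th n)) (V1 n)) ->
    (forall n, 0 < mass (fun y => U n y - V1 n y)) ->
    forall e, 0 < e -> \forall n \near \oo, energy (unit_diff (U n) (V1 n)) <= l + e.
  move=> nV1 mV1 e e0; have e2 : 0 < e / 2 by rewrite divr_gt0.
  have [eta1 eta10 H1] := unit_diff_energy_limit s01 N0 CP0 L0 (D0_poincare C0 HC) e2.
  have [eta2 eta20 H2] := lambda1_limsup s01 tphi0 m0 e2.
  have [eta3 eta30 H3] := lambda1_limsup s01 tphi0 m0 ltr01.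
  apply: filterS3 (th_small _ eta10) (th_small _ eta20) (th_small _ eta30) => n t1 t2 t3.
  have lL : 0 <= lam (th n) <= l + 1.
    by rewrite fine_ge0 ?lambda1_ge0//=; apply: H3; rewrite th0.
  have t1' : 0 < th n < eta1 by rewrite th0.
  apply: le_trans (H1 _ _ _ _ t1' lL (nU n) (nV1 n) (mV1 n)) _.
  have : lam (th n) <= l + e / 2 by apply: H2; rewrite th0.
  lra.
apply: (@no_orthogonal_near_minimizers _ _ s s01 Omega oO l
  (fun n => unit_diff (U n) (V n)) (fun n => unit_diff (U n) (V' n))) => //.
- by move=> phi tphi; exact: lambda1_2_le.
- by move=> n; exact: unit_diff_D0.
- by move=> n; exact: unit_diff_D0.
- by move=> n; exact: (unit_diff_mass s01 (DU n) (DV n)).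
- by move=> n; exact: (unit_diff_mass s01 (DU n) (DV' n)).
- by move=> n; exact: (unit_diff_orthogonal (th0 n) (thp n) (nU n) (nV n)).
- exact: lim.
- exact: lim.
Qed.

End simplicity.

Theorem proposition3p7 (R : realType) (N : nat) (s : R) (Omega : set 'rV[R]_N)
    (hN : (1 <= N)%N) (hs : 0 < s < 1) (oOmega : open Omega)
    (hOmega : compact_embedding Omega s) :
  exists qOmega : R,
    [/\ 2 < qOmega, (qOmega%:E < @critical_exponent R N s)%E &
        forall q : R, 2 < q < qOmega -> lambda1_simple Omega s q].
Proof.
have [r /andP[r0 rp] Hr] := simple_near_2 hs hN oOmega hOmega.
exists (2 + r); split.
- by rewrite ltrDl.
- apply: le_lt_trans (gn_exponent_subcritical hs hN).
  by rewrite lee_fin -lerBrDl.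
- move=> q /andP[q2 qr]; rewrite -(subrKC 2 q); apply: Hr.
  by rewrite subr_gt0 q2 ltrBlDl.
Qed.
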